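(* For $i\in\{1,2\}$ let $\ell_i=\ell_i(n)\ge 3$ be either a constant (independent of $n$) or an integer sequence tending to $+\infty$ as $n\to+\infty$, such that $\ell_2(n)<\ell_1(n)$ for all $n$ and $\ell_1/\log n\to 0$. Let $0<p=p(n)<1$ be such that $p\,\ell_1^{9}\to 0$ and $n^2p^{\ell_1}\ell_1^{-9}\to+\infty$. Assume that $np^{\ell_1-1}\ell_1$ has a limit in $[0,+\infty]$ as $n\to+\infty$. Then $$ \left(\frac{X_{\ell_1}-\mathbb{E}(X_{\ell_1})}{\sigma_{\ell_1}},\frac{X_{\ell_2}-\mathbb{E}(X_{\ell_2})}{\sigma_{\ell_2}}\right)\stackrel{d}{\longrightarrow}\mathrm{N}\left(\begin{pmatrix}0\\0\end{pmatrix},\begin{pmatrix}1&\kappa_{\ell_1,\ell_2}\\ \kappa_{\ell_1,\ell_2}&1\end{pmatrix}\right), $$ where $\kappa_{\ell_1,\ell_2}$ satisfies: - $\kappa_{\ell_1,\ell_2}=0$ if $np^{\ell_1-1}\ell_1\to 0$; - $0<\kappa_{\ell_1,\ell_2}<1$ if either $np^{\ell_1-1}\ell_1\to c$ for some $c\in\mathbb{R}_+$ (i.e. $0<c<+\infty$), or $np^{\ell_1-1}\ell_1\to+\infty$ and $\ell_2$ is a constant; - $\kappa_{\ell_1,\ell_2}=1$ if $np^{\ell_1-1}\ell_1\to+\infty$ and $\ell_2=\ell_2(n)\to+\infty$.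
   Context: For $n\in\mathbb{N}$ write $[n]:=\{1,\dots,n\}$. For $3\le\ell\le n$, an $\ell$-AP in $[n]$ is a set $\{a,a+b,\dots,a+(\ell-1)b\}\subseteq[n]$ with integers $a$ and $b\ge 1$; let $\mathcal{A}_\ell$ be the set of all $\ell$-APs in $[n]$. For $p\in[0,1]$, $[n]_p$ is the random subset of $[n]$ that contains each element independently with probability $p$. Put $X_\ell:=\sum_{T\in\mathcal{A}_\ell}\mathbf{1}_{\{T\subseteq[n]_p\}}$ and $\sigma_\ell:=\sqrt{\mathbb{V}(X_\ell)}$ (standard deviation). Both $X_{\ell_1}$ and $X_{\ell_2}$ are computed from the same random set $[n]_p$. The number $\kappa_{\ell_1,\ell_2}$ is the limiting correlation $\kappa_{\ell_1,\ell_2}:=\lim_{n\to+\infty}\mathbb{E}\big[(X_{\ell_1}-\mathbb{E}X_{\ell_1})(X_{\ell_2}-\mathbb{E}X_{\ell_2})\big]/(\sigma_{\ell_1}\sigma_{\ell_2})$. $\mathrm{N}(\mu,\Sigma)$ is the bivariate (possibly degenerate) Gaussian distribution with mean vector $\mu$ and covariance matrix $\Sigma$; $\stackrel{d}{\longrightarrow}$ is convergence in distribution as $n\to+\infty$. *)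

(* Defs.v *)
From HB Require Import structures.
From mathcomp Require Import all_boot all_order all_algebra.
From mathcomp Require Import all_classical all_reals all_analysis.

Set Implicit Arguments.
Unset Strict Implicit.
Unset Printing Implicit Defensive.

Import Order.TTheory GRing.Theory Num.Theory.
Import numFieldNormedType.Exports.

Local Open Scope classical_set_scope.
Local Open Scope ring_scope.

(* The ground set [n] = {1, ..., n} is represented by 'I_n: the ordinal i
   stands for the integer i.+1. *)
Definition APs (n l : nat) : {set {set 'I_n}} :=
  [set A : {set 'I_n} | `[< exists a b : nat,
     [/\ (1 <= a)%N, (1 <= b)%N, (a + l.-1 * b <= n)%N
       & forall i : 'I_n,
           i \in A <-> exists2 k : nat, (k < l)%N & i.+1 = (a + k * b)%N] >]]%SET.

Definition independent_events (d : measure_display) (T : measurableType d)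
    (R : realType) (P : probability T R) (I : finType) (E : I -> set T) : Prop :=
  forall J : {set I},
    P (\bigcap_(i in [set` J]) E i) = (\prod_(i in J) fine (P (E i)))%:E.

(* S has the law of the random subset [n]_p. *)
Definition binomial_subset (d : measure_display) (T : measurableType d)
    (R : realType) (P : probability T R) (n : nat) (S : T -> {set 'I_n})
    (p : R) : Prop :=
  [/\ forall i : 'I_n, measurable [set w | i \in S w],
      forall i : 'I_n, P [set w | i \in S w] = p%:E
    & independent_events P (fun i : 'I_n => [set w | i \in S w])].

Definition AP_count (R : realType) (T : Type) (n : nat) (S : T -> {set 'I_n})
    (l : nat) (w : T) : R :=
  \sum_(A in APs n l) (A \subset S w)%:R.

Section moments.
Context (d : measure_display) (T : measurableType d) (R : realType).
Variable P : probability T R.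
Implicit Types X Y : T -> R.

Definition std_dev X : R := Num.sqrt (fine 'V_P[X]).

Definition standardize X : T -> R :=
  fun w => (X w - fine 'E_P[X]) / std_dev X.

Definition correlation X Y : R :=
  fine (covariance P X Y) / (std_dev X * std_dev Y).

End moments.

(* N is the normal law on R^2 with mean vector mu and covariance matrix Sigma,
   i.e., the law of mu + A Z with A A^T = Sigma and Z a pair of independent
   standard normal variables. A may be singular, so degenerate laws are
   included. (normal_prob m 0 cannot be used for them: it is the uniform law
   on [0, 1], not the Dirac mass at m.) *)
Definition bivariate_normal (R : realType)
    (N : probability (measurableTypeR R * measurableTypeR R)%type R)
    (mu : R * R) (Sigma : 'M[R]_2) : Prop :=
  exists2 A : 'M[R]_2, A *m A^T = Sigma &
    forall B : set (measurableTypeR R * measurableTypeR R), measurable B ->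
      N B = (normal_prob 0 1 \x normal_prob 0 1)%E
        [set z : R * R | B (mu.1 + A 0 0 * z.1 + A 0 1 * z.2,
                            mu.2 + A 1 0 * z.1 + A 1 1 * z.2)].

(* The n-th random vector may live on its own probability space. *)
Definition cvg_in_distribution (R : realType) (d : nat -> measure_display)
    (T : forall n, measurableType (d n)) (P : forall n, probability (T n) R)
    (Z : forall n, T n -> R * R)
    (N : probability (measurableTypeR R * measurableTypeR R)%type R) : Prop :=
  forall f : R * R -> R, continuous f ->
    (exists M : R, forall z, `|f z| <= M) ->
    ('E_(P n)[f \o Z n])%E @[n --> \oo] --> (\int[N]_z (f z)%:E)%E.

(* Sequences are indexed by the positive integers; the term of index 0 is
   irrelevant. *)
Definition constant_seq (l : nat -> nat) : Prop :=
  exists c : nat, forall n : nat, (0 < n)%N -> l n = c.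

(* Main.v *)
(** The two counts are sums, over progressions a, of indicators of the events
    that a is contained in the random set, and such indicators are independent
    unless the progressions meet. For a linear combination W of the two
    standardized counts, Stein's method shows that E cos (lambda W + c), as a
    function of lambda, solves the Gaussian differential equation up to an error
    controlled by the triples of progressions that hang together. These triples
    are counted through the number of progressions meeting a given set in one
    point (of total weight about n p^(l-1)) or in two points (at most l^2 for each
    pair), and
    their contribution vanishes in the regime of the theorem. Convergence of all
    E cos (s Z1 + t Z2 + c) together with bounded second moments gives
    convergence in distribution, by approximating test functions on large boxes
    by trigonometric polynomials.

    For the correlation, pairs of progressions meeting in exactly one point
    contribute p^(l1+l2-1) (1-p) sum_x f1(x) f2(x) to the covariance, where fi(x)
    is the number of li-progressions through x; the other pairs contribute about
    E Xi to the variances and a negligible amount to the covariance. As fi(x) is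
    close to n phi_i(x/n) for an explicit profile phi_i, the sums of products
    are Riemann sums converging to a Gram matrix J. The limit is then
    J12 / sqrt (J22 (J11 + M1 / theta)) with theta = lim n p^(l1-1) l1 and
    M1 > 0. Cauchy-Schwarz is strict when l2 is constant, since the profiles are
    not proportional near 0, and is an equality when l2 tends to infinity, since
    all profiles converge to the same function. *)

(* The lengths may grow with [n], so every estimate is uniform in them and tracks the powers of
   [l1]; the two exponents 9 of the hypotheses pay for these powers. The family [l1] is the delicate
   one: its inverse deviation is only known to be of smaller order than [l1 ^ -4], which cannot
   absorb crude overlap factors of order [l1 ^ 8]. Since [l2 < l1], the other mean count has an
   additional factor [1 / p], and [l1 ^ 8] times its inverse deviation does tend to 0. Hence triples
   inside one family are counted with the coincidences [c = a] split off, after which overlaps in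
   two points or more carry a factor [p], while mixed triples always contain the smaller inverse
   deviation and admit the crude count.

   Cosines with a free phase replace characteristic functions: everything stays real, and one
   stability estimate for the differential equation yields both the limit theorem and the Fourier
   transform of the normal law.

   The known Lipschitz constant of a profile grows with the length. Convergence of Riemann sums with
   varying profiles is therefore reduced to one fixed profile, by a comparison of profiles whose
   rate does not depend on the point. *)
Require Import Defs.
From HB Require Import structures.
From mathcomp Require Import all_boot all_order all_algebra.
From mathcomp Require Import all_classical all_reals all_analysis.
From mathcomp Require Import measurable_realfun.
From mathcomp Require Import ring lra zify.

Set Implicit Arguments.
Unset Strict Implicit.
Unset Printing Implicit Defensive.

Import Order.TTheory GRing.Theory Num.Theory.
Import numFieldNormedType.Exports.

Local Open Scope classical_set_scope.
Local Open Scope ring_scope.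

(** * The finite Bernoulli model *)

Section bernoulli_model.
Context (R : realType) (I : finType) (p : R).
Hypothesis p01 : 0 <= p <= 1.
Implicit Types (A B C : {set I}) (f g : {set I} -> R).

(** Restricting the product to [B] lets the weight on the full set split into a weight on [B] and
    one on its complement; [bern_mean_indep] rests on this. *)
Definition bern_weight B A : R := \prod_(i in B) (if i \in A then p else 1 - p).

Definition bern_mean f : R := \sum_(A : {set I}) bern_weight [set: I]%SET A * f A.

Local Notation Ex := bern_mean.

Lemma bern_weight_ge0 B A : 0 <= bern_weight B A.
Proof. by apply: prodr_ge0 => i _; case: ifP => _; move: p01; lra. Qed.

Lemma sum_set_prod (F G : I -> R) :
  \sum_(A : {set I}) \prod_i (if i \in A then F i else G i)
  = \prod_i (F i + G i).
Proof. by rewrite bigA_distr. Qed.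

Lemma bern_mean_subset B : Ex (fun A => (B \subset A)%:R) = p ^+ #|B|.
Proof.
(* The indicator is absorbed into the product: a coordinate of [B] missing from [A] gets weight 0,
   so that [sum_set_prod] applies. *)
transitivity (\sum_(A : {set I})
    \prod_i (if i \in A then p else if i \in B then 0 else 1 - p)).
  apply: eq_bigr => A _; rewrite /bern_weight.
  have [BA|] := boolP (B \subset A).
    rewrite mulr1; apply: eq_big => i; rewrite ?inE// => _.
    case: ifPn => // iA; case: ifP => // iB.
    by rewrite (fintype.subsetP BA _ iB) in iA.
  case/subsetPn => x xB xA.
  by rewrite mulr0 (bigD1 x)//= (negbTE xA) xB mul0r.
rewrite sum_set_prod (bigID (mem B))/= [X in _ * X]big1 ?mulr1; last first.
  by move=> i /negbTE ->; rewrite addrC subrK.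
rewrite -[RHS]prodr_const; apply: eq_bigr => i /= ->.
by rewrite addr0.
Qed.

Lemma bern_mean1 : Ex (fun=> 1) = 1.
Proof.
rewrite -[RHS](expr0 p) -(cards0 I) -bern_mean_subset.
by apply: eq_bigr => A _; rewrite finset.sub0set.
Qed.

Lemma bern_meanD f g : Ex (fun A => f A + g A) = Ex f + Ex g.
Proof. by rewrite -big_split; apply: eq_bigr => A _; rewrite mulrDr. Qed.

Lemma bern_meanZ c f : Ex (fun A => c * f A) = c * Ex f.
Proof. by rewrite /Ex mulr_sumr; apply: eq_bigr => A _; rewrite mulrCA. Qed.

Lemma bern_meanN f : Ex (fun A => - f A) = - Ex f.
Proof. by rewrite -mulN1r -bern_meanZ; apply: eq_bigr => A _; rewrite mulN1r. Qed.

Lemma bern_meanB f g : Ex (fun A => f A - g A) = Ex f - Ex g.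
Proof. by rewrite bern_meanD bern_meanN. Qed.

Lemma bern_mean_cst c : Ex (fun=> c) = c.
Proof.
by rewrite -[RHS]mulr1 -bern_mean1 -bern_meanZ; apply: eq_bigr => A _; rewrite mulr1.
Qed.

Lemma bern_mean_sum (J : Type) (s : seq J) (P : pred J) (F : J -> {set I} -> R) :
  Ex (fun A => \sum_(j <- s | P j) F j A) = \sum_(j <- s | P j) Ex (F j).
Proof. by rewrite /Ex exchange_big/=; apply: eq_bigr => A _; rewrite mulr_sumr. Qed.

Lemma eq_bern_mean f g : f =1 g -> Ex f = Ex g.
Proof. by move=> fg; apply: eq_bigr => A _; rewrite fg. Qed.

Lemma le_bern_mean f g : (forall A, f A <= g A) -> Ex f <= Ex g.
Proof. by move=> fg; apply: ler_sum => A _; rewrite ler_wpM2l ?bern_weight_ge0. Qed.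

Lemma bern_mean_ge0 f : (forall A, 0 <= f A) -> 0 <= Ex f.
Proof. by move=> fg; apply: sumr_ge0 => A _; rewrite mulr_ge0 ?bern_weight_ge0. Qed.

Lemma ler_norm_bern_mean f : `|Ex f| <= Ex (fun A => `|f A|).
Proof.
apply: le_trans (ler_norm_sum _ _ _) _; apply: ler_sum => A _.
by rewrite normrM (ger0_norm (bern_weight_ge0 _ _)).
Qed.

Lemma bern_mean_indep B f g :
  (forall A, f A = f (A :&: B)) -> (forall A, g A = g (A :\: B)) ->
  Ex (fun A => f A * g A) = Ex f * Ex g.
Proof.
move=> fB gB.
pose F h := \sum_(A : {set I} | A \subset B) bern_weight B A * h A.
pose G h := \sum_(A : {set I} | A \subset ~: B) bern_weight (~: B) A * h A.
have split f' g' : (forall A, f' A = f' (A :&: B)) ->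
    (forall A, g' A = g' (A :\: B)) -> Ex (fun A => f' A * g' A) = F f' * G g'.
  move=> fB' gB'; rewrite /F mulr_suml.
  under [RHS]eq_bigr do rewrite mulr_sumr.
  rewrite pair_big/=.
  rewrite [RHS](reindex_onto (fun A => (A :&: B, A :\: B))
    (fun q => q.1 :|: q.2))/=; last first.
    move=> [A1 A2]/= /andP[A1B A2B]; congr pair; apply/setP => i; rewrite !inE.
      have := fintype.subsetP A1B i; have := fintype.subsetP A2B i; rewrite !inE.
      by case: (i \in A1); case: (i \in A2); case: (i \in B) => //=; move=> H1 H2; (try by have:= H1 isT); (try by have := H2 isT).
    have := fintype.subsetP A1B i; have := fintype.subsetP A2B i; rewrite !inE.
    by case: (i \in A1); case: (i \in A2); case: (i \in B) => //=; move=> H1 H2; (try by have:= H1 isT); (try by have := H2 isT).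
  apply: eq_big => [A|A _].
    rewrite finset.subsetIr finset.setDE finset.subsetIr/=.
    by apply/esym/eqP/setP => i; rewrite !inE; case: (i \in A); case: (i \in B).
  have -> : bern_weight [set: I]%SET A
      = bern_weight B (A :&: B) * bern_weight (~: B) (A :\: B).
    rewrite /bern_weight (bigID (mem B))/=; congr (_ * _).
      by apply: eq_big => i; rewrite !inE//= => ->; rewrite andbT.
    by apply: eq_big => i; rewrite !inE//= => ->.
  by rewrite (fB' A) (gB' A) mulrACA.
(* [F] and [G] are not normalised separately. Splitting [f * 1], [1 * g] and [1 * 1] expresses
   [Ex f], [Ex g] and 1 through them, and the spurious factors cancel. *)
have c1 A : (fun=> 1) A = (fun=> 1 : R) (A :&: B) by [].
have c2 A : (fun=> 1) A = (fun=> 1 : R) (A :\: B) by [].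
have e1 : Ex f = F f * G (fun=> 1).
  by rewrite -(split _ _ fB c2); apply: eq_bern_mean => A; rewrite mulr1.
have e2 : Ex g = F (fun=> 1) * G g.
  by rewrite -(split _ _ c1 gB); apply: eq_bern_mean => A; rewrite mul1r.
have e3 : F (fun=> 1) * G (fun=> 1) = 1.
  by rewrite -(split _ _ c1 c2) -[RHS]bern_mean1; apply: eq_bern_mean => A; rewrite mulr1.
by rewrite split// e1 e2 -(mulr1 (F f * G g)) -[X in _ * X = _]e3; ring.
Qed.

End bernoulli_model.

(** * Stein's method for dissociated sums *)

Section dissociated_sums.
Context (R : realType) (I : finType) (p : R) (b : {set I} -> R).
Hypothesis p01 : 0 <= p <= 1.
Implicit Types (a c e A B : {set I}).

Local Notation Ex := (bern_mean p).

Definition meets B c := ~~ [disjoint B & c].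

(** The weights [b] live on all subsets of the ground set and vanish off the progressions in the
    application, so a linear combination of two counts is a single sum of this kind. *)
Definition centered_term a A : R := b a * ((a \subset A)%:R - p ^+ #|a|).

Definition dissociated_sum A : R := \sum_a centered_term a A.

Definition sum_avoiding B A : R := \sum_(c | ~~ meets B c) centered_term c A.

(** The power of [p] is the probability that the random set contains all three sets; up to a factor
    8 it bounds the absolute third moments of the centered terms. *)
Definition connected_triples : R :=
  \sum_a \sum_(c | meets a c) \sum_(e | meets (a :|: c) e)
    `|b a * b c * b e| * p ^+ #|a :|: c :|: e|.

Local Notation xi := centered_term.
Local Notation W := dissociated_sum.
Local Notation Wo := sum_avoiding.

Let p0 : 0 <= p. Proof. by case/andP: p01. Qed.
Let p1 : p <= 1. Proof. by case/andP: p01. Qed.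

Lemma centered_term_setI a A : xi a A = xi a (A :&: a).
Proof. by rewrite /xi finset.subsetI fintype.subxx andbT. Qed.

Lemma centered_term_setD a B A : ~~ meets B a -> xi a A = xi a (A :\: B).
Proof.
by rewrite /meets negbK /xi finset.subsetD disjoint_sym => ->; rewrite andbT.
Qed.

Lemma sum_avoiding_setD B A : Wo B A = Wo B (A :\: B).
Proof. by apply: eq_bigr => c; exact: centered_term_setD. Qed.

Lemma sum_avoidingE B A : W A - Wo B A = \sum_(c | meets B c) xi c A.
Proof.
by rewrite /W (bigID (fun c => meets B c))/= addrK.
Qed.

Lemma bern_mean_centered a : Ex (xi a) = 0.
Proof. by rewrite bern_meanZ bern_meanB bern_mean_subset bern_mean_cst subrr mulr0. Qed.

Lemma centered_term_uncorrelated a c :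
  ~~ meets a c -> Ex (fun A => xi a A * xi c A) = 0.
Proof.
move=> ac; rewrite (@bern_mean_indep _ _ _ a).
- by rewrite bern_mean_centered mul0r.
- by move=> A; rewrite -centered_term_setI.
- by move=> A; rewrite -centered_term_setD.
Qed.

Lemma bern_mean_sqr_dissociated :
  Ex (fun A => W A ^+ 2)
  = \sum_a \sum_(c | meets a c) Ex (fun A => xi a A * xi c A).
Proof.
transitivity (\sum_a \sum_c Ex (fun A => xi a A * xi c A)).
  under eq_bigr do rewrite -bern_mean_sum.
  rewrite -bern_mean_sum; apply: eq_bern_mean => A.
  rewrite expr2 {1}/W mulr_suml; apply: eq_bigr => a _.
  by rewrite mulr_sumr.
apply: eq_bigr => a _; rewrite (bigID (meets a))/= addrC big1 ?add0r//.
by move=> c; exact: centered_term_uncorrelated.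
Qed.

Lemma normr_centered_term a A :
  `|xi a A| <= `|b a| * ((a \subset A)%:R + p ^+ #|a|).
Proof.
rewrite normrM ler_wpM2l//; apply: le_trans (ler_normB _ _) _.
by rewrite !ger0_norm ?exprn_ge0.
Qed.

Lemma bern_mean_normr_centered a : Ex (fun A => `|xi a A|) <= 2 * (`|b a| * p ^+ #|a|).
Proof.
apply: le_trans (le_bern_mean p01 (normr_centered_term a)) _.
rewrite bern_meanZ bern_meanD bern_mean_subset bern_mean_cst// mulrCA.
by rewrite mulr_natl mulr2n.
Qed.

Let subI a c A : (a \subset A)%:R * (c \subset A)%:R = ((a :|: c) \subset A)%:R :> R.
Proof. by rewrite finset.subUset mulrb; case: (a \subset A); rewrite ?mul1r ?mul0r. Qed.

Let cardU a c : (#|a :|: c| <= #|a| + #|c|)%N.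
Proof. by rewrite cardsU leq_subr. Qed.

(** Each centered indicator is at most the indicator plus [p ^+ #|a|]. In the expanded product every
    one of the four means is a power of [p] with exponent at least [#|a :|: c|]. *)
Lemma bern_mean_normr_centered2 a c :
  Ex (fun A => `|xi a A * xi c A|) <= 4 * (`|b a * b c| * p ^+ #|a :|: c|).
Proof.
have h A : `|xi a A * xi c A| <= `|b a * b c| *
   (((a :|: c) \subset A)%:R + p ^+ #|c| * (a \subset A)%:R
    + p ^+ #|a| * (c \subset A)%:R + p ^+ (#|a| + #|c|)).
  rewrite normrM; apply: le_trans (ler_pM _ _ (normr_centered_term a A)
    (normr_centered_term c A)) _ => //.
  by rewrite -subI normrM exprD le_eqVlt; apply/orP; left; apply/eqP; ring.
apply: le_trans (le_bern_mean p01 h) _.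
rewrite bern_meanZ !bern_meanD !bern_meanZ !bern_mean_subset bern_mean_cst//.
rewrite -!exprD mulrCA ler_wpM2l//.
have le : p ^+ (#|a| + #|c|) <= p ^+ #|a :|: c| by rewrite ler_wiXn2l.
have := le; rewrite [X in p ^+ X <= _]addnC => le'.
lra.
Qed.

Lemma bern_mean_normr_centered3 a c e :
  Ex (fun A => `|xi a A * xi c A * xi e A|)
  <= 8 * (`|b a * b c * b e| * p ^+ #|a :|: c :|: e|).
Proof.
have h A : `|xi a A * xi c A * xi e A| <= `|b a * b c * b e| *
   ((a :|: c :|: e \subset A)%:R
    + p ^+ #|e| * (a :|: c \subset A)%:R
    + p ^+ #|c| * (a :|: e \subset A)%:R
    + p ^+ #|a| * (c :|: e \subset A)%:R
    + p ^+ (#|c| + #|e|) * (a \subset A)%:R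
    + p ^+ (#|a| + #|e|) * (c \subset A)%:R
    + p ^+ (#|a| + #|c|) * (e \subset A)%:R
    + p ^+ (#|a| + #|c| + #|e|)).
  rewrite (normrM (_ * _) (xi e A)) (normrM (xi a A)).
  apply: le_trans (ler_pM _ _ (ler_pM _ _ (normr_centered_term a A)
    (normr_centered_term c A)) (normr_centered_term e A)) _ => //.
  by rewrite -!subI !normrM !exprD le_eqVlt; apply/orP; left; apply/eqP; ring.
apply: le_trans (le_bern_mean p01 h) _.
rewrite bern_meanZ !bern_meanD !bern_meanZ !bern_mean_subset bern_mean_cst//.
rewrite -!exprD mulrCA ler_wpM2l//.
have ub k : (#|a :|: c :|: e| <= k)%N -> p ^+ k <= p ^+ #|a :|: c :|: e|.
  by move=> ?; rewrite ler_wiXn2l.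
have c1 := cardU (a :|: c) e; have c2 := cardU (a :|: e) c.
have c3 := cardU (c :|: e) a; have c4 := cardU a c; have c5 := cardU a e.
have c6 := cardU c e.
rewrite finset.setUAC in c2.
have c3' : (#|a :|: c :|: e| <= #|c :|: e| + #|a|)%N by rewrite -finset.setUA finset.setUC.
have u1 := ub (#|e| + #|a :|: c|)%N ltac:(lia).
have u2 := ub (#|c| + #|a :|: e|)%N ltac:(lia).
have u3 := ub (#|a| + #|c :|: e|)%N ltac:(lia).
have u4 := ub (#|c| + #|e| + #|a|)%N ltac:(lia).
have u5 := ub (#|a| + #|e| + #|c|)%N ltac:(lia).
have u6 := ub (#|a| + #|c| + #|e|)%N ltac:(lia).
lra.
Qed.

Lemma bern_mean_indep_sum_avoiding B f (G : R -> R) :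
  (forall A, f A = f (A :&: B)) ->
  Ex (fun A => f A * G (Wo B A)) = Ex f * Ex (fun A => G (Wo B A)).
Proof.
by move=> fB; apply: (@bern_mean_indep _ _ _ B) => // A; rewrite -sum_avoiding_setD.
Qed.

(* The term xi a is independent of the part of W avoiding a, and the product of
   xi a and xi c of the part avoiding both a and c; the differences between W and
   these parts are paid for by F and its derivative. *)
Lemma stein_bound (F F1 : R -> R) :
  (forall x y, `|F y - F x - (y - x) * F1 x| <= (y - x) ^+ 2) ->
  (forall x y, `|F1 y - F1 x| <= `|y - x|) ->
  `|Ex (fun A => W A * F (W A)) - Ex (fun A => W A ^+ 2) * Ex (F1 \o W)|
  <= 24 * connected_triples.
Proof.
move=> hF hF1.
(* [T a] is the first-order Taylor remainder of [F] between the part of [W] avoiding [a] and [W]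
   itself; [U a c] is the error of decoupling [xi a * xi c] from the derivative. They cost 8 and 16,
   hence 24. *)
pose T a := Ex (fun A => xi a A * (F (W A) - F (Wo a A) - (W A - Wo a A) * F1 (Wo a A))).
pose U a c := Ex (fun A => xi a A * xi c A * F1 (Wo a A))
  - Ex (fun A => xi a A * xi c A) * Ex (F1 \o W).
have -> : Ex (fun A => W A * F (W A)) - Ex (fun A => W A ^+ 2) * Ex (F1 \o W)
    = \sum_a (T a + \sum_(c | meets a c) U a c).
  have -> : Ex (fun A => W A * F (W A)) = \sum_a Ex (fun A => xi a A * F (W A)).
    by rewrite -bern_mean_sum; apply: eq_bern_mean => A; rewrite mulr_suml.
  rewrite bern_mean_sqr_dissociated mulr_suml -sumrB; apply: eq_bigr => a _.
  rewrite sumrB mulr_suml addrA; congr (_ - _).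
  have E0 : Ex (fun A => xi a A * F (Wo a A)) = 0.
    rewrite bern_mean_indep_sum_avoiding ?bern_mean_centered ?mul0r// => A.
    exact: centered_term_setI.
  rewrite -bern_mean_sum /T -[LHS]subr0 -[X in _ - X]E0 -bern_meanB -bern_meanD.
  apply: eq_bern_mean => A; rewrite sum_avoidingE -mulr_suml -mulr_sumr; ring.
apply: le_trans (ler_norm_sum _ _ _) _; rewrite mulr_sumr; apply: ler_sum => a _.
apply: le_trans (ler_normD _ _) _.
set S := \sum_(c | _) _.
have S_U c : \sum_(e | meets (a :|: c) e) `|b a * b c * b e| * p ^+ #|a :|: c :|: e|
    >= 0 by apply: sumr_ge0 => e _; rewrite mulr_ge0// exprn_ge0.
have hT : `|T a| <= 8 * S.
  apply: le_trans (ler_norm_bern_mean p01 _) _.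
  have h A : `|xi a A * (F (W A) - F (Wo a A) - (W A - Wo a A) * F1 (Wo a A))|
      <= \sum_(c | meets a c) \sum_(e | meets a e) `|xi a A * xi c A * xi e A|.
    rewrite normrM; apply: le_trans (ler_wpM2l (normr_ge0 _) (hF _ _)) _.
    rewrite sum_avoidingE -[X in _ * X]ger0_norm ?sqr_ge0//; apply: le_trans (_ : `|xi a A| *
      ((\sum_(c | meets a c) `|xi c A|) * (\sum_(e | meets a e) `|xi e A|)) <= _).
      by rewrite ler_wpM2l// normrX expr2 ler_pM// ler_norm_sum.
    rewrite mulr_suml mulr_sumr; apply: ler_sum => c _.
    rewrite !mulr_sumr; apply: ler_sum => e _.
    by rewrite !normrM mulrA.
  apply: le_trans (le_bern_mean p01 h) _.
  rewrite bern_mean_sum /S mulr_sumr; apply: ler_sum => c ac.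
  rewrite bern_mean_sum mulr_sumr.
  rewrite [leRHS](bigID (meets a))/=.
  apply: ler_wpDr.
    by apply: sumr_ge0 => e _; rewrite mulr_ge0// mulr_ge0// exprn_ge0.
  rewrite [leRHS](eq_bigl (meets a)) => [|e].
    by apply: ler_sum => e ae; exact: bern_mean_normr_centered3.
  rewrite andb_idl//; rewrite /meets; apply: contra => /pred0P h'.
  apply/pred0P => x /=; have := h' x; rewrite /= inE.
  by case: (x \in a); case: (x \in e); rewrite ?orbT.
have hU c : meets a c -> `|U a c| <= 16 *
    \sum_(e | meets (a :|: c) e) `|b a * b c * b e| * p ^+ #|a :|: c :|: e|.
  move=> ac; rewrite /U.
  have E1 : Ex (fun A => xi a A * xi c A * F1 (Wo (a :|: c) A))
      = Ex (fun A => xi a A * xi c A) * Ex (fun A => F1 (Wo (a :|: c) A)).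
    apply: bern_mean_indep_sum_avoiding => A.
    by rewrite /xi !finset.subsetI finset.subsetUl finset.subsetUr !andbT.
  (* The sum avoiding both [a] and [c] serves as intermediate: it is independent of [xi a * xi c],
     and passing to it from [Wo a], then from it to [W], costs 8 each. *)
  set m := Ex (fun A => xi a A * xi c A).
  have -> : Ex (fun A => xi a A * xi c A * F1 (Wo a A)) - m * Ex (F1 \o W)
    = Ex (fun A => xi a A * xi c A * (F1 (Wo a A) - F1 (Wo (a :|: c) A)))
      + m * (Ex (fun A => F1 (Wo (a :|: c) A) - F1 (W A))).
    rewrite [X in _ = X + _](eq_bern_mean p (g := fun A => xi a A * xi c A * F1 (Wo a A) -
      xi a A * xi c A * F1 (Wo (a :|: c) A))); last by move=> A; rewrite mulrBr.
    by rewrite !bern_meanB E1 /m/=; ring.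
  apply: le_trans (ler_normD _ _) _.
  have -> : (16 = 8 + 8 :> R) by ring.
  rewrite mulrDl; apply: lerD.
    apply: le_trans (ler_norm_bern_mean p01 _) _.
    have h A : `|xi a A * xi c A * (F1 (Wo a A) - F1 (Wo (a :|: c) A))| <=
        \sum_(e | meets (a :|: c) e) `|xi a A * xi c A * xi e A|.
      rewrite normrM; apply: le_trans (ler_wpM2l (normr_ge0 _) (hF1 _ _)) _.
      have -> : Wo a A - Wo (a :|: c) A =
          \sum_(e | meets (a :|: c) e && ~~ meets a e) xi e A.
        have := sum_avoidingE a A; have := sum_avoidingE (a :|: c) A.
        rewrite (bigID (meets a))/=.
        rewrite (eq_bigl (meets a)) => [h1 h2|e]; first lra.
        rewrite andb_idl//; rewrite /meets; apply: contra => /pred0P h'.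
        apply/pred0P => x /=; have := h' x; rewrite /= inE.
        by case: (x \in a); case: (x \in e); rewrite ?orbT.
      rewrite -normrM mulr_sumr; apply: le_trans (ler_norm_sum _ _ _) _.
      rewrite [leRHS](bigID (meets a))/= addrC.
      by apply: ler_wpDr => //; exact: sumr_ge0.
    apply: le_trans (le_bern_mean p01 h) _.
    rewrite bern_mean_sum mulr_sumr; apply: ler_sum => e _.
    exact: bern_mean_normr_centered3.
  rewrite normrM.
  have h2 : `|Ex (fun A => F1 (Wo (a :|: c) A) - F1 (W A))| <=
      \sum_(e | meets (a :|: c) e) 2 * (`|b e| * p ^+ #|e|).
    apply: le_trans (ler_norm_bern_mean p01 _) _.
    have h A : `|F1 (Wo (a :|: c) A) - F1 (W A)| <=
        \sum_(e | meets (a :|: c) e) `|xi e A|.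
      apply: le_trans (hF1 _ _) _; rewrite distrC sum_avoidingE.
      exact: ler_norm_sum.
    apply: le_trans (le_bern_mean p01 h) _.
    rewrite bern_mean_sum; apply: ler_sum => e _.
    exact: bern_mean_normr_centered.
  have h3 : `|m| <= 4 * (`|b a * b c| * p ^+ #|a :|: c|).
    apply: le_trans (ler_norm_bern_mean p01 _) _.
    exact: bern_mean_normr_centered2.
  apply: le_trans (ler_pM _ _ h3 h2) _ => //.
  rewrite !mulr_sumr; apply: ler_sum => e _.
  rewrite [`|_ * b e|]normrM.
  have -> : 4 * (`|b a * b c| * p ^+ #|a :|: c|) * (2 * (`|b e| * p ^+ #|e|)) =
     8 * (`|b a * b c| * `|b e| * p ^+ (#|a :|: c| + #|e|)) by rewrite exprD; ring.
  by rewrite ler_wpM2l// ler_wpM2l ?mulr_ge0// ler_wiXn2l.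
have -> : (24 = 8 + 16 :> R) by ring.
rewrite mulrDl lerD//.
apply: le_trans (ler_norm_sum _ _ _) _; rewrite /S mulr_sumr.
exact: ler_sum.
Qed.

End dissociated_sums.

(** * Trigonometric inequalities and the Gaussian differential equation *)

Section trigonometric_bounds.
Context (R : realType).
Implicit Types x y : R.

Lemma normr_sin_le1 x : `|sin x| <= 1.
Proof. by rewrite ler_norml sin_geN1 sin_le1. Qed.

Lemma normr_cos_le1 x : `|cos x| <= 1.
Proof. by rewrite ler_norml cos_geN1 cos_le1. Qed.

Lemma mean_value (f df : R -> R) : (forall x, is_derive x 1 f (df x)) ->
  forall x y, exists2 z, `|z - x| <= `|y - x| & f y - f x = df z * (y - x).
Proof.
move=> dfE x y.
have cf A : {within A, continuous f}.
  apply: continuous_subspaceT => z.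
  by apply/differentiable_continuous/derivable1_diffP; exact: ex_derive.
have [xy|yx|->] := ltgtP x y; last by exists y; rewrite ?subrr ?mulr0.
- have [z + ->] := MVT xy (fun z _ => dfE z) (cf _).
  rewrite in_itv/= => /andP[xz zy]; exists z => //.
  by rewrite !ger0_norm ?subr_ge0 ?(ltW xz) ?(ltW xy)// lerD2r ltW.
- have [z + e] := MVT yx (fun z _ => dfE z) (cf _).
  rewrite in_itv/= => /andP[yz zx]; exists z; last by lra.
  by rewrite !ler0_norm ?subr_le0 ?(ltW zx) ?(ltW yx)// lerN2 lerD2r ltW.
Qed.

Lemma sin_lipschitz x y : `|sin y - sin x| <= `|y - x|.
Proof.
have [z _ ->] := mean_value (fun x => @is_derive_sin R x) x y.
by rewrite normrM ler_piMl// normr_cos_le1.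
Qed.

Lemma cos_lipschitz x y : `|cos y - cos x| <= `|y - x|.
Proof.
have [z _ ->] := mean_value (fun x => @is_derive_cos R x) x y.
by rewrite normrM normrN ler_piMl// normr_sin_le1.
Qed.

Lemma sin_taylor1 x y : `|sin y - sin x - (y - x) * cos x| <= (y - x) ^+ 2.
Proof.
have [z zx ->] := mean_value (fun x => @is_derive_sin R x) x y.
rewrite mulrC -mulrBr normrM -[leRHS]ger0_norm ?sqr_ge0// normrX expr2.
by rewrite ler_wpM2l// (le_trans (cos_lipschitz _ _)).
Qed.

Lemma cos_taylor1 x y : `|cos y - cos x + (y - x) * sin x| <= (y - x) ^+ 2.
Proof.
have [z zx ->] := mean_value (fun x => @is_derive_cos R x) x y.
have -> : - sin z * (y - x) + (y - x) * sin x = (y - x) * (sin x - sin z) by ring.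
rewrite normrM -[leRHS]ger0_norm ?sqr_ge0// normrX expr2.
by rewrite ler_wpM2l// distrC (le_trans (sin_lipschitz _ _)).
Qed.

(** After multiplication by the integrating factor [expR (v x^2 / 2)], the derivative is that factor
    times the defect of the equation. The mean value theorem evaluates it at some [z <= 1], where
    the factor is at most its value at 1, which [expR (- v / 2)] cancels. *)
Lemma gaussian_ode_stability (psi dpsi : R -> R) (v eps : R) : 0 <= v ->
  (forall x, is_derive x 1 psi (dpsi x)) ->
  (forall x, 0 <= x <= 1 -> `|dpsi x + v * x * psi x| <= eps) ->
  `|psi 1 - expR (- v / 2) * psi 0| <= eps.
Proof.
move=> v0 dpsiE heps.
pose q x := v / 2 * x ^+ 2.
pose D x := expR (q x) * psi x.
have dD x : is_derive x 1 D (expR (q x) * (dpsi x + v * x * psi x)).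
  have dq : is_derive x 1 q (v * x).
    have -> : q = (v / 2) \*: ((@id R) ^+ 2).
      by apply/funext => z; rewrite /q fctE.
    apply: is_derive_eq; rewrite /GRing.scale/= expr1; lra.
  have dEq : is_derive x 1 (expR \o q) (expR (q x) * (v * x)).
    by apply: is_derive_eq (is_derive1_comp _ _) _; rewrite /GRing.scale/=.
  have -> : D = (expR \o q) * psi by [].
  apply: is_derive_eq; rewrite /GRing.scale/=; ring.
have cD : {within `[0, 1], continuous D}.
  apply: continuous_subspaceT => z.
  by apply/differentiable_continuous/derivable1_diffP; exact: ex_derive.
have [z + e] := MVT ltr01 (fun z _ => dD z) cD.
rewrite in_itv/= => /andP[z0 z1].
have q1 : q 1 = v / 2 by rewrite /q expr1n mulr1.
have q0 : q 0 = 0 by rewrite /q expr0n mulr0.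
have -> : psi 1 - expR (- v / 2) * psi 0 = expR (- v / 2) * (D 1 - D 0).
  by rewrite /D q1 q0 expR0 mul1r mulrBr mulrA -expRD mulNr addNr expR0 mul1r.
rewrite e subr0 mulr1 mulrA -expRD normrM.
have h : 0 <= z <= 1 by rewrite !ltW.
rewrite -[leRHS]mul1r ler_pM// ?heps// ger0_norm ?expR_ge0//.
rewrite -[leRHS]expR0 ler_expR /q.
have : z ^+ 2 <= 1 by rewrite exprn_ile1// ltW.
nra.
Qed.

End trigonometric_bounds.

Section dissociated_fourier.
Context (R : realType) (I : finType) (p : R) (b : {set I} -> R).
Hypothesis p01 : 0 <= p <= 1.

Local Notation Ex := (bern_mean p).
Local Notation W := (dissociated_sum p b).

Lemma is_derive_bern_mean (f df : {set I} -> R -> R) :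
  (forall A (x : R), is_derive x (1 : R) (f A) (df A x)) ->
  forall x : R, is_derive x (1 : R) (fun x => Ex (f ^~ x)) (Ex (df ^~ x)).
Proof.
move=> dfE x; rewrite /bern_mean.
have -> : (fun x => \sum_A bern_weight p [set: I]%SET A * f A x)
    = \sum_A (bern_weight p [set: I]%SET A \*: f A).
  by apply/funext => z; rewrite fct_sumE.
elim/big_ind2 : _ => [|F dF G dG hF hG|A _].
- exact: is_derive_cst.
- exact: is_deriveD.
- exact: is_deriveZ.
Qed.

(* The function psi x = E cos (x W + c) satisfies psi' = - v x psi up to the error
   of Stein's method, where v is the variance of W. *)
Lemma dissociated_sum_cos c :
  `|Ex (fun A => cos (W A + c)) - expR (- Ex (fun A => W A ^+ 2) / 2) * cos c|
  <= 24 * connected_triples p b.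
Proof.
pose psi x := Ex (fun A => cos (x * W A + c)).
pose dpsi x := Ex (fun A => - (W A * sin (x * W A + c))).
have dpsiE (x : R) : is_derive x (1 : R) psi (dpsi x).
  apply: (is_derive_bern_mean (f := fun A x => cos (x * W A + c))
    (df := fun A x => - (W A * sin (x * W A + c)))) => A z.
  have dl : is_derive z (1 : R) (fun z => z * W A + c) (W A).
    have -> : (fun z => z * W A + c) = W A \*: (@id R) + cst c.
      by apply/funext => u; rewrite !fctE mulrC.
    by apply: is_derive_eq; rewrite /GRing.scale/= mulr1 addr0.
  apply: is_derive_eq (is_derive1_comp _ _) _; rewrite /GRing.scale/=; ring.
have v0 : 0 <= Ex (fun A => W A ^+ 2) by apply: bern_mean_ge0 => // A; exact: sqr_ge0.
have := gaussian_ode_stability (eps := 24 * connected_triples p b) v0 dpsiE.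
have -> : psi 1 = Ex (fun A => cos (W A + c)).
  by apply: eq_bern_mean => A; rewrite mul1r.
have -> : psi 0 = cos c.
  by rewrite -[RHS](@bern_mean_cst R I p); apply: eq_bern_mean => A; rewrite mul0r add0r.
move=> HH; apply: HH => x /andP[x0 x1].
have x21 : x ^+ 2 <= 1 by rewrite exprn_ile1.
have := stein_bound (p := p) b p01 (F := fun w => sin (x * w + c))
  (F1 := fun w => x * cos (x * w + c)).
rewrite bern_meanZ -normrN /dpsi bern_meanN => h.
apply: le_trans (h _ _).
- by rewrite le_eqVlt; apply/orP; left; apply/eqP; congr `|_|; rewrite /psi; ring.
- move=> u w; have := sin_taylor1 (x * u + c) (x * w + c).
  rewrite opprD addrACA subrr addr0 -mulrBr.
  rewrite (mulrC x (w - u)) mulrA => h'; apply: le_trans h' _.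
  by rewrite exprMn ler_piMr// sqr_ge0.
- move=> u w; rewrite -mulrBr normrM ger0_norm//.
  apply: le_trans (ler_wpM2l x0 (cos_lipschitz _ _)) _.
  rewrite opprD addrACA subrr addr0 -mulrBr normrM (ger0_norm x0) mulrA -expr2.
  by rewrite ler_piMl.
Qed.

End dissociated_fourier.

(** * From the random set to the finite model *)

Section binomial_subset_law.
Context (R : realType).

(** The law of the random set is given through the events [J \subset S] only. Their indicators span
    all functions of the set: the indicator of [B = A] is the product of [1_(i in B)] over [i] in
    [A] and of [1 - 1_(i in B)] over the others, and expanding it gives the coefficients [e A J]. *)
Lemma set_fun_span (I : finType) (g : {set I} -> R) :
  exists c : {set I} -> R, forall B, g B = \sum_J c J * (J \subset B)%:R.
Proof.
pose e (A J : {set I}) : R := \prod_i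
  (if i \in J then (if i \in A then 1 else -1) else (if i \in A then 0 else 1)).
have eE A B : (B == A)%:R = \sum_J e A J * (J \subset B)%:R.
  transitivity (\prod_(i : I) (((if i \in A then 1 else -1) * (i \in B)%:R) +
      (if i \in A then 0 else 1)) : R).
    case: eqP => [->|/eqP BA].
      rewrite big1// => i _; case: (i \in A); rewrite ?mulr1 ?addr0//.
      by rewrite mulr0 add0r.
    have [i iBA] : exists i, (i \in B) != (i \in A).
      apply/existsP; apply: contraNT BA; rewrite negb_exists => /forallP h.
      by apply/eqP/setP => i; have := h i; rewrite negbK => /eqP.
    rewrite (bigD1 i)//=; move: iBA.
    by case: (i \in B); case: (i \in A) => // _; rewrite ?(mulr0,mulr1,addr0,addNr,mul0r).
  rewrite -sum_set_prod; apply: eq_bigr => J _.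
  have [JB|] := boolP (J \subset B).
    rewrite mulr1; apply: eq_bigr => i _; case: ifPn => // iJ.
    by rewrite (fintype.subsetP JB _ iJ) mulr1.
  case/subsetPn => i iJ iB; rewrite mulr0 (bigD1 i)//= iJ (negbTE iB).
  by rewrite mulr0 mul0r.
exists (fun J => \sum_A g A * e A J) => B.
transitivity (\sum_A g A * (B == A)%:R).
  rewrite (bigD1 B)//= eqxx mulr1 big1 ?addr0// => A.
  by rewrite eq_sym => /negbTE ->; rewrite mulr0.
under eq_bigr do rewrite eE mulr_sumr.
rewrite exchange_big/=; apply: eq_bigr => J _; rewrite mulr_suml.
by apply: eq_bigr => A _; rewrite mulrA.
Qed.

Lemma expectation_binomial_subset (d : measure_display) (T : measurableType d)
    (P : probability T R) (n : nat) (S : T -> {set 'I_n}) (p : R)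
    (hS : binomial_subset P S p) (g : {set 'I_n} -> R) :
  ('E_P[g \o S] = (bern_mean p g)%:E)%E.
Proof.
case: hS => mS PS indS; have [c gE] := set_fun_span g.
have EJE (J : {set 'I_n}) :
    [set w | J \subset S w] = \bigcap_(i in [set` J]) [set w | i \in S w].
  apply/seteqP; split => w /=; first by move=> /fintype.subsetP h i /h.
  by move=> h; apply/fintype.subsetP => i /h.
have mJ (J : {set 'I_n}) : measurable [set w | J \subset S w].
  rewrite EJE; apply: fin_bigcap_measurable => //.
have PJ (J : {set 'I_n}) : P [set w | J \subset S w] = (p ^+ #|J|)%:E.
  rewrite EJE indS; congr EFin; rewrite -prodr_const; apply: eq_bigr => i _.
  by rewrite PS.
rewrite unlock.
transitivity (\int[P]_w (\sum_J (c J)%:E * (\1_[set w | J \subset S w] w)%:E))%E.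
  apply: eq_integral => w _; rewrite /= gE -sumEFin; apply: eq_bigr => J _.
  by rewrite EFinM indicE mem_setE.
rewrite integral_sum//=; last first.
  by move=> J; apply: integrableZl => //; exact: integrable_indic.
rewrite (eq_bern_mean p gE) bern_mean_sum -sumEFin; apply: eq_bigr => J _.
rewrite integralZl//; last exact: integrable_indic.
rewrite integral_indic// setIT bern_meanZ bern_mean_subset EFinM; congr (_ * _)%E.
exact: PJ.
Qed.

Lemma covariance_binomial_subset (d : measure_display) (T : measurableType d)
    (P : probability T R) (n : nat) (S : T -> {set 'I_n}) (p : R)
    (hS : binomial_subset P S p) (g h : {set 'I_n} -> R) :
  covariance P (g \o S) (h \o S)
  = (bern_mean p (fun A => (g A - bern_mean p g) * (h A - bern_mean p h)))%:E.
Proof.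
rewrite covariance.unlock !(expectation_binomial_subset hS)/=.
exact: (expectation_binomial_subset hS
  (fun A => (g A - bern_mean p g) * (h A - bern_mean p h))).
Qed.

End binomial_subset_law.

(** * Gaussian laws on the plane *)

Section gaussian_fourier.
Context {R : realType}.
Local Notation mu := (@lebesgue_measure R).
Local Notation phi := (@normal_pdf R 0 1).

(** The change of variables involves an abstract Radon-Nikodym derivative; it agrees almost
    everywhere with the explicit density because both have the same integral over every measurable
    set. *)
Lemma integral_normal_prob (m s : R) (f : R -> \bar R) :
  (normal_prob m s).-integrable setT f ->
  (\int[normal_prob m s]_x f x = \int[mu]_x (f x * (normal_pdf m s x)%:E))%E.
Proof.
move=> intf; have mf := measurable_int _ intf.
rewrite -(Radon_Nikodym_change_of_variables (normal_prob_dominates m s))//=.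
apply: ae_eq_integral => //.
- apply: emeasurable_funM => //; apply: (measurable_int mu).
  by apply: Radon_Nikodym_integrable; exact: normal_prob_dominates.
- apply: emeasurable_funM => //; apply/measurable_EFinP.
  exact: measurable_normal_pdf.
- apply: ae_eqe_mul2l => /=.
  rewrite Radon_NikodymE//=; first exact: normal_prob_dominates.
  move=> abmu.
  case: cid => /= h [h1 h2 h3].
  apply: integral_ae_eq => //=.
  + by apply/measurable_EFinP; exact: measurable_normal_pdf.
  + by move=> E E01 mE; rewrite -h3.
Qed.

Lemma std_normal_pdfE x : phi x = normal_peak 1 * expR (- (x ^+ 2 / 2)).
Proof.
by rewrite normal_pdfE ?oner_eq0// /normal_fun subr0 expr1n mulNr.
Qed.

(** Integrability under quadratic growth is borrowed from the normal density of variance 2, through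
    [1 + x^2 <= 4 (1 + x^2 / 4) <= 4 exp (x^2 / 4)]. *)
Lemma sqr_std_normal_pdf_le x :
  (1 + x ^+ 2) * phi x <=
  4 * normal_peak 1 / normal_peak (Num.sqrt 2) * normal_pdf 0 (Num.sqrt 2) x.
Proof.
have s0 : Num.sqrt 2 != 0 :> R by rewrite gt_eqF// sqrtr_gt0.
have k0 : normal_peak (Num.sqrt 2 : R) != 0 by rewrite gt_eqF// normal_peak_gt0.
rewrite std_normal_pdfE normal_pdfE// mulrA divfK// /normal_fun subr0.
rewrite sqr_sqrtr// (mulrCA (1 + _)) (mulrC 4) -(mulrA (normal_peak 1)).
rewrite ler_wpM2l ?normal_peak_ge0//.
have -> : - x ^+ 2 / (2 *+ 2) = x ^+ 2 / 4 + - (x ^+ 2 / 2) by field.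
rewrite expRD mulrA ler_wpM2r ?expR_ge0//.
have := expR_ge1Dx (x ^+ 2 / 4); lra.
Qed.

Lemma integrable_sqr_std_normal_pdf :
  mu.-integrable setT (fun x => ((1 + x ^+ 2) * phi x)%:E).
Proof.
apply: (@le_integrable _ _ R mu setT measurableT _ (fun x => (4 * normal_peak 1 /
  normal_peak (Num.sqrt 2) * normal_pdf 0 (Num.sqrt 2) x)%:E)).
- apply/measurable_EFinP; apply: measurable_funM; last exact: measurable_normal_pdf.
  by apply: measurable_funD => //; exact: measurable_funX.
- move=> x _; rewrite lee_fin ger0_norm.
    by rewrite (le_trans (sqr_std_normal_pdf_le x))// ler_norm.
  by rewrite mulr_ge0 ?normal_pdf_ge0// addr_ge0// sqr_ge0.
- under eq_fun do rewrite EFinM.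
  by apply: integrableZl => //; exact: integrable_normal_pdf.
Qed.

Lemma integrable_mul_std_normal_pdf (f : R -> R) (K : R) :
  measurable_fun setT f -> (forall x, `|f x| <= K * (1 + x ^+ 2)) ->
  mu.-integrable setT (fun x => (f x * phi x)%:E).
Proof.
move=> mf fK; apply: (@le_integrable _ _ R mu setT measurableT _
  (fun x => (K%:E * ((1 + x ^+ 2) * phi x)%:E)%E)).
- by apply/measurable_EFinP; apply: measurable_funM => //; exact: measurable_normal_pdf.
- move=> x _; have p0 : 0 <= phi x := normal_pdf_ge0 _ _ _.
  rewrite -EFinM !abse_EFin lee_fin mulrA (normrM (f x)) (normrM (K * _)).
  by rewrite (ger0_norm p0) ler_wpM2r// (le_trans (fK x))// ler_norm.
- by apply: integrableZl => //; exact: integrable_sqr_std_normal_pdf.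
Qed.

Lemma is_derive_std_normal_pdf (x : R) : is_derive x (1 : R) phi (- (x * phi x)).
Proof.
have -> : phi = normal_peak 1 \*: (expR \o (fun x => - (x ^+ 2 / 2))).
  by apply/funext => z; rewrite std_normal_pdfE.
have dq : is_derive x (1 : R) (fun x : R => - (x ^+ 2 / 2)) (- x).
  have -> : (fun x : R => - (x ^+ 2 / 2)) = (- 2^-1) \*: ((@id R) ^+ 2).
    by apply/funext => z; rewrite mulrC -mulNr.
  by apply: is_derive_eq; rewrite /GRing.scale/= expr1; lra.
have dEq : is_derive x (1 : R) (expR \o (fun x => - (x ^+ 2 / 2)))
    (expR (- (x ^+ 2 / 2)) * (- x)).
  by apply: is_derive_eq (is_derive1_comp _ _) _; rewrite /GRing.scale/=.
have -> : - (x * (normal_peak 1 \*: (expR \o (fun x0 : R => - (x0 ^+ 2 / 2)))) x)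
    = normal_peak 1 *: (expR (- (x ^+ 2 / 2)) * - x).
  change (- (x * (normal_peak 1 * expR (- (x ^+ 2 / 2))))
    = normal_peak 1 * (expR (- (x ^+ 2 / 2)) * - x)); ring.
exact: is_deriveZ.
Qed.

Lemma continuous_std_normal_pdf : continuous phi.
Proof. by apply: continuous_normal_pdf; rewrite oner_eq0. Qed.

Lemma normr_normal_pdf_le n : (0 < n)%N ->
  phi n%:R <= 4 * normal_peak 1 / n%:R /\ phi (- n%:R) <= 4 * normal_peak 1 / n%:R.
Proof.
move=> n0; rewrite !std_normal_pdfE sqrrN.
suff h : normal_peak 1 * expR (- (n%:R ^+ 2 / 2)) <= 4 * normal_peak 1 / n%:R :> R by [].
have n1 : 1 <= n%:R :> R by rewrite ler1n.
rewrite (mulrC 4) -(mulrA (normal_peak 1)) ler_wpM2l ?normal_peak_ge0// expRN.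
rewrite ler_pdivlMr ?ltr0n// mulrC ler_pdivrMr ?expR_gt0//.
have := expR_ge1Dx (n%:R ^+ 2 / 2 : R); nra.
Qed.

(** On [[-n, n]] the fundamental theorem of calculus leaves two boundary values of [g], which are
    [O(1 / n)] by the bound through the density; dominated convergence passes to the whole line. *)
Lemma integral_is_derive_std_normal (g dg : R -> R) (K : R) :
  (forall x : R, is_derive x (1 : R) g (dg x)) -> continuous dg ->
  (forall x, `|g x| <= K * phi x) ->
  (forall x, `|dg x| <= K * (1 + x ^+ 2) * phi x) ->
  (\int[mu]_x (dg x)%:E = 0)%E.
Proof.
move=> gE cdg gK dgK.
have mdg : measurable_fun setT dg by exact: continuous_measurable_fun.
pose D n : set R := [set` `[- n%:R, n%:R]].
have mD n : measurable (D n) by exact: measurable_itv.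
pose f_ n : R -> \bar R := (EFin \o dg) \_ (D n).
have intE n : (0 < n)%N -> (\int[mu]_x f_ n x = (g n%:R - g (- n%:R))%:E)%E.
  move=> n0; rewrite -integral_mkcond EFinB.
  have n0' : 0 < n%:R :> R by rewrite ltr0n.
  have cg (A : set R) : {within A, continuous g}.
    apply: continuous_subspaceT => z.
    by apply/differentiable_continuous/derivable1_diffP; exact: ex_derive.
  apply: continuous_FTC2; first lra.
  - exact: continuous_subspaceT.
  - split.
    + by move=> x _; exact: ex_derive.
    + by apply: cvg_at_right_filter; apply/differentiable_continuous/derivable1_diffP; exact: ex_derive.
    + by apply: cvg_at_left_filter; apply/differentiable_continuous/derivable1_diffP; exact: ex_derive.
  - by move=> x _; rewrite derive1E; exact: derive_val.
have cv1 : (\int[mu]_x f_ n x @[n --> \oo] --> \int[mu]_x (dg x)%:E)%E.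
  have mf_ n : measurable_fun setT (f_ n).
    apply/(measurable_restrictT _ _).1 => //.
    exact/measurable_funTS/measurable_EFinP.
  have mf : measurable_fun setT (EFin \o dg) by exact/measurable_EFinP.
  have cvf : {ae mu, forall x, setT x -> f_ n x @[n --> \oo] --> (EFin \o dg) x}.
    apply: aeW => x _; apply: cvg_near_cst; near=> n.
    rewrite /f_ patchE ifT// inE /D/= in_itv/= -ler_norml.
    by near: n; exact: nbhs_infty_ger.
  have ig : mu.-integrable setT (fun x => (K%:E * ((1 + x ^+ 2) * phi x)%:E)%E).
    by apply: integrableZl => //; exact: integrable_sqr_std_normal_pdf.
  have dom : {ae mu, forall x n, setT x ->
      (`|f_ n x| <= K%:E * ((1 + x ^+ 2) * phi x)%:E)%E}.
    apply: aeW => x n _; rewrite /f_ patchE -EFinM mulrA; case: ifPn => _.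
      by rewrite abse_EFin lee_fin.
    by rewrite abse0 lee_fin (le_trans (normr_ge0 _) (dgK x)).
  by have [] := @dominated_convergence _ _ R mu setT measurableT f_ _ _ mf_ mf cvf ig dom.
have cv2 : (\int[mu]_x f_ n x @[n --> \oo] --> 0%E)%E.
  apply: cvg_trans (near_eq_cvg (f := fun n => (g n%:R - g (- n%:R))%:E) _) _.
    by near=> n; apply/esym/intE; near: n; exact: nbhs_infty_gt.
  apply: cvg_EFin; first exact: nearW.
  pose c := 2 * (`|K| * (4 * normal_peak 1)).
  have cn : c * n%:R^-1 @[n --> \oo] --> 0.
    rewrite -(mulr0 c); apply: cvgMl_tmp; apply/gtr0_cvgV0; last exact: cvgr_idn.
    by near=> n; rewrite ltr0n; near: n; exact: nbhs_infty_gt.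
  apply: (squeeze_cvgr (f := fun n => - (c * n%:R^-1)) _ _ cn).
    near=> n; have n0 : (0 < n)%N by near: n; exact: nbhs_infty_gt.
    have [h1 h2] := normr_normal_pdf_le n0.
    rewrite /= -ler_norml; apply: le_trans (ler_normB _ _) _.
    have hK x : `|g x| <= `|K| * phi x.
      by rewrite (le_trans (gK x))// ler_wpM2r ?normal_pdf_ge0 ?ler_norm.
    have := lerD (le_trans (hK _) (ler_wpM2l (normr_ge0 K) h1))
      (le_trans (hK _) (ler_wpM2l (normr_ge0 K) h2)).
    by move=> /le_trans; apply; rewrite /c le_eqVlt; apply/orP; left; apply/eqP; ring.
  by rewrite -[X in _ --> X]oppr0; apply: cvgN.
by rewrite -(cvg_lim _ cv1)// (cvg_lim _ cv2).
Unshelve. all: by end_near. Qed.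

Definition gaussian_mean (f : R -> R) : R := \int[mu]_x (f x * phi x).

Local Notation J := gaussian_mean.

(** Quadratic growth covers the cosines, [x sin], and the [x ^+ 2] that bounds the second-order
    remainder when the frequency of a cosine is varied. *)
Definition sqr_dominated (f : R -> R) :=
  measurable_fun setT f /\ exists K, forall x, `|f x| <= K * (1 + x ^+ 2).

Lemma sqr_dominated_integrable f : sqr_dominated f ->
  mu.-integrable setT (EFin \o (fun x => f x * phi x)).
Proof. by case=> mf [K fK]; exact: (integrable_mul_std_normal_pdf mf fK). Qed.

Lemma gaussian_meanD f g : sqr_dominated f -> sqr_dominated g ->
  J (fun x => f x + g x) = J f + J g.
Proof.
move=> df dg; rewrite /J -RintegralD//.
- by apply: eq_Rintegral => x _; rewrite mulrDl.
- exact: sqr_dominated_integrable.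
- exact: sqr_dominated_integrable.
Qed.

Lemma gaussian_meanZ k f : sqr_dominated f -> J (fun x => k * f x) = k * J f.
Proof.
move=> df; rewrite /J -RintegralZl//; last exact: sqr_dominated_integrable.
by apply: eq_Rintegral => x _; rewrite mulrA.
Qed.

Lemma le_gaussian_mean f g : sqr_dominated f -> sqr_dominated g ->
  (forall x, f x <= g x) -> J f <= J g.
Proof.
move=> df dg fg; rewrite /J; apply: le_Rintegral => //.
- exact: sqr_dominated_integrable.
- exact: sqr_dominated_integrable.
- by move=> x _; rewrite ler_wpM2r ?normal_pdf_ge0.
Qed.

Lemma gaussian_mean_cst c : J (fun=> c) = c.
Proof.
rewrite /J RintegralZl//; last exact: integrable_normal_pdf.
by rewrite /Rintegral integral_normal_pdf mulr1.
Qed.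

Lemma normr_x_le (x : R) : `|x| <= 1 + x ^+ 2.
Proof. by rewrite -real_normK ?num_real//; have := normr_ge0 x; nra. Qed.

Lemma sqr_ge1D (x : R) : 1 <= 1 + x ^+ 2.
Proof. by rewrite lerDl sqr_ge0. Qed.

Lemma sqr_dominated_bounded (f : R -> R) : measurable_fun setT f ->
  (forall x, `|f x| <= 1) -> sqr_dominated f.
Proof.
move=> mf f1; split=> //; exists 1 => x.
by rewrite mul1r (le_trans (f1 x))// sqr_ge1D.
Qed.

Lemma measurable_affine (a c : R) : measurable_fun setT (fun x : R => a * x + c).
Proof. by apply: measurable_funD => //; exact: measurable_funM. Qed.

Lemma sqr_dominated_cos a c : sqr_dominated (fun x => cos (a * x + c)).
Proof.
apply: sqr_dominated_bounded => [|x]; last exact: normr_cos_le1.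
apply: measurableT_comp; last exact: measurable_affine.
by apply: continuous_measurable_fun; exact: continuous_cos.
Qed.

Lemma sqr_dominated_xsin a c : sqr_dominated (fun x => x * sin (a * x + c)).
Proof.
split.
  apply: measurable_funM => //; apply: measurableT_comp; last exact: measurable_affine.
  by apply: continuous_measurable_fun; exact: continuous_sin.
exists 1 => x; rewrite normrM mul1r (le_trans _ (normr_x_le x))//.
by rewrite ler_piMr// normr_sin_le1.
Qed.

Lemma sqr_dominatedZ k f : sqr_dominated f -> sqr_dominated (fun x => k * f x).
Proof.
case=> mf [K fK]; split; first exact: measurable_funM.
by exists (`|k| * K) => x; rewrite normrM -mulrA ler_wpM2l.
Qed.

Lemma sqr_dominatedD f g : sqr_dominated f -> sqr_dominated g ->
  sqr_dominated (fun x => f x + g x).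
Proof.
case=> mf [K fK] [mg [L gL]]; split; first exact: measurable_funD.
by exists (K + L) => x; rewrite mulrDl (le_trans (ler_normD _ _))// lerD.
Qed.

Lemma sqr_dominated_sqr : sqr_dominated (fun x => x ^+ 2).
Proof.
split; first exact: measurable_funX.
by exists 1 => x; rewrite mul1r ger0_norm ?sqr_ge0// lerDr.
Qed.

(** Integration by parts: the derivative of [sin (a x + c)] times the density is the difference of
    the two integrands, and its integral is 0. *)
Lemma gaussian_mean_stein a c :
  J (fun x => x * sin (a * x + c)) = a * J (fun x => cos (a * x + c)).
Proof.
have dl (x : R) : is_derive x (1 : R) (fun z => a * z + c) a.
  have -> : (fun z => a * z + c) = a \*: (@id R) + cst c by [].
  by apply: is_derive_eq; rewrite /GRing.scale/= mulr1 addr0.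
have ds (x : R) : is_derive x (1 : R) (fun z => sin (a * z + c)) (a * cos (a * x + c)).
  by apply: is_derive_eq (is_derive1_comp _ _) _; rewrite /GRing.scale/= mulrC.
have dg (x : R) : is_derive x (1 : R) (fun z => sin (a * z + c) * phi z)
    (a * cos (a * x + c) * phi x - x * sin (a * x + c) * phi x).
  have -> : a * cos (a * x + c) * phi x - x * sin (a * x + c) * phi x =
    sin (a * x + c) *: (- (x * phi x)) + phi x *: (a * cos (a * x + c)).
    by rewrite /GRing.scale/=; ring.
  by apply: is_deriveM; exact: is_derive_std_normal_pdf.
have := @integral_is_derive_std_normal _ _ (`|a| + 1) dg.
move=> H; have {}H := H _ _ _.
suff e : J (fun x => a * cos (a * x + c) + - 1 * (x * sin (a * x + c))) = 0.
  move: e; rewrite gaussian_meanD.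
  - rewrite !gaussian_meanZ; last exact: sqr_dominated_cos; last exact: sqr_dominated_xsin.
    lra.
  - exact/sqr_dominatedZ/sqr_dominated_cos.
  - exact/sqr_dominatedZ/sqr_dominated_xsin.
rewrite /J /Rintegral (_ : (\int[mu]_x _)%E = 0%E)//.
rewrite -[RHS]H.
- by apply: eq_integral => x _; congr EFin; rewrite mulrDl mulN1r mulNr.
- move=> x.
  have cl : {for x, continuous (fun z : R => a * z + c)}.
    by apply/differentiable_continuous/derivable1_diffP; exact: ex_derive.
  have cp : {for x, continuous phi} by exact: continuous_std_normal_pdf.
  have cs : {for x, continuous (fun z : R => sin (a * z + c))}.
    by apply: continuous_comp => //; exact: continuous_sin.
  have cc : {for x, continuous (fun z : R => cos (a * z + c))}.
    by apply: continuous_comp => //; exact: continuous_cos.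
  apply: cvgB; apply: cvgM => //; apply: cvgM => //; exact: cvg_cst.
- move=> x; rewrite normrM (ger0_norm (normal_pdf_ge0 _ _ _)).
  rewrite ler_wpM2r ?normal_pdf_ge0// (le_trans (normr_sin_le1 _))//.
  by rewrite lerDr.
- move=> x; rewrite -mulrBl normrM (ger0_norm (normal_pdf_ge0 _ _ _)).
  rewrite ler_wpM2r ?normal_pdf_ge0// (le_trans (ler_normB _ _))//.
  rewrite !normrM mulrDl mul1r; apply: lerD.
    by rewrite ler_wpM2l// (le_trans (normr_cos_le1 _))// sqr_ge1D.
  by rewrite (le_trans _ (normr_x_le x))// ler_piMr// normr_sin_le1.
Qed.

(** A quadratic remainder bound gives the derivative directly, so a Gaussian mean can be
    differentiated in a parameter without a theorem on differentiation under the integral. *)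
Lemma is_derive_quadratic (f : R -> R) (x d C : R) :
  (forall h, `|f (x + h) - f x - h * d| <= C * h ^+ 2) -> is_derive x (1 : R) f d.
Proof.
move=> fC.
have cv : (fun h : R => h^-1 *: (f (h *: 1 + x) - f x)) @ 0^' --> d.
  apply/cvgrPdist_le => e e0; near=> h.
  have h0 : h != 0 by near: h; exact: nbhs_dnbhs_neq.
  have he : `|h| <= e / (`|C| + 1).
    near: h; apply: dnbhs0_le; rewrite divr_gt0// ltr_wpDl//.
  have -> : d - h^-1 *: (f (h *: 1 + x) - f x) = - (h^-1 * (f (x + h) - f x - h * d)).
    by rewrite /GRing.scale/= mulr1 [h + x]addrC; field.
  rewrite normrN normrM normrV ?unitfE//.
  rewrite ler_pdivrMl ?normr_gt0//; apply: le_trans (fC h) _.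
  rewrite -real_normK ?num_real// expr2 mulrCA ler_wpM2l//.
  have : C * `|h| <= `|C| * `|h| by rewrite ler_wpM2r// ler_norm.
  move: he; rewrite ler_pdivlMr ?ltr_wpDl//.
  have := normr_ge0 h; nra.
by apply: DeriveDef; [apply/cvg_ex; exists d|apply/cvg_lim].
Unshelve. all: by end_near. Qed.

(** As a function of [z], the mean of [cos (z t x + c)] solves the equation of
    [gaussian_ode_stability] with [v = t ^+ 2] and no error, by [gaussian_mean_stein]. *)
Lemma gaussian_mean_cos t c : J (fun x => cos (t * x + c)) = expR (- t ^+ 2 / 2) * cos c.
Proof.
pose psi z := J (fun x => cos (z * t * x + c)).
pose dpsi z := - t * J (fun x => x * sin (z * t * x + c)).
have dpsiE (z : R) : is_derive z (1 : R) psi (dpsi z).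
  apply: (@is_derive_quadratic _ _ _ (t ^+ 2 * J (fun x => x ^+ 2))) => h.
  pose r x := cos ((z + h) * t * x + c) + - 1 * cos (z * t * x + c)
    + h * t * (x * sin (z * t * x + c)).
  have e : psi (z + h) - psi z - h * dpsi z = J r.
    rewrite /r gaussian_meanD; [|apply: sqr_dominatedD|apply: sqr_dominatedZ].
    - rewrite gaussian_meanD; [|exact: sqr_dominated_cos|apply/sqr_dominatedZ/sqr_dominated_cos].
      rewrite !gaussian_meanZ; [|exact: sqr_dominated_cos|exact: sqr_dominated_xsin].
      by rewrite /psi /dpsi; ring.
    - exact: sqr_dominated_cos.
    - exact/sqr_dominatedZ/sqr_dominated_cos.
    - exact: sqr_dominated_xsin.
  have dr : sqr_dominated r.
    apply: sqr_dominatedD; last exact/sqr_dominatedZ/sqr_dominated_xsin.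
    apply: sqr_dominatedD; first exact: sqr_dominated_cos.
    exact/sqr_dominatedZ/sqr_dominated_cos.
  have hr x : `|r x| <= t ^+ 2 * h ^+ 2 * x ^+ 2.
    have := cos_taylor1 (z * t * x + c) ((z + h) * t * x + c).
    rewrite (_ : (z + h) * t * x + c - (z * t * x + c) = h * t * x); last by ring.
    rewrite (_ : (h * t * x) ^+ 2 = t ^+ 2 * h ^+ 2 * x ^+ 2); last by ring.
    by apply: le_trans; rewrite /r mulN1r mulrA.
  rewrite e mulrAC -gaussian_meanZ; last exact: sqr_dominated_sqr.
  rewrite ler_norml; apply/andP; split.
    rewrite -mulN1r -gaussian_meanZ; last exact/sqr_dominatedZ/sqr_dominated_sqr.
    apply: le_gaussian_mean => // [|x]; first exact/sqr_dominatedZ/sqr_dominatedZ/sqr_dominated_sqr.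
    by have := hr x; rewrite ler_norml mulN1r => /andP[].
  apply: le_gaussian_mean => // [|x]; first exact/sqr_dominatedZ/sqr_dominated_sqr.
  by have := hr x; rewrite ler_norml => /andP[].
have := gaussian_ode_stability (eps := 0) (sqr_ge0 t) dpsiE.
rewrite normr_le0 subr_eq0 => H.
have {}H : psi 1 == expR (- t ^+ 2 / 2) * psi 0.
  apply: H => z _; rewrite /dpsi gaussian_mean_stein normr_le0; apply/eqP.
  by rewrite /psi; ring.
rewrite -[RHS](_ : expR (- t ^+ 2 / 2) * psi 0 = _).
  by rewrite -(eqP H); apply: eq_Rintegral => x _; rewrite mul1r.
congr (_ * _); rewrite -[RHS]gaussian_mean_cst.
by apply: eq_Rintegral => x _; rewrite !mul0r add0r.
Qed.

Lemma measurable_cos_affine (t c : R) : measurable_fun setT (fun x : R => cos (t * x + c)).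
Proof. by have [] := sqr_dominated_cos t c. Qed.

Lemma integrable_bounded (d : measure_display) (T : measurableType d)
    (P : probability T R) (f : T -> R) (M : R) :
  measurable_fun setT f -> (forall x, `|f x| <= M) ->
  P.-integrable setT (EFin \o f).
Proof.
move=> mf fM; apply: (@le_integrable _ _ R P setT measurableT _ (EFin \o cst M)).
- exact/measurable_EFinP.
- by move=> x _; rewrite lee_fin (le_trans (fM x))//= ler_norm.
- exact: finite_measure_integrable_cst.
Qed.

Lemma std_normal_cos (t c : R) :
  (\int[normal_prob 0 1]_x (cos (t * x + c))%:E = (expR (- t ^+ 2 / 2) * cos c)%:E)%E.
Proof.
rewrite integral_normal_prob; last first.
  apply: (@integrable_bounded _ _ _ _ 1); first exact: measurable_cos_affine.
  by move=> x; exact: normr_cos_le1.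
rewrite -gaussian_mean_cos /J /Rintegral fineK//.
have := sqr_dominated_integrable (sqr_dominated_cos t c).
by move=> /(integrable_fin_num measurableT).
Qed.

End gaussian_fourier.

Section bivariate_gaussian.
Context {R : realType}.
Local Notation RR := (measurableTypeR R * measurableTypeR R)%type.

(** The summands [0] keep the map convertible to the one in [bivariate_normal] with mean
    [(0, 0)]. *)
Definition affine_map (A : 'M[R]_2) (z : RR) : RR :=
  (0 + A 0 0 * z.1 + A 0 1 * z.2, 0 + A 1 0 * z.1 + A 1 1 * z.2).

Lemma measurable_linear_form (a b : R) (c : R) :
  measurable_fun setT (fun z : RR => c + a * z.1 + b * z.2 : measurableTypeR R).
Proof.
apply: measurable_funD; last by apply: measurable_funM => //; exact: measurable_snd.
by apply: measurable_funD => //; apply: measurable_funM => //; exact: measurable_fst.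
Qed.

Lemma measurable_affine_map (A : 'M[R]_2) : measurable_fun setT (affine_map A).
Proof. by apply/measurable_fun_pairP; split; exact: measurable_linear_form. Qed.

HB.instance Definition _ (A : 'M[R]_2) :=
  isMeasurableFun.Build _ _ RR RR (affine_map A) (measurable_affine_map A).

Definition std_gaussian2 : probability RR R := (normal_prob 0 1 \x normal_prob 0 1)%E.

Definition affine_gaussian (A : 'M[R]_2) : probability RR R :=
  distribution std_gaussian2 (affine_map A).

Lemma affine_gaussian_bivariate_normal (A : 'M[R]_2) :
  bivariate_normal (affine_gaussian A) (0, 0) (A *m A^T).
Proof. by exists A. Qed.

(** By Fubini the inner integral is a one-dimensional cosine mean whose phase contains the outer
    variable, so [std_normal_cos] applies twice. *)
Lemma affine_gaussian_cos (A : 'M[R]_2) s t c :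
  (\int[affine_gaussian A]_z (cos (s * z.1 + t * z.2 + c))%:E
   = (expR (- ((s * A 0 0 + t * A 1 0) ^+ 2 + (s * A 0 1 + t * A 1 1) ^+ 2) / 2)
      * cos c)%:E)%E.
Proof.
have mf : measurable_fun setT (fun z : RR => cos (s * z.1 + t * z.2 + c)).
  apply: (measurableT_comp (f := (@cos R : measurableTypeR R -> measurableTypeR R))).
    by apply: continuous_measurable_fun; exact: continuous_cos.
  by under eq_fun do rewrite addrC addrA; exact: measurable_linear_form.
have mg : measurable_fun setT
    (fun z : RR => cos (s * (affine_map A z).1 + t * (affine_map A z).2 + c)).
  by apply: (measurableT_comp mf); exact: measurable_affine_map.
rewrite integral_pushforward//=; last 2 first.
- exact/measurable_EFinP.
- apply: (@integrable_bounded _ _ _ std_gaussian2 _ 1 mg) => z.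
  exact: normr_cos_le1.
rewrite preimage_setT -integral12_prod_meas1; last first.
  apply: (@integrable_bounded _ _ _ std_gaussian2 _ 1 mg) => z.
  exact: normr_cos_le1.
pose a := s * A 0 0 + t * A 1 0.
pose b := s * A 0 1 + t * A 1 1.
transitivity (\int[normal_prob 0 1]_(x in [set: measurableTypeR R])
    ((expR (- b ^+ 2 / 2))%:E * (cos (a * x + c))%:E))%E.
  apply: eq_integral => x _; rewrite /fubini_F -EFinM -std_normal_cos.
  apply: eq_integral => y _.
  have ringE (u v : R) : s * (0 + A 0 0 * u + A 0 1 * v)
      + t * (0 + A 1 0 * u + A 1 1 * v) + c = b * v + (a * u + c).
    by rewrite /a /b; ring.
  exact: (congr1 (EFin \o cos) (ringE x y)).
rewrite (@integralZl _ _ R (normal_prob 0 1) _ measurableT (fun x => (cos (a * x + c))%:E)); last first.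
  apply: (@integrable_bounded _ _ _ _ _ 1); first exact: measurable_cos_affine.
  by move=> x; exact: normr_cos_le1.
rewrite std_normal_cos -EFinM mulrA -expRD; congr (expR _ * _)%:E.
by rewrite -/a -/b; field.
Qed.

End bivariate_gaussian.

(** * Convergence in distribution from trigonometric moments *)

Section trigonometric_approximation.
Context {R : realType}.
Implicit Types (f g : R * R -> R) (z : R * R).

(** The free phase [c] makes sines and constants available as well, and the product-to-sum formula
    closes the class under products. *)
Inductive trig_poly : (R * R -> R) -> Prop :=
| trig_cos s t c : trig_poly (fun z => cos (s * z.1 + t * z.2 + c))
| trig_add f g : trig_poly f -> trig_poly g -> trig_poly (fun z => f z + g z)
| trig_scale k f : trig_poly f -> trig_poly (fun z => k * f z)
| trig_ext f g : f =1 g -> trig_poly f -> trig_poly g.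

Lemma trig_mul f g : trig_poly f -> trig_poly g -> trig_poly (fun z => f z * g z).
Proof.
move=> tf tg; elim: tf => {f} [s t c|f f' _ Hf _ Hf'|k f _ Hf|f f' ff' _ Hf].
- elim: tg => {g} [s' t' c'|g g' _ Hg _ Hg'|k g _ Hg|g g' gg' _ Hg].
  + apply: (@trig_ext (fun z =>
      2^-1 * (cos ((s + s') * z.1 + (t + t') * z.2 + (c + c'))
        + cos ((s - s') * z.1 + (t - t') * z.2 + (c - c'))))) => [z|].
      set a := s * z.1 + t * z.2 + c; set b := s' * z.1 + t' * z.2 + c'.
      have -> : (s + s') * z.1 + (t + t') * z.2 + (c + c') = a + b by rewrite /a /b; ring.
      have -> : (s - s') * z.1 + (t - t') * z.2 + (c - c') = a - b by rewrite /a /b; ring.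
      by rewrite cosD cosB; field.
    by apply: trig_scale; apply: trig_add; exact: trig_cos.
  + by apply: trig_ext (trig_add Hg Hg') => z; rewrite mulrDr.
  + by apply: trig_ext (trig_scale k Hg) => z; rewrite mulrCA.
  + by apply: trig_ext Hg => z; rewrite gg'.
- by apply: trig_ext (trig_add Hf Hf') => z; rewrite mulrDl.
- by apply: trig_ext (trig_scale k Hf) => z; rewrite mulrA.
- by apply: trig_ext Hf => z; rewrite ff'.
Qed.

Lemma trig_cst k : trig_poly (fun=> k).
Proof.
apply: (@trig_ext (fun z => k * cos (0 * z.1 + 0 * z.2 + 0))) => [z|].
  by rewrite !mul0r !addr0 cos0 mulr1.
by apply: trig_scale; exact: trig_cos.
Qed.

Lemma trig_sum (J : Type) (r : seq J) (P : pred J) (F : J -> R * R -> R) :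
  (forall j, trig_poly (F j)) -> trig_poly (fun z => \sum_(j <- r | P j) F j z).
Proof.
move=> tF; elim: r => [|j r IH].
  by apply: trig_ext (trig_cst 0) => z; rewrite big_nil.
case Pj : (P j).
  by apply: trig_ext (trig_add (tF j) IH) => z; rewrite big_cons Pj.
by apply: trig_ext IH => z; rewrite big_cons Pj.
Qed.

Lemma trig_prod (J : Type) (r : seq J) (P : pred J) (F : J -> R * R -> R) :
  (forall j, trig_poly (F j)) -> trig_poly (fun z => \prod_(j <- r | P j) F j z).
Proof.
move=> tF; elim: r => [|j r IH].
  by apply: trig_ext (trig_cst 1) => z; rewrite big_nil.
case Pj : (P j).
  by apply: trig_ext (trig_mul (tF j) IH) => z; rewrite big_cons Pj.
by apply: trig_ext IH => z; rewrite big_cons Pj.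
Qed.

(** This second moment controls Bernstein polynomials: the proportion [#|A| / m] concentrates at
    [u]. *)
Lemma bern_mean_card_variance (m : nat) (u : R) : 0 <= u <= 1 ->
  bern_mean u (fun A : {set 'I_m} => (#|A|%:R - m%:R * u) ^+ 2) = m%:R * (u * (1 - u)).
Proof.
move=> u01.
pose e (i : 'I_m) (A : {set 'I_m}) : R := (i \in A)%:R - u.
have meanE i : bern_mean u (fun A : {set 'I_m} => (i \in A)%:R) = u.
  rewrite -[RHS]expr1 -(cards1 i) -bern_mean_subset.
  by apply: eq_bern_mean => A; rewrite finset.sub1set.
have cardE (A : {set 'I_m}) : #|A|%:R - m%:R * u = \sum_i e i A.
  rewrite sumrB sumr_const card_ord mulr_natl; congr (_ - _).
  by rewrite -sum1_card natr_sum big_mkcond/=; apply: eq_bigr => i _; case: (i \in A).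
transitivity (\sum_i \sum_j bern_mean u (fun A => e i A * e j A)).
  under eq_bigr do rewrite -bern_mean_sum.
  rewrite -bern_mean_sum; apply: eq_bern_mean => A; rewrite cardE expr2 mulr_suml.
  by apply: eq_bigr => i _; rewrite mulr_sumr.
rewrite (eq_bigr (fun=> u * (1 - u))) => [|i _].
  by rewrite sumr_const card_ord mulr_natl.
rewrite (bigD1 i)//= big1 ?addr0 => [|j ji].
  transitivity (bern_mean u (fun A : {set 'I_m} => (1 - 2 * u) * (i \in A)%:R + u ^+ 2)).
    by apply: eq_bern_mean => A; rewrite /e; case: (i \in A) => /=; ring.
  by rewrite bern_meanD bern_meanZ bern_mean_cst meanE; ring.
rewrite (@bern_mean_indep _ _ _ [set i]%SET).
- by rewrite /e bern_meanB bern_mean_cst meanE subrr mul0r.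
- by move=> A; rewrite /e !inE eqxx andbT.
- by move=> A; rewrite /e !inE ji.
Qed.

(** The two arguments play different roles: [s] stays in [[-1/2, 1/2]], where a move by [d <= 1/2]
    changes the sine by at least [d cos 1], while [a] may be any value of [asin]. Monotonicity on
    [[-pi/2, pi/2]] extends the gap beyond distance [d]. *)
Lemma sin_separation (del : R) : 0 < del ->
  exists2 eta : R, 0 < eta & forall s a : R, `|s| <= 2^-1 -> - (pi / 2) <= a <= pi / 2 ->
    `|sin s - sin a| < eta -> `|s - a| < del.
Proof.
move=> del0; pose d := Num.min del 2^-1.
have d0 : 0 < d by rewrite lt_min del0/=; lra.
have d2 : d <= 2^-1 by rewrite ge_min lexx orbT.
have ddel : d <= del by rewrite ge_min lexx.
have c1 := @cos1_gt0 R; have pi21 : 1 <= pi / 2 :> R.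
  have [pih h1 h2] := @cos_exists R.
  have [h3 h4] := @pihalf_02_cos_pihalf R.
  have -> : pi / 2 = pih by apply: cos_02_uniq => //; lra.
  by case/andP: h1.
exists (d * cos 1); first exact: mulr_gt0.
have cosge (w : R) : -1 <= w -> w <= 1 -> cos 1 <= cos w.
  wlog w0 : w / 0 <= w => [hw w1 w2|_].
    by have [/hw|/ltW w0] := leP 0 w; [exact|rewrite -(cosN w); apply: hw; lra].
  rewrite [w <= 1]le_eqVlt => /predU1P[->//|w1].
  by apply: ltW; rewrite ltr_cos ?in_itv//=; lra.
have ler_sin (x y : R) : - (pi / 2) <= x -> x <= y -> y <= pi / 2 -> sin x <= sin y.
  by move=> *; rewrite leNgt ltr_sin ?in_itv/= -?leNgt//; lra.
(* On [-1, 1] the derivative of sin is at least cos 1. *)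
have inc (x y : R) : -1 <= x -> x <= y -> y <= 1 -> (y - x) * cos 1 <= sin y - sin x.
  move=> x1 xy y1.
  have cs : {within `[x, y], continuous (@sin R)}.
    by apply: continuous_subspaceT; exact: continuous_sin.
  have [w + ->] := MVT_segment xy (fun w _ => is_derive_sin w) cs.
  rewrite in_itv/= => /andP[xw wy].
  by rewrite mulrC ler_wpM2r ?subr_ge0// cosge//; lra.
move=> s a; rewrite ler_norml => /andP[s1 s2] /andP[a1 a2].
rewrite ltr_norml => /andP[h1 h2].
have [sa|as_] := leP s a.
  rewrite ler0_norm ?subr_le0// opprB ltNge; apply/negP => sda.
  have h := inc s (s + d).
  have {h} : (s + d - s) * cos 1 <= sin (s + d) - sin s by apply: h; lra.
  have : sin (s + d) <= sin a by apply: ler_sin; lra.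
  lra.
rewrite gtr0_norm ?subr_gt0// ltNge; apply/negP => sda.
have h := inc (s - d) s.
have {h} : (s - (s - d)) * cos 1 <= sin s - sin (s - d) by apply: h; lra.
have : sin a <= sin (s - d) by apply: ler_sin; lra.
lra.
Qed.

(** Only the first point is confined to the box, because the nodes [a A] of the approximation below
    range over [[- pi K, pi K]]. *)
Lemma heine (f : R * R -> R) (B eps : R) : continuous f -> 0 < eps ->
  exists2 del : R, 0 < del & forall x y x' y', `|x| <= B -> `|y| <= B ->
    `|x - x'| < del -> `|y - y'| < del -> `|f (x, y) - f (x', y')| <= eps.
Proof.
move=> cf e0.
have cB : compact ([set` `[- B, B]] `*` [set` `[- B, B]] : set (R * R)).
  by apply: compact_setX; exact: segment_compact.
pose Q (d : R) z := forall z' : R * R, `|z.1 - z'.1| < d -> `|z.2 - z'.2| < d ->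
  `|f z - f z'| <= eps.
suff H : \forall d \near (0:R)^'+, ([set` `[- B, B]] `*` [set` `[- B, B]] : set (R * R)) `<=` Q d.
  have : \forall d \near (0:R)^'+, 0 < d /\ ([set` `[- B, B]] `*` [set` `[- B, B]]) `<=` Q d.
    by near=> d; split; near: d; [exact: nbhs_right_gt|exact: H].
  move=> /filter_ex[d [d0 hd]]; exists d => // x y x' y' xB yB x1 y1.
  by apply: (hd (x, y)) => //=; split; rewrite /= in_itv/= -ler_norml.
apply: (compact_near_coveringP _).1 cB _ _ _ _ _ => z _.
  
  have /cvgrPdist_lt/(_ (eps / 2)) := cf z.
  move=> /(_ (divr_gt0 e0 _))/=; rewrite ltr0n => /(_ isT).
  rewrite -nbhs_ballE => -[r /= r0 hr].
  exists (ball z (r / 2), [set d : R | 0 < d < r / 2]) => /=.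
    split; first by apply: nbhsx_ballx; rewrite divr_gt0.
    by near=> d; apply/andP; split; near: d; [exact: nbhs_right_gt|apply: nbhs_right_lt; rewrite divr_gt0].
  move=> [w d]/= [[w1 w2] /andP[d0 dr]] z' z1 z2.
  have hw : `|f z - f w| < eps / 2.
    apply: hr; split => /=; rewrite /ball/=.
      by move: w1; rewrite /ball/=; lra.
    by move: w2; rewrite /ball/=; lra.
  have hz' : `|f z - f z'| < eps / 2.
    apply: hr; split => /=; rewrite /ball/=.
      rewrite (_ : z.1 - z'.1 = (z.1 - w.1) + (w.1 - z'.1)); last by ring.
      by apply: le_lt_trans (ler_normD _ _) _; move: w1; rewrite /ball/=; lra.
    rewrite (_ : z.2 - z'.2 = (z.2 - w.2) + (w.2 - z'.2)); last by ring.
    by apply: le_lt_trans (ler_normD _ _) _; move: w2; rewrite /ball/=; lra.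
  have -> : f w - f z' = (f z - f z') - (f z - f w) by ring.
  by apply: le_trans (ler_normB _ _) _; lra.
Unshelve. all: by end_near. Qed.

(* The approximant is the Bernstein polynomial of f in the variable
   u = (1 + sin (x / 2K)) / 2, which separates the points of [-K, K]. *)
Lemma trig_approximation (f : R * R -> R) (M K eps : R) : continuous f ->
  (forall z, `|f z| <= M) -> 0 < K -> 0 < eps ->
  exists g, [/\ trig_poly g, forall z, `|g z| <= M &
    forall z, `|z.1| <= K -> `|z.2| <= K -> `|f z - g z| <= eps].
Proof.
move=> cf fM K0 e0.
have M0 : 0 <= M by exact: le_trans (fM (0, 0)).
have [del del0 hdel] := @heine f K (eps / 2) cf (divr_gt0 e0 (ltr0Sn _ _)).
have [eta eta0 heta] := sin_separation (divr_gt0 del0 (mulr_gt0 (ltr0Sn R 1) K0)).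
(* This size makes the error [8 M / (eta ^+ 2 m)] coming from the variance at most [eps / 4] in each
   coordinate. *)
pose m := (Num.truncn (32 * M / (eta ^+ 2 * eps))).+1.
have mE : 32 * M <= m%:R * (eta ^+ 2 * eps).
  by rewrite -ler_pdivrMr ?mulr_gt0 ?exprn_gt0// ltW// truncnS_gt.
pose u (x : R) : R := (1 + sin (x / (2 * K))) / 2.
have u01 x : 0 <= u x <= 1.
  by have := sin_geN1 (x / (2 * K)); have := sin_le1 (x / (2 * K)); rewrite /u; lra.
(* [a A] is a point where [u] takes the value [#|A| / m]: the nodes are equidistant in the variable
   [u]. *)
pose a (A : {set 'I_m}) : R := 2 * K * asin (2 * (#|A|%:R / m%:R) - 1).
pose g z := bern_mean (u z.1) (fun A => bern_mean (u z.2) (fun B => f (a A, a B))).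
have mp : 0 < m%:R :> R by rewrite ltr0n.
have var x : bern_mean (u x) (fun A : {set 'I_m} => (u x - #|A|%:R / m%:R) ^+ 2) <= m%:R^-1.
  have -> : bern_mean (u x) (fun A : {set 'I_m} => (u x - #|A|%:R / m%:R) ^+ 2) =
      m%:R ^- 2 * (m%:R * (u x * (1 - u x))).
    rewrite -bern_mean_card_variance// -bern_meanZ; apply: eq_bern_mean => A.
    by field; rewrite lt0r_neq0.
  rewrite [leLHS](_ : _ = m%:R^-1 * (u x * (1 - u x))); last first.
    by field; rewrite lt0r_neq0.
  by rewrite ler_piMr ?invr_ge0//; have := u01 x; nra.
(* The separation of sin turns a small difference of u-values into a small difference of arguments. *)
have sep x (A : {set 'I_m}) : `|x| <= K -> `|u x - #|A|%:R / m%:R| < eta / 2 -> `|x - a A| < del.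
  move=> xK h; set c := #|A|%:R / m%:R in h.
  have c01 : 0 <= c <= 1.
    rewrite divr_ge0//= ler_pdivrMr// mul1r ler_nat.
    by rewrite -[X in (_ <= X)%N](card_ord m) max_card.
  have hs : `|x / (2 * K) - asin (2 * c - 1)| < del / (2 * K).
    apply: heta.
    - rewrite normrM normfV [`|2 * K|]gtr0_norm; last by rewrite mulr_gt0.
      by rewrite ler_pdivrMr ?mulr_gt0//; lra.
    - by rewrite asin_geNpi2 ?asin_lepi2//; lra.
    - rewrite asinK ?in_itv/=; last lra.
      rewrite (_ : sin (x / (2 * K)) - (2 * c - 1) = 2 * (u x - c)); last by rewrite /u; field.
      by rewrite normrM ger0_norm//; lra.
  rewrite (_ : x - a A = 2 * K * (x / (2 * K) - asin (2 * c - 1))); last first.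
    by rewrite /a -/c; field; rewrite lt0r_neq0.
  rewrite normrM gtr0_norm ?mulr_gt0//.
  by rewrite mulrC -ltr_pdivlMr ?mulr_gt0.
have tw (h : R * R -> R) (A : {set 'I_m}) : trig_poly h ->
    trig_poly (fun z => bern_weight (h z) [set: 'I_m]%SET A).
  move=> th; apply: (trig_prod _ _ (F := fun i z => if i \in A then h z else 1 - h z)) => i.
  case: (i \in A) => //.
  apply: trig_ext (trig_add (trig_cst 1) (trig_scale (-1) th)) => z.
  by rewrite mulN1r.
have tu1 : trig_poly (fun z => u z.1).
  apply: trig_ext (trig_scale 2^-1 (trig_add (trig_cst 1) (trig_cos (2 * K)^-1 0 (- (pi / 2))))) => z.
  by rewrite cosBpihalf mul0r addr0 /u mulrC (mulrC _^-1).
have tu2 : trig_poly (fun z => u z.2).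
  apply: trig_ext (trig_scale 2^-1 (trig_add (trig_cst 1) (trig_cos 0 (2 * K)^-1 (- (pi / 2))))) => z.
  by rewrite cosBpihalf mul0r add0r /u mulrC (mulrC _^-1).
exists g; split.
- apply: trig_sum => A; apply: trig_mul; first exact: tw.
  apply: trig_sum => B; apply: trig_mul; first exact: tw.
  exact: trig_cst.
- move=> z; apply: le_trans (ler_norm_bern_mean (u01 _) _) _.
  rewrite -[leRHS](@bern_mean_cst _ 'I_m (u z.1)); apply: le_bern_mean => // A.
  apply: le_trans (ler_norm_bern_mean (u01 _) _) _.
  by rewrite -[leRHS](@bern_mean_cst _ 'I_m (u z.2)); apply: le_bern_mean.
- move=> [x y]/= xK yK.
  pose q (t : R) (A : {set 'I_m}) := 8 * M / eta ^+ 2 * (u t - #|A|%:R / m%:R) ^+ 2.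
  have eta2 : 0 < eta ^+ 2 by rewrite exprn_gt0.
  have c0 : 0 <= 8 * M / eta ^+ 2 := divr_ge0 (mulr_ge0 (ler0n _ 8) M0) (ltW eta2).
  (* Chebyshev in pointwise form: if both proportions are within [eta / 2], uniform continuity
     applies; otherwise the [q] of the bad coordinate is at least [2 M]. *)
  have pt A B : `|f (x, y) - f (a A, a B)| <= eps / 2 + q x A + q y B.
    have q0 t (C : {set 'I_m}) : 0 <= q t C by rewrite /q mulr_ge0 ?sqr_ge0.
    have qM t (C : {set 'I_m}) : eta / 2 <= `|u t - #|C|%:R / m%:R| -> 2 * M <= q t C.
      move=> h; rewrite /q [leLHS](_ : _ = 8 * M / eta ^+ 2 * (eta ^+ 2 / 4)); last first.
        by field; rewrite lt0r_neq0.
      rewrite ler_wpM2l//.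
      by rewrite -[leRHS]ger0_norm ?sqr_ge0// normrX; nra.
    have f2M : `|f (x, y) - f (a A, a B)| <= 2 * M.
      by apply: le_trans (ler_normB _ _) _; rewrite mulr_natl mulr2n lerD.
    have [hA|/(qM x)] := ltP `|u x - #|A|%:R / m%:R| (eta / 2); last first.
      by have := q0 y B; lra.
    have [hB|/(qM y)] := ltP `|u y - #|B|%:R / m%:R| (eta / 2); last first.
      by have := q0 x A; lra.
    have := hdel _ _ _ _ xK yK (sep _ _ xK hA) (sep _ _ yK hB).
    by have := q0 x A; have := q0 y B; lra.
  have -> : f (x, y) - g (x, y) = bern_mean (u x) (fun A => bern_mean (u y)
      (fun B => f (x, y) - f (a A, a B))).
    rewrite /g/= -[f (x, y) in LHS](@bern_mean_cst _ 'I_m (u x)) -bern_meanB.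
    apply: eq_bern_mean => A.
    by rewrite -[f (x, y) in LHS](@bern_mean_cst _ 'I_m (u y)) -bern_meanB.
  apply: le_trans (ler_norm_bern_mean (u01 _) _) _.
  apply: (@le_trans _ _ (bern_mean (u x) (fun A => (eps / 2 + q x A)
     + bern_mean (u y) (fun B : {set 'I_m} => q y B)))).
    apply: le_bern_mean => // A; apply: le_trans (ler_norm_bern_mean (u01 _) _) _.
    rewrite -[X in X + _](@bern_mean_cst _ 'I_m (u y)) -bern_meanD.
    by apply: le_bern_mean.
  rewrite !bern_meanD !bern_mean_cst !bern_meanZ.
  have h1 := ler_wpM2l c0 (var x); have h2 := ler_wpM2l c0 (var y).
  have h3 : 8 * M / eta ^+ 2 * m%:R^-1 <= eps / 4.
    rewrite ler_pdivrMr// ler_pdivrMr//; move: mE; lra.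
  apply: le_trans (lerD (lerD (lexx _) (le_trans h1 h3)) (le_trans h2 h3)) _.
  by rewrite le_eqVlt; apply/orP; left; apply/eqP; field.
Qed.

End trigonometric_approximation.

Section weak_convergence.
Context {R : realType}.
Local Notation RR := (measurableTypeR R * measurableTypeR R)%type.
Variables (E : nat -> (R * R -> R) -> R) (N : probability RR R).

Hypothesis mean_add : forall n f g, (0 < n)%N ->
  E n (fun z => f z + g z) = E n f + E n g.
Hypothesis mean_scale : forall n k f, (0 < n)%N -> E n (fun z => k * f z) = k * E n f.
Hypothesis mean_cst : forall n c, (0 < n)%N -> E n (fun=> c) = c.
Hypothesis mean_mono : forall n f g, (0 < n)%N -> (forall z, f z <= g z) -> E n f <= E n g.
Hypothesis mean_sqr : \forall n \near \oo, E n (fun z => z.1 ^+ 2 + z.2 ^+ 2) <= 2.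
Hypothesis mean_cos : forall s t c,
  E n (fun z => cos (s * z.1 + t * z.2 + c)) @[n --> \oo] -->
  (\int[N]_z cos (s * z.1 + t * z.2 + c)).

Lemma trig_poly_measurable (f : RR -> R) : trig_poly f -> measurable_fun setT f.
Proof.
elim=> {f} [s t c|f g _ mf _ mg|k f _ mf|f g fg _ mf].
- apply: (measurableT_comp (f := (@cos R : measurableTypeR R -> measurableTypeR R))).
    by apply: continuous_measurable_fun; exact: continuous_cos.
  by under eq_fun do rewrite addrC addrA; exact: measurable_linear_form.
- exact: measurable_funD.
- exact: measurable_funM.
- by rewrite (_ : g = f)//; apply/funext => z; rewrite fg.
Qed.

Lemma trig_poly_bounded (f : R * R -> R) : trig_poly f -> exists M, forall z, `|f z| <= M.
Proof.
elim=> {f} [s t c|f g _ [M fM] _ [L gL]|k f _ [M fM]|f g fg _ [M fM]].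
- by exists 1 => z; exact: normr_cos_le1.
- by exists (M + L) => z; rewrite (le_trans (ler_normD _ _))// lerD.
- by exists (`|k| * M) => z; rewrite normrM ler_wpM2l.
- by exists M => z; rewrite -fg.
Qed.

Lemma trig_poly_integrable (f : RR -> R) : trig_poly f -> N.-integrable setT (EFin \o f).
Proof.
move=> tf; have [M fM] := trig_poly_bounded tf.
by apply: (integrable_bounded N _ fM); exact: trig_poly_measurable.
Qed.

Lemma trig_poly_cvg (f : R * R -> R) : trig_poly f ->
  E n f @[n --> \oo] --> (\int[N]_z f z).
Proof.
elim=> {f} [s t c|f g tf Hf tg Hg|k f tf Hf|f g fg _ Hf].
- exact: mean_cos.
- rewrite RintegralD//; [|exact: trig_poly_integrable|exact: trig_poly_integrable].
  apply: cvg_trans (cvgD Hf Hg); apply: near_eq_cvg; near=> n.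
  by rewrite /= mean_add//; near: n; exact: nbhs_infty_gt.
- rewrite RintegralZl//; last exact: trig_poly_integrable.
  apply: cvg_trans (cvgMl_tmp (a := k) Hf); apply: near_eq_cvg; near=> n.
  by rewrite /= mean_scale//; near: n; exact: nbhs_infty_gt.
- by rewrite (_ : g = f)//; apply/funext => z; rewrite fg.
Unshelve. all: by end_near. Qed.

(** The plane carries the product sigma-algebra; a continuous function is measurable for it as a
    pointwise limit of trigonometric polynomials approximating it on growing boxes. *)
Lemma continuous_measurable2 (f : R * R -> R) (M : R) :
  continuous f -> (forall z, `|f z| <= M) -> measurable_fun setT (f : RR -> R).
Proof.
move=> cf fM.
have /choice[g gP] : forall n, exists g, [/\ trig_poly g, forall z, `|g z| <= M &
    forall z : R * R, `|z.1| <= n.+1%:R -> `|z.2| <= n.+1%:R -> `|f z - g z| <= n.+1%:R^-1].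
  by move=> n; apply: trig_approximation.
apply: (@measurable_fun_cvg _ _ _ _ g).
  by move=> n; apply: trig_poly_measurable; have [] := gP n.
move=> z _; apply/cvgrPdist_le => e e0; near=> n.
have [_ _ h] := gP n; apply: le_trans (h z _ _) _.
- apply: (@le_trans _ _ n%:R); last by rewrite ler_nat.
  by near: n; exact: nbhs_infty_ger.
- apply: (@le_trans _ _ n%:R); last by rewrite ler_nat.
  by near: n; exact: nbhs_infty_ger.
- rewrite invf_ple ?posrE//; apply: (@le_trans _ _ n%:R); last by rewrite ler_nat.
  by near: n; exact: nbhs_infty_ger.
Unshelve. all: by end_near. Qed.

(** A substitute for the indicator of the outside of a box. It is at most the squared norm over
    [K ^+ 2], which serves for [E n], and at most 1, so that dominated convergence handles its
    integral under [N]. *)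
Definition tail (K : R) (z : R * R) : R := Num.min 1 ((z.1 ^+ 2 + z.2 ^+ 2) / K ^+ 2).

Lemma tail_ge0 K z : 0 <= tail K z.
Proof. by rewrite /tail le_min ler01 divr_ge0 ?sqr_ge0// addr_ge0 ?sqr_ge0. Qed.

Lemma tail_le1 K z : tail K z <= 1.
Proof. by rewrite /tail ge_min lexx. Qed.

Lemma measurable_tail K : measurable_fun setT (tail K : RR -> R).
Proof.
apply: measurable_minr => //; apply: measurable_funM => //.
by apply: measurable_funD; apply: measurable_funX.
Qed.

Lemma integrable_tail K : N.-integrable setT (EFin \o (tail K : RR -> R)).
Proof.
apply: (integrable_bounded N (M := 1)); first exact: measurable_tail.
by move=> z; rewrite ger0_norm ?tail_ge0 ?tail_le1.
Qed.

Lemma integral_tail_cvg0 : (\int[N]_z tail n.+1%:R z) @[n --> \oo] --> (0 : R).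
Proof.
have cv : (\int[N]_z (tail n.+1%:R z)%:E @[n --> \oo] --> \int[N]_z (cst 0 z))%E.
  have mf_ n : measurable_fun setT (fun z : RR => (tail n.+1%:R z)%:E).
    by apply/measurable_EFinP; exact: measurable_tail.
  have cvf : {ae N, forall z : RR, setT z ->
      (tail n.+1%:R z)%:E @[n --> \oo] --> (cst 0%E z : \bar R)}.
    apply: aeW => z _; apply: cvg_EFin; first exact: nearW.
    apply/cvgr0Pnorm_le => e e0; near=> n.
    rewrite /= ger0_norm ?tail_ge0// /tail ge_min; apply/orP; right.
    rewrite ler_pdivrMr ?exprn_gt0// -ler_pdivrMl//.
    apply: (@le_trans _ _ n.+1%:R); last first.
      by rewrite -[leLHS]expr1 ler_weXn2l// ler1n.
    apply: (@le_trans _ _ n%:R); last by rewrite ler_nat.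
    by near: n; exact: nbhs_infty_ger.
  have ig : N.-integrable setT (EFin \o cst 1) by exact: finite_measure_integrable_cst.
  have dom : {ae N, forall (z : RR) (n : nat), setT z ->
      (`|(tail n.+1%:R z)%:E| <= (EFin \o (cst 1%R : RR -> R)) z)%E}.
    by apply: aeW => z n _; rewrite lee_fin ger0_norm ?tail_ge0 ?tail_le1.
  by have [] := @dominated_convergence _ _ R N setT measurableT _ _ _ mf_ (measurable_cst _) cvf ig dom.
rewrite integral_cst// mul0e in cv.
by have /fine_cvgP[] := cv.
Unshelve. all: by end_near. Qed.

(** The trigonometric approximant is close to [f] on a box only, but it has the same bound [M]:
    outside, the difference is at most [2 M] and is paid for by [tail]. *)
Lemma weak_cvg (f : R * R -> R) (M : R) : continuous f -> (forall z, `|f z| <= M) ->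
  E n f @[n --> \oo] --> (\int[N]_z f z).
Proof.
move=> cf fM; apply/cvgrPdist_le => e e0.
have M0 : 0 <= M by exact: le_trans (fM (0, 0)).
(* The three comparisons at the end add up to [(3 + 4 M) e'], which is below [8 (M + 1) e' = e]. *)
pose e' := e / (8 * (M + 1)).
have M1 : 0 < M + 1 by rewrite ltr_wpDl.
have e'0 : 0 < e' by rewrite divr_gt0// mulr_gt0.
have e'E : e' * (8 * (M + 1)) = e by rewrite /e' divfK// lt0r_neq0// mulr_gt0.
have /cvgr0Pnorm_le/(_ _ e'0) Htail := integral_tail_cvg0.
have [k [Nk k1]] : exists k : nat, (\int[N]_z tail k.+1%:R z <= e') /\ 2 <= k.+1%:R ^+ 2 * e'.
  near \oo => k; exists k; split.
    by apply: le_trans (ler_norm _) _; near: k; exact: Htail.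
  rewrite mulrC -ler_pdivrMl//.
  apply: (@le_trans _ _ k.+1%:R); last first.
    by rewrite -[leLHS]expr1 ler_weXn2l// ler1n.
  apply: (@le_trans _ _ k%:R); last by rewrite ler_nat.
  by near: k; exact: nbhs_infty_ger.
have [g [tg gM fg]] := trig_approximation cf fM (ltr0Sn R k) e'0.
have pt z : `|f z - g z| <= e' + 2 * M * tail k.+1%:R z.
  have h0 : 0 <= 2 * M by rewrite mulr_ge0.
  have f2M : `|f z - g z| <= 2 * M.
    by apply: le_trans (ler_normB _ _) _; rewrite mulr_natl mulr2n lerD.
  have out : k.+1%:R ^+ 2 <= z.1 ^+ 2 + z.2 ^+ 2 -> `|f z - g z| <= e' + 2 * M * tail k.+1%:R z.
    move=> h; rewrite /tail min_l; last by rewrite ler_pdivlMr ?exprn_gt0// mul1r.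
    by rewrite mulr1 (le_trans f2M)// lerDr ltW.
  have [h1|h1] := leP `|z.1| k.+1%:R; last first.
    apply: out; rewrite -[z.1 ^+ 2]real_normK ?num_real//.
    have h : k.+1%:R ^+ 2 <= `|z.1| ^+ 2 by rewrite lerXn2r ?nnegrE// ltW.
    by have := sqr_ge0 z.2; lra.
  have [h2|h2] := leP `|z.2| k.+1%:R; last first.
    apply: out; rewrite -[z.2 ^+ 2]real_normK ?num_real//.
    have h : k.+1%:R ^+ 2 <= `|z.2| ^+ 2 by rewrite lerXn2r ?nnegrE// ltW.
    by have := sqr_ge0 z.1; lra.
  by rewrite (le_trans (fg _ h1 h2))// lerDl mulr_ge0// tail_ge0.
have /cvgrPdist_le/(_ _ e'0) cvg_g := trig_poly_cvg tg.
near=> n.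
have n0 : (0 < n)%N by near: n; exact: nbhs_infty_gt.
have ET : E n (tail k.+1%:R) <= e'.
  have : E n (fun z => z.1 ^+ 2 + z.2 ^+ 2) <= 2 by near: n; exact: mean_sqr.
  have : E n (tail k.+1%:R) <= E n (fun z => k.+1%:R ^- 2 * (z.1 ^+ 2 + z.2 ^+ 2)).
    by apply: mean_mono => // z; rewrite /tail ge_min [X in _ || X]le_eqVlt mulrC eqxx orbT.
  rewrite mean_scale// => h1 h2; apply: le_trans h1 _.
  by rewrite ler_pdivrMl ?exprn_gt0// (le_trans h2).
have mono1 (u v : R * R -> R) : (forall z, `|u z - v z| <= e' + 2 * M * tail k.+1%:R z) ->
    E n u <= E n v + (e' + 2 * M * e').
  move=> uv; apply: (@le_trans _ _ (E n (fun z => v z + (e' + 2 * M * tail k.+1%:R z)))).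
    by apply: mean_mono => // z; have := uv z; rewrite ler_norml => /andP[_]; lra.
  by rewrite !mean_add// mean_cst// mean_scale// !lerD2l ler_wpM2l// mulr_ge0.
have En : `|E n f - E n g| <= e' + 2 * M * e'.
  rewrite ler_norml; apply/andP; split.
    by have := mono1 g f; move=> /(_ (fun z => eq_ind _ (fun r => r <= _) (pt z) _ (distrC _ _))); lra.
  by have := mono1 f g pt; lra.
have intf : N.-integrable setT (EFin \o (f : RR -> R)).
  by apply: (integrable_bounded N _ fM); exact: continuous_measurable2 fM.
have intg : N.-integrable setT (EFin \o (g : RR -> R)) by exact: trig_poly_integrable.
have mono2 (u v : RR -> R) : N.-integrable setT (EFin \o u) ->
    N.-integrable setT (EFin \o v) ->
    (forall z, `|u z - v z| <= e' + 2 * M * tail k.+1%:R z) ->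
    \int[N]_z u z <= \int[N]_z v z + (e' + 2 * M * e').
  move=> iu iv uv.
  have it : N.-integrable setT (EFin \o (fun z : RR => 2 * M * tail k.+1%:R z)).
    exact: (@integrableZl _ _ R N setT measurableT (2 * M) _ (integrable_tail _)).
  have ic : N.-integrable setT (EFin \o (fun z : RR => e' + 2 * M * tail k.+1%:R z)).
    exact: (@integrableD _ _ R N setT measurableT _ _ (finite_measure_integrable_cst N e' measurableT) it).
  apply: (@le_trans _ _ (\int[N]_z (v z + (e' + 2 * M * tail k.+1%:R z)))).
    apply: le_Rintegral => //.
      exact: (@integrableD _ _ R N setT measurableT _ _ iv ic).
    by move=> z _; have := uv z; rewrite ler_norml => /andP[_]; lra.
  rewrite RintegralD// lerD2l RintegralD//; last exact: finite_measure_integrable_cst.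
  rewrite Rintegral_cst// (_ : fine _ = 1) ?mulr1 ?lerD2l; last first.
    by rewrite -[RHS]/(fine 1%E); congr fine; exact: probability_setT.
  rewrite RintegralZl//; last exact: integrable_tail.
  by rewrite ler_wpM2l// mulr_ge0.
have NN : `|\int[N]_z f z - \int[N]_z g z| <= e' + 2 * M * e'.
  rewrite ler_norml; apply/andP; split.
    by have := mono2 g f intg intf; move=> /(_ (fun z => eq_ind _ (fun r => r <= _) (pt z) _ (distrC _ _))); lra.
  by have := mono2 f g intf intg pt; lra.
have Eg : `|\int[N]_z g z - E n g| <= e' by near: n; exact: cvg_g.
have -> : \int[N]_z f z - E n f = (\int[N]_z f z - \int[N]_z g z)
   + (\int[N]_z g z - E n g) - (E n f - E n g) by ring.
apply: le_trans (ler_normB _ _) _.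
apply: le_trans (lerD (ler_normD _ _) (lexx _)) _.
apply: le_trans (lerD (lerD NN Eg) En) _.
rewrite -e'E; nra.
Unshelve. all: by end_near. Qed.

End weak_convergence.

(** * Counting arithmetic progressions *)

Section arithmetic_progressions.
Local Open Scope nat_scope.
Variables (n l : nat).
Hypothesis l3 : (2 < l)%N.
Local Notation m := l.-1.

Definition ap_set (a b : nat) : {set 'I_n} :=
  [set i : 'I_n | [exists k : 'I_l, i.+1 == (a + k * b)%N]]%SET.

Definition ap_params : {set 'I_n.+1 * 'I_n.+1} :=
  [set q : 'I_n.+1 * 'I_n.+1 | [&& (0 < q.1)%N, (0 < q.2)%N & (q.1 + m * q.2 <= n)%N]]%SET.

Lemma mem_ap_set a b (i : 'I_n) :
  reflect (exists2 k : nat, (k < l)%N & i.+1 = (a + k * b)%N) (i \in ap_set a b).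
Proof.
rewrite inE; apply: (iffP existsP) => [[k /eqP e]|[k kl e]]; first by exists k.
by exists (Ordinal kl); apply/eqP.
Qed.

Lemma APs_imset : APs n l = [set ap_set q.1 q.2 | q : 'I_n.+1 * 'I_n.+1 in ap_params]%SET.
Proof.
apply/setP => A; apply/idP/imsetP.
  rewrite inE => /asboolP[a [b [a1 b1 abn hA]]].
  have an : a < n.+1 by rewrite ltnS (leq_trans _ abn)// leq_addr.
  have m0 : 0 < m by lia.
  have bn : b < n.+1.
    by rewrite ltnS (leq_trans _ abn)// (leq_trans _ (leq_addl _ _))// leq_pmull.
  exists (Ordinal an, Ordinal bn); first by rewrite inE /= a1 b1 abn.
  by apply/setP => i; apply/idP/mem_ap_set => /hA.
case=> -[a b]; rewrite inE/= => /and3P[a0 b0 abn] ->.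
rewrite inE; apply/asboolP; exists a, b; split => // i.
by split => /mem_ap_set.
Qed.

Lemma ap_params_lt (q : 'I_n.+1 * 'I_n.+1) k : q \in ap_params -> (k < l)%N ->
  (0 < q.1 + k * q.2 <= n)%N.
Proof. by rewrite inE => /and3P[? ? ?] ?; apply/andP; split; nia. Qed.

(** Each first term is the other one plus a nonnegative multiple of a difference, so they agree. The
    second terms then show that each difference is a positive multiple of the other. *)
Lemma ap_set_inj : {in ap_params &, injective (fun q : 'I_n.+1 * 'I_n.+1 => ap_set q.1 q.2)}.
Proof.
move=> [a b] [a' b'] hq hq' /= e.
have mem (k : nat) : (k < l)%N -> exists2 k', (k' < l)%N & (a + k * b = a' + k' * b')%N.
  move=> kl; have /andP[h1 h2] := ap_params_lt hq kl; rewrite /= in h1 h2.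
  have ik : ((a + k * b).-1 < n)%N by lia.
  have : Ordinal ik \in ap_set a' b'.
    by rewrite -e; apply/mem_ap_set; exists k => //=; lia.
  by case/mem_ap_set => k' kl' /= e'; exists k' => //; lia.
have mem' (k : nat) : (k < l)%N -> exists2 k', (k' < l)%N & (a' + k * b' = a + k' * b)%N.
  move=> kl; have /andP[h1 h2] := ap_params_lt hq' kl; rewrite /= in h1 h2.
  have ik : ((a' + k * b').-1 < n)%N by lia.
  have : Ordinal ik \in ap_set a b.
    by rewrite e; apply/mem_ap_set; exists k => //=; lia.
  by case/mem_ap_set => k' kl' /= e'; exists k' => //; lia.
have l0 : (0 < l)%N by lia.
have l1 : (1 < l)%N by lia.
have [k1 _ e1] := mem 0 l0; have [k2 _ e2] := mem' 0 l0.
have [k3 _ e3] := mem 1 l1; have [k4 _ e4] := mem' 1 l1.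
move: hq hq'; rewrite !inE/= => /and3P[a0 b0 _] /and3P[a0' b0' _].
have ea : a = a' :> nat by lia.
have eb : b = b' :> nat.
  have k30 : k3 != 0 by apply/eqP => k30; rewrite k30 in e3; lia.
  have k40 : k4 != 0 by apply/eqP => k40; rewrite k40 in e4; lia.
  nia.
by congr pair; exact: val_inj.
Qed.

Lemma big_APs (R : Type) (idx : R) (op : Monoid.com_law idx) (F : {set 'I_n} -> R) :
  \big[op/idx]_(A in APs n l) F A = \big[op/idx]_(q in ap_params) F (ap_set q.1 q.2).
Proof. by rewrite APs_imset big_imset//; exact: ap_set_inj. Qed.

Lemma card_APs_mem A : A \in APs n l -> #|A| = l.
Proof.
rewrite APs_imset => /imsetP[[a b] hq ->].
have lt (k : 'I_l) : ((a + k * b).-1 < n)%N.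
  by have /andP[/= h1 h2] := ap_params_lt hq (ltn_ord k); lia.
transitivity #|[set Ordinal (lt k) | k : 'I_l]%SET|.
  congr #|pred_of_set _|; apply/setP => i; apply/mem_ap_set/imsetP.
    by move=> [k kl /= e]; exists (Ordinal kl) => //; apply: val_inj; rewrite /= -e.
  move=> [k _ ->]; exists k => //=.
  by have /andP[/= h1 h2] := ap_params_lt hq (ltn_ord k); lia.
rewrite card_imset ?card_ord// => k k' /(congr1 val)/= e; apply: val_inj => /=.
have /andP[/= h1 _] := ap_params_lt hq (ltn_ord k).
have /andP[/= h2 _] := ap_params_lt hq (ltn_ord k').
move: hq; rewrite inE => /and3P[/= _ b0 _]; nia.
Qed.

(** The positions of [x] and [y] in a progression determine its first term and its difference, so
    each pair of positions admits at most one progression. *)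
Lemma card_APs_through2 (x y : 'I_n) : x != y ->
  (\sum_(A in APs n l) ((x \in A) && (y \in A)) <= l ^ 2)%N.
Proof.
move=> xy; rewrite big_APs.
apply: (@leq_trans (\sum_(q in ap_params) \sum_(r < l) \sum_(s < l)
  ((x.+1 == q.1 + r * q.2) && (y.+1 == q.1 + s * q.2))%N)).
  apply: leq_sum => q _.
  case: mem_ap_set => //= -[r rl er]; case: mem_ap_set => //= -[s sl es].
  rewrite (bigD1 (Ordinal rl))//= (bigD1 (Ordinal sl))//= er es !eqxx/=.
  by rewrite -addnA leq_addr.
rewrite exchange_big/=.
apply: (@leq_trans (\sum_(r < l) \sum_(s < l) 1)); last first.
  by rewrite !sum_nat_const !card_ord muln1 -mulnn.
apply: leq_sum => r _; rewrite exchange_big/=; apply: leq_sum => s _.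
rewrite -big_mkcondr sum1_card; apply/card_le1_eqP => -[a b] [a' b'].
move=> /and3P[_ /eqP/= e1 /eqP/= e2] /and3P[_ /eqP/= e3 /eqP/= e4].
have rs : r != s :> nat.
  by apply: contraNneq xy => rs; apply/eqP/val_inj/succn_inj; rewrite /= e1 e2 rs.
have eb : b' = b :> nat.
  by have [rs'|rs'|/eqP] := ltngtP r s; [nia|nia|rewrite (negbTE rs)].
have ea : a' = a :> nat by rewrite eb in e3; lia.
by congr pair; exact: val_inj.
Qed.

Lemma count_pos_leq (t : nat) : (t <= n)%N ->
  #|[set b : 'I_n.+1 | (0 < b)%N && (b <= t)%N]%SET| = t.
Proof.
move=> tn.
transitivity #|[set inord k.+1 | k : 'I_t]%SET : {set 'I_n.+1}|.
  congr #|pred_of_set _|; apply/setP => b; rewrite inE; apply/andP/imsetP.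
    move=> [b0 bt]; have kt : (b.-1 < t)%N by lia.
    exists (Ordinal kt) => //; apply: val_inj => /=; rewrite prednK// inordK//.
  move=> [k _ ->]; rewrite inordK; last by have := ltn_ord k; lia.
  by split => //; exact: ltn_ord.
rewrite card_imset ?card_ord// => k k' /(congr1 val)/=.
rewrite !inordK; [|by have := ltn_ord k'; lia|by have := ltn_ord k; lia].
by move=> [e]; exact: val_inj.
Qed.

Definition ap_degree (x : 'I_n) : nat := \sum_(A in APs n l) (x \in A).

(** With [x] at position [r], the difference [b] must satisfy [r b <= x] and
    [(m - r) b <= n - 1 - x]; the ordinal [x] stands for [x + 1], whence the shift. At [r = 0] and
    [r = m] one constraint is void. These positions are split off, since division by 0 has value 0
    and would falsify the minimum. *)
Lemma ap_degreeE (x : 'I_n) : ap_degree x =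
  (((n.-1 - x) %/ m + x %/ m)
   + \sum_(1 <= r < m) minn (x %/ r) ((n.-1 - x) %/ (m - r)))%N.
Proof.
rewrite /ap_degree big_APs.
transitivity (\sum_(q in ap_params) \sum_(r < l) (x.+1 == q.1 + r * q.2)%N)%N.
  apply: eq_bigr => q hq; case: mem_ap_set => [[r rl er]|h].
    rewrite (bigD1 (Ordinal rl))//= er eqxx big1// => s sr; apply/eqP.
    rewrite eqb0; apply: contraNneq sr => e; apply/eqP/val_inj => /=.
    move: hq; rewrite inE => /and3P[_ q20 _].
    by move/addnI/eqP: e; rewrite eqn_pmul2r// => /eqP.
  rewrite big1// => r _; apply/eqP; rewrite eqb0; apply/eqP => e.
  by apply: h; exists r.
rewrite exchange_big/=.
pose cnt r := #|[set b : 'I_n.+1 | [&& (0 < b)%N, (r * b <= x)%N & ((m - r) * b <= n.-1 - x)%N]]%SET|.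
have cntE (r : 'I_l) : (\sum_(q in ap_params) (x.+1 == q.1 + r * q.2)%N = cnt r)%N.
  rewrite -big_mkcondr sum1_card.
  have mE (b : nat) : (m - r) * b + r * b = m * b.
    by rewrite -mulnDl subnK//; have := ltn_ord r; lia.
  rewrite -(card_in_imset (f := fun q : 'I_n.+1 * 'I_n.+1 => q.2)).
    apply: eq_card => b; rewrite !inE; apply/imsetP/and3P.
      move=> [[a b']] /andP[]; rewrite inE => /and3P[/= a0 b0 abn] /eqP e ->.
      by have := ltn_ord x; have := mE b'; split => //; lia.
    move=> [b0 h1 h2].
    have an : x.+1 - r * b < n.+1 by have := ltn_ord x; lia.
    exists (Ordinal an, b) => //; apply/andP; split; last by apply/eqP => /=; lia.
    rewrite inE; apply/and3P; split => //=; first lia.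
    by have := ltn_ord x; have := mE b; lia.
  move=> [a b] [a' b'] /andP[_ /eqP/= e1] /andP[_ /eqP/= e2] eb.
  rewrite -eb in e2 *; congr pair; apply: val_inj => /=; lia.
rewrite (eq_bigr (fun r : 'I_l => cnt r)) => [|r _]; last exact: cntE.
rewrite -(big_mkord xpredT cnt).
have y_le (t d : nat) : t <= n -> t %/ d <= n by move=> tn; exact: leq_trans (leq_div _ _) tn.
have xn : x <= n by exact: ltnW.
have yn : n.-1 - x <= n by lia.
have cnt0 : cnt 0 = (n.-1 - x) %/ m.
  rewrite /cnt -[RHS]count_pos_leq; last exact: y_le.
  by apply: eq_card => b; rewrite !inE subn0 leq_divRL ?mul0n// 1?mulnC//; lia.
have cntm : cnt m = x %/ m.
  rewrite /cnt -[RHS]count_pos_leq; last exact: y_le.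
  by apply: eq_card => b; rewrite !inE subnn mul0n andbT leq_divRL 1?mulnC//; lia.
rewrite -[l in index_iota _ l](prednK (ltnW (ltnW l3))).
rewrite big_ltn//; rewrite big_nat_recr/=; last by lia.
rewrite cnt0 cntm -addnA; congr (_ + _); rewrite addnC; congr (_ + _).
apply: eq_big_nat => r /andP[r1 rm].
rewrite /cnt -[RHS]count_pos_leq; last by rewrite geq_min y_le.
apply: eq_card => b; rewrite !inE leq_min !leq_divRL//; last by lia.
by rewrite ![_ * r]mulnC ![_ * (m - r)]mulnC.
Qed.

End arithmetic_progressions.

(** * Bounds on the limiting profiles *)

Section ap_profile.
Context {R : realType}.
Implicit Types (m : nat) (x y : R).

(* The limiting density of (m+1)-APs through the point x n, for fixed m: the
   positions 0 and m contribute (1 - x) / m and x / m. *)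
Definition ap_profile m x : R :=
  m%:R^-1 + \sum_(1 <= r < m) Num.min (x / r%:R) ((1 - x) / (m - r)%:R).

Local Notation phi := ap_profile.

Lemma sum_nat_cst (a b : nat) (c : R) : \sum_(a <= r < b) c = (b - a)%:R * c.
Proof. by rewrite big_const_nat iter_addr_0 mulr_natl. Qed.

Lemma ap_profile_term_ge0 m r x : 0 <= x <= 1 ->
  0 <= Num.min (x / r%:R) ((1 - x) / (m - r)%:R).
Proof. by move=> /andP[x0 x1]; rewrite le_min !divr_ge0// subr_ge0. Qed.

Lemma ap_profile_term_le m r x : (0 < r < m)%N -> 0 <= x <= 1 ->
  Num.min (x / r%:R) ((1 - x) / (m - r)%:R) <= m%:R^-1.
Proof.
move=> /andP[r0 rm] /andP[x0 x1].
have r0' : 0 < r%:R :> R by rewrite ltr0n.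
have mr0 : 0 < (m - r)%:R :> R by rewrite ltr0n subn_gt0.
have mE : m%:R = r%:R + (m - r)%:R :> R by rewrite -natrD subnKC// ltnW.
rewrite ge_min mE ler_pdivrMr// ler_pdivrMr//.
rewrite (mulrC _ r%:R) (mulrC _ (m - r)%:R) !ler_pdivlMr ?addr_gt0//.
by apply/orP; have [h|h] := leP (x * (r%:R + (m - r)%:R)) r%:R; [left|right; nra].
Qed.

Lemma ap_profile_ge_inv m x : 0 <= x <= 1 -> m%:R^-1 <= phi m x.
Proof. by move=> x01; rewrite lerDl sumr_ge0// => r _; exact: ap_profile_term_ge0. Qed.

Lemma ap_profile_ge0 m x : 0 <= x <= 1 -> 0 <= phi m x.
Proof. by move=> /(ap_profile_ge_inv m); apply: le_trans; rewrite invr_ge0. Qed.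

Lemma ap_profile_le1 m x : (0 < m)%N -> 0 <= x <= 1 -> phi m x <= 1.
Proof.
move=> m0 x01; rewrite /phi.
have h : \sum_(1 <= r < m) Num.min (x / r%:R) ((1 - x) / (m - r)%:R) <=
    \sum_(1 <= r < m) m%:R^-1.
  by apply: ler_sum_nat => r rm; exact: ap_profile_term_le.
apply: le_trans (lerD (lexx _) h) _.
rewrite sum_nat_cst -[X in X + _]mul1r -mulrDl natrB// addrC subrK divff//.
by rewrite pnatr_eq0 -lt0n.
Qed.

(** The summand [1 / m] and the [m - 1] others are each at least [min x (1 - x) / m]. The bound is
    free of [m], which keeps the limits of Riemann sums positive when the lengths grow. *)
Lemma ap_profile_ge_min m x : (0 < m)%N -> 0 <= x <= 1 -> Num.min x (1 - x) <= phi m x.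
Proof.
move=> m0 /andP[x0 x1]; rewrite /phi; set c := Num.min x (1 - x).
have c0 : 0 <= c by rewrite le_min x0 subr_ge0.
have c1 : c <= 1 by rewrite ge_min x1.
have m0' : 0 < m%:R :> R by rewrite ltr0n.
have h : \sum_(1 <= r < m) c / m%:R <=
    \sum_(1 <= r < m) Num.min (x / r%:R) ((1 - x) / (m - r)%:R).
  apply: ler_sum_nat => r /andP[r0 rm].
  have r0' : 0 < r%:R :> R by rewrite ltr0n.
  have mr0 : 0 < (m - r)%:R :> R by rewrite ltr0n subn_gt0.
  rewrite le_min; apply/andP; split; apply: ler_pM => //; rewrite ?invr_ge0//.
  - by rewrite ge_min lexx.
  - by rewrite lef_pV2// ler_nat ltnW.
  - by rewrite ge_min lexx orbT.
  - by rewrite lef_pV2// ler_nat leq_subr.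
apply: le_trans (lerD (lexx _) h).
have h2 : c / m%:R <= m%:R^-1 by rewrite ler_piMl// invr_ge0.
apply: le_trans (lerD h2 (lexx _)).
rewrite sum_nat_cst natrB// mulrBl mul1r addrC subrK mulrC divfK//.
by rewrite lt0r_neq0.
Qed.

Lemma min_lipschitz (a b a' b' e : R) : `|a - a'| <= e -> `|b - b'| <= e ->
  `|Num.min a b - Num.min a' b'| <= e.
Proof.
rewrite !ler_norml => /andP[h1 h2] /andP[h3 h4].
have [ab|ab] := leP a b; have [ab'|ab'] := leP a' b'; apply/andP; split; lra.
Qed.

Lemma ap_profile_lipschitz m x y : `|phi m x - phi m y| <= m%:R * `|x - y|.
Proof.
rewrite /phi opprD addrACA subrr add0r -sumrB.
apply: le_trans (ler_norm_sum _ _ _) _.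
apply: (@le_trans _ _ (\sum_(1 <= r < m) `|x - y|)); last first.
  by rewrite sum_nat_cst ler_wpM2r// ler_nat leq_subr.
apply: ler_sum_nat => r /andP[r0 rm].
have r1 : 1 <= r%:R :> R by rewrite ler1n.
have mr1 : 1 <= (m - r)%:R :> R by rewrite ler1n subn_gt0.
apply: min_lipschitz; rewrite -mulrBl normrM normfV.
  by rewrite ler_piMr// invf_le1 ?normr_gt0 ?lt0r_neq0 ?ger0_norm// (lt_le_trans ltr01).
rewrite (_ : 1 - x - (1 - y) = - (x - y)); last by ring.
rewrite normrN.
by rewrite ler_piMr// invf_le1 ?normr_gt0 ?lt0r_neq0 ?ger0_norm// (lt_le_trans ltr01).
Qed.

Lemma sum_indic_le m (t : R) : 0 <= t -> \sum_(1 <= r < m) (r%:R <= t)%R%:R <= t.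
Proof.
move=> t0; suff : \sum_(1 <= r < m) (r%:R <= t)%R%:R <= t /\
  \sum_(1 <= r < m) ((r%:R : R) <= t)%R%:R <= m.-1%:R :> R by case.
elim: m => [|[|m] [IH1 IH2]]; [by rewrite big_geq|by rewrite big_geq|].
rewrite big_nat_recr//=; have [h|h] /= := leP m.+1%:R t.
  by rewrite -natr1 in h *; split; move: IH2; rewrite /=; lra.
by rewrite addr0; split => //; rewrite (le_trans IH2)//= ler_nat.
Qed.

(** At most [eta m] positions lie below [eta m], each with a summand at most [1 / m]; the others
    have summands at most [x / (eta m)]. Long progressions thus have a small profile near 0. *)
Lemma ap_profile_near0 m x (eta : R) : (0 < m)%N -> 0 <= x <= 1 -> 0 < eta ->
  phi m x <= m%:R^-1 + (eta + x / eta).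
Proof.
move=> m0 x01 e0; rewrite lerD2l.
have m0' : 0 < m%:R :> R by rewrite ltr0n.
have /andP[x0 x1] := x01.
have h : \sum_(1 <= r < m) Num.min (x / r%:R) ((1 - x) / (m - r)%:R) <=
    \sum_(1 <= r < m) ((r%:R <= eta * m%:R)%R%:R * m%:R^-1 + x / (eta * m%:R)).
  apply: ler_sum_nat => r /andP[r0 rm].
  have r0' : 0 < r%:R :> R by rewrite ltr0n.
  have [re|re] := leP r%:R (eta * m%:R).
    rewrite mul1r; apply: ler_wpDr; first by rewrite divr_ge0// mulr_ge0// ltW.
    by apply: ap_profile_term_le => //; rewrite r0.
  rewrite mul0r add0r ge_min; apply/orP; left.
  by rewrite ler_wpM2l// lef_pV2 ?posrE ?mulr_gt0// ltW.
apply: le_trans h _; rewrite big_split/=; apply: lerD.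
  rewrite -mulr_suml ler_pdivrMr//.
  by apply: sum_indic_le; rewrite mulr_ge0// ltW.
rewrite sum_nat_cst (_ : _ * _ = x / eta * ((m - 1)%:R / m%:R)); last first.
  by field; rewrite !lt0r_neq0.
rewrite ler_piMr ?divr_ge0 ?(ltW e0)// ler_pdivrMr// mul1r ler_nat.
exact: leq_subr.
Qed.

End ap_profile.

Section ap_degree_bounds.
Context {R : realType}.

Lemma natr_divn_le (a d : nat) : (a %/ d)%:R <= a%:R / d%:R :> R.
Proof.
have [->|d0] := posnP d; first by rewrite divn0 invr0 mulr0.
by rewrite ler_pdivlMr ?ltr0n// -natrM ler_nat leq_divM.
Qed.

Lemma natr_divn_ge (a d : nat) : (0 < d)%N -> a%:R / d%:R - 1 <= (a %/ d)%:R :> R.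
Proof.
move=> d0; rewrite lerBlDr ler_pdivrMr ?ltr0n// natr1 -natrM ler_nat ltnW//.
exact: ltn_ceil.
Qed.

Variables (n l : nat).
Hypothesis l3 : (2 < l)%N.
Local Notation m := l.-1.
Implicit Types x : 'I_n.

Let m0 : (0 < m)%N. Proof. by lia. Qed.

Lemma natr_minn (a b : nat) : (minn a b)%:R = Num.min a%:R b%:R :> R.
Proof.
by rewrite /minn; case: ltnP => h; [rewrite min_l// ler_nat ltnW|rewrite min_r// ler_nat].
Qed.

Lemma scaled_profileE x : n%:R * ap_profile m (x%:R / n%:R) =
  n%:R / m%:R + \sum_(1 <= r < m) Num.min (x%:R / r%:R) ((n%:R - x%:R) / (m - r)%:R) :> R.
Proof.
have n0 : 0 < n%:R :> R by rewrite ltr0n (leq_ltn_trans _ (ltn_ord x)).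
rewrite /ap_profile mulrDr; congr (_ + _); rewrite mulr_sumr; apply: eq_bigr => r _.
rewrite minr_pMr ?ltW//; congr Num.min; rewrite mulrA; congr (_ / _).
  by rewrite mulrC divfK// lt0r_neq0.
by rewrite mulrBr mulr1 [X in _ - X]mulrC divfK// lt0r_neq0.
Qed.

Lemma ap_degree_le x : (ap_degree l x)%:R <= n%:R * ap_profile m (x%:R / n%:R) :> R.
Proof.
rewrite scaled_profileE ap_degreeE// natrD; apply: lerD.
  rewrite natrD; apply: le_trans (lerD (natr_divn_le _ _) (natr_divn_le _ _)) _.
  rewrite -mulrDl ler_wpM2r ?invr_ge0// -natrD ler_nat; have := ltn_ord x; lia.
rewrite natr_sum; apply: ler_sum_nat => r /andP[r0 rm].
rewrite natr_minn le_min; apply/andP; split.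
  by rewrite ge_min natr_divn_le.
rewrite ge_min; apply/orP; right; apply: le_trans (natr_divn_le _ _) _.
rewrite ler_wpM2r ?invr_ge0// lerBrDr -natrD ler_nat; have := ltn_ord x; lia.
Qed.

(** Taking a floor loses at most 1, and so does replacing [n - x] by [n - 1 - x]; there are [l]
    positions. *)
Lemma ap_degree_ge x :
  n%:R * ap_profile m (x%:R / n%:R) - 2 * l%:R <= (ap_degree l x)%:R :> R.
Proof.
have xn := ltn_ord x.
have nE : n%:R = (n.-1 - x)%:R + x%:R + 1 :> R by rewrite -natrD natr1; congr (_%:R); lia.
rewrite scaled_profileE ap_degreeE// natrD.
have h1 : n%:R / m%:R - 3 <= ((n.-1 - x) %/ m + x %/ m)%:R :> R.
  rewrite natrD nE !mulrDl mul1r.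
  have := natr_divn_ge (n.-1 - x) m0; have := natr_divn_ge x m0.
  have : m%:R^-1 <= 1 :> R by rewrite invf_le1 ?ltr0n// ler1n.
  lra.
have h2 : \sum_(1 <= r < m) Num.min (x%:R / r%:R) ((n%:R - x%:R) / (m - r)%:R) -
    2 * (m - 1)%:R <= (\sum_(1 <= r < m) minn (x %/ r) ((n.-1 - x) %/ (m - r)))%:R :> R.
  rewrite [2 * _]mulrC -sum_nat_cst -sumrB natr_sum.
  apply: ler_sum_nat => r /andP[r0 rm].
  rewrite natr_minn le_min; apply/andP; split.
    have := natr_divn_ge x r0 => h.
    have : Num.min (x%:R / r%:R) ((n%:R - x%:R) / (m - r)%:R) <= x%:R / r%:R :> R.
      by rewrite ge_min lexx.
    lra.
  have mr0 : (0 < m - r)%N by rewrite subn_gt0.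
  have := natr_divn_ge (n.-1 - x) mr0 => h.
  have : Num.min (x%:R / r%:R) ((n%:R - x%:R) / (m - r)%:R) <= (n%:R - x%:R) / (m - r)%:R :> R.
    by rewrite ge_min lexx orbT.
  have -> : n%:R - x%:R = (n.-1 - x)%:R + 1 :> R by rewrite nE; ring.
  have : (m - r)%:R^-1 <= 1 :> R by rewrite invf_le1 ?ltr0n// ler1n.
  rewrite mulrDl mul1r; lra.
have lE : l%:R = (m - 1)%:R + 2 :> R by rewrite -natrD; congr (_%:R); lia.
rewrite lE; lra.
Qed.

Lemma ap_degree_le_n x : (ap_degree l x)%:R <= n%:R :> R.
Proof.
have n0 : 0 < n%:R :> R by rewrite ltr0n (leq_ltn_trans _ (ltn_ord x)).
apply: le_trans (ap_degree_le x) _; rewrite ler_piMr ?(ltW n0)//.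
apply: ap_profile_le1 => //; rewrite divr_ge0//= ler_pdivrMr// mul1r ler_nat.
exact: ltnW.
Qed.

End ap_degree_bounds.

(** * Connected triples of sets *)

Section triple_sums.
Context {R : realType} (I : finType) (p : R).
Hypothesis p01 : 0 <= p <= 1.
Implicit Types (a c e B : {set I}) (P Q S : {set {set I}}).

Let p0 : 0 <= p. Proof. by case/andP: p01. Qed.
Let p1 : p <= 1. Proof. by case/andP: p01. Qed.

Lemma meetsP B c : reflect (exists2 x, x \in B & x \in c) (meets B c).
Proof.
rewrite /meets; apply: (iffP pred0Pn) => -[x]; first by case/andP; exists x.
by move=> xB xc; exists x; apply/andP.
Qed.

Lemma meetsC a c : meets a c = meets c a.
Proof. by rewrite /meets disjoint_sym. Qed.

Lemma meetsU a c e : meets (a :|: c) e = meets a e || meets c e.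
Proof.
apply/meetsP/orP => [[x]|[] /meetsP[x xa xe]].
- by rewrite inE => /orP[xa|xc] xe; [left|right]; apply/meetsP; exists x.
- by exists x; rewrite // inE xa.
- by exists x; rewrite // inE xa orbT.
Qed.

(** Connectedness in a form symmetric in the three sets, so that the families in [triple_sum] can be
    permuted freely. *)
Definition two_edges a c e : bool :=
  [|| meets a c && meets a e, meets a c && meets c e | meets a e && meets c e].

Definition triple_sum P Q S : R :=
  \sum_(a in P) \sum_(c in Q) \sum_(e in S) (two_edges a c e)%:R * p ^+ #|a :|: c :|: e|.

(** A triple explored from [a]: each power of [p] counts only the points added by the new set, so
    the inner sums can be bounded uniformly before the outer ones. *)
Definition chain_sum P Q S : R :=
  \sum_(a in P) p ^+ #|a| * \sum_(c in Q | meets a c) p ^+ #|c :\: a| *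
    \sum_(e in S | meets (a :|: c) e) p ^+ #|e :\: (a :|: c)|.

Lemma triple_sumC P Q S : triple_sum P Q S = triple_sum Q P S.
Proof.
rewrite /triple_sum exchange_big/=; apply: eq_bigr => c _; apply: eq_bigr => a _.
apply: eq_bigr => e _; rewrite [a :|: c]finset.setUC; congr (_%:R * _).
by rewrite /two_edges (meetsC a c); case: (meets c a); case: (meets a e); case: (meets c e).
Qed.

Lemma triple_sumAC P Q S : triple_sum P Q S = triple_sum P S Q.
Proof.
rewrite /triple_sum; apply: eq_bigr => a _; rewrite exchange_big/=.
apply: eq_bigr => e _; apply: eq_bigr => c _; rewrite finset.setUAC; congr (_%:R * _).
by rewrite /two_edges (meetsC e c); case: (meets a c); case: (meets a e); case: (meets c e).
Qed.

Lemma cardsUD a c e : #|a :|: c :|: e| = (#|a| + (#|c :\: a| + #|e :\: (a :|: c)|))%N.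
Proof.
have cU (A B : {set I}) : #|A :|: B| = (#|A| + #|B :\: A|)%N.
  by rewrite cardsU cardsD finset.setIC addnBA// subset_leq_card// finset.subsetIl.
by rewrite cU cU addnA.
Qed.

(** Two edges connect the triple, so from [a] either [c] is reached first and [e] meets the union,
    or the same happens with [c] and [e] exchanged. *)
Lemma triple_sum_le_chain P Q S :
  triple_sum P Q S <= chain_sum P Q S + chain_sum P S Q.
Proof.
have chainE Q' S' : chain_sum P Q' S' = \sum_(a in P) \sum_(c in Q') \sum_(e in S')
    (meets a c && meets (a :|: c) e)%:R * p ^+ #|a :|: c :|: e|.
  apply: eq_bigr => a _; rewrite mulr_sumr big_mkcondr; apply: eq_bigr => c _.
  case: ifP => ac /=; last by rewrite big1// => e _; rewrite mul0r.
  rewrite !mulr_sumr big_mkcondr; apply: eq_bigr => e _.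
  by case: ifP => ace; rewrite ?mul0r// mul1r cardsUD !exprD.
have -> : chain_sum P S Q = \sum_(a in P) \sum_(c in Q) \sum_(e in S)
    (meets a e && meets (a :|: e) c)%:R * p ^+ #|a :|: c :|: e|.
  rewrite chainE; apply: eq_bigr => a _; rewrite exchange_big/=.
  by apply: eq_bigr => e _; apply: eq_bigr => c _; rewrite finset.setUAC.
rewrite chainE -big_split; apply: ler_sum => a _; rewrite -big_split.
apply: ler_sum => c _; rewrite -big_split; apply: ler_sum => e _ /=.
rewrite -mulrDl ler_wpM2r ?exprn_ge0// -natrD ler_nat !meetsU /two_edges (meetsC e c).
by case: (meets a c); case: (meets a e); case: (meets c e).
Qed.

Lemma connected_triples_le (b : {set I} -> R) (w1 w2 : R) (P1 P2 : {set {set I}}) :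
  0 <= w1 -> 0 <= w2 ->
  (forall a, `|b a| <= w1 * (a \in P1)%:R + w2 * (a \in P2)%:R) ->
  connected_triples p b <= w1 ^+ 3 * triple_sum P1 P1 P1
    + 3 * (w1 ^+ 2 * w2 * triple_sum P1 P1 P2)
    + 3 * (w1 * w2 ^+ 2 * triple_sum P1 P2 P2) + w2 ^+ 3 * triple_sum P2 P2 P2.
Proof.
move=> w10 w20 hb.
pose v a := w1 * (a \in P1)%:R + w2 * (a \in P2)%:R.
have v0 a : 0 <= v a by rewrite addr_ge0// mulr_ge0.
have h1 : connected_triples p b <= \sum_a \sum_c \sum_e
    v a * v c * v e * ((two_edges a c e)%:R * p ^+ #|a :|: c :|: e|).
  rewrite /connected_triples; apply: ler_sum => a _.
  rewrite big_mkcond; apply: ler_sum => c _.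
  have nn c' : 0 <= \sum_e v a * v c' * v e * ((two_edges a c' e)%:R * p ^+ #|a :|: c' :|: e|).
    by apply: sumr_ge0 => e _; rewrite !mulr_ge0// exprn_ge0.
  case: ifP => ac; last exact: nn.
  rewrite big_mkcond; apply: ler_sum => e _.
  case: ifP => ace; last by rewrite !mulr_ge0// exprn_ge0.
  have -> : two_edges a c e by move: ace; rewrite /two_edges meetsU ac /= => /orP[] ->; rewrite ?orbT.
  rewrite mul1r ler_wpM2r ?exprn_ge0// !normrM ler_pM// ?mulr_ge0//.
    by rewrite ler_pM// hb.
apply: le_trans h1 _.
have ind (P : {set {set I}}) (F : {set I} -> R) : \sum_(a in P) F a = \sum_a (a \in P)%:R * F a.
  by rewrite big_mkcond; apply: eq_bigr => a _; case: ifP; rewrite ?mul1r ?mul0r.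
have tE P Q S : triple_sum P Q S = \sum_a \sum_c \sum_e
    (a \in P)%:R * (c \in Q)%:R * (e \in S)%:R * ((two_edges a c e)%:R * p ^+ #|a :|: c :|: e|).
  rewrite /triple_sum ind; apply: eq_bigr => a _; rewrite ind mulr_sumr.
  apply: eq_bigr => c _; rewrite ind !mulr_sumr; apply: eq_bigr => e _.
  by rewrite !mulrA.
have -> : \sum_a \sum_c \sum_e v a * v c * v e * ((two_edges a c e)%:R * p ^+ #|a :|: c :|: e|)
  = w1 ^+ 3 * triple_sum P1 P1 P1
    + (w1 ^+ 2 * w2 * triple_sum P1 P1 P2 + w1 ^+ 2 * w2 * triple_sum P1 P2 P1
       + w1 ^+ 2 * w2 * triple_sum P2 P1 P1)
    + (w1 * w2 ^+ 2 * triple_sum P1 P2 P2 + w1 * w2 ^+ 2 * triple_sum P2 P1 P2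
       + w1 * w2 ^+ 2 * triple_sum P2 P2 P1)
    + w2 ^+ 3 * triple_sum P2 P2 P2.
  rewrite !tE !mulr_sumr -!big_split; apply: eq_bigr => a _ /=.
  rewrite !mulr_sumr -!big_split; apply: eq_bigr => c _ /=.
  rewrite !mulr_sumr -!big_split; apply: eq_bigr => e _ /=.
  rewrite /v; ring.
rewrite (triple_sumC P2 P1 P1) (triple_sumAC P1 P2 P1) (triple_sumAC P2 P2 P1).
rewrite (triple_sumC P2 P1 P2); lra.
Qed.

End triple_sums.

Section ap_overlaps.
Context {R : realType} (n : nat) (p : R).
Hypothesis p01 : 0 <= p <= 1.
Implicit Types (l : nat) (B c : {set 'I_n}).

Let p0 : 0 <= p. Proof. by case/andP: p01. Qed.
Let p1 : p <= 1. Proof. by case/andP: p01. Qed.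

Lemma natr_mem_sum (T : finType) (B c : {set T}) :
  (#|c :&: B|%:R : R) = \sum_(x in B) (x \in c)%:R.
Proof.
rewrite -sum1_card natr_sum big_mkcond [RHS]big_mkcond/=; apply: eq_bigr => x _.
by rewrite inE; case: (x \in c); case: (x \in B).
Qed.

Lemma ap_degree_natr l (x : 'I_n) : (ap_degree l x)%:R = \sum_(c in APs n l) (x \in c)%:R :> R.
Proof. by rewrite /ap_degree natr_sum. Qed.

Lemma sum_ap_degree l : (2 < l)%N ->
  \sum_(x : 'I_n) (ap_degree l x)%:R = #|APs n l|%:R * l%:R :> R.
Proof.
move=> l3; under eq_bigr do rewrite ap_degree_natr.
rewrite exchange_big/= mulr_natl -sumr_const; apply: eq_bigr => c cA.
rewrite -[in RHS](card_APs_mem l3 cA) -sum1_card natr_sum [RHS]big_mkcond/=.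
by apply: eq_bigr => x _; case: (x \in c).
Qed.

(** A union bound over pairs of distinct points of [B], each pair lying in at most [l ^ 2]
    progressions. [Q] and [q] allow a factor [p] to be gained when [c = a] is excluded. *)
Lemma sum_two_meeting_APs l (Q : pred {set 'I_n}) (q : R) B : (2 < l)%N -> 0 <= q ->
  (forall c, c \in APs n l -> Q c -> (1 < #|c :&: B|)%N -> p ^+ #|c :\: B| <= q) ->
  \sum_(c in APs n l | (1 < #|c :&: B|)%N && Q c) p ^+ #|c :\: B|
  <= #|B|%:R ^+ 2 * l%:R ^+ 2 * q.
Proof.
move=> l3 q0 hq.
apply: (@le_trans _ _ (\sum_(c in APs n l)
    \sum_(x in B) \sum_(y in B) ((x != y) && (x \in c) && (y \in c))%:R * q)).
  rewrite big_mkcondr; apply: ler_sum => c cA.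
  case: ifP => [/andP[two Qc]|_]; last by do 2 (apply: sumr_ge0 => ? _); rewrite mulr_ge0.
  apply: le_trans (hq c cA Qc two) _.
  have /card_gt1P[u [v [+ + uv]]] := two; rewrite !inE => /andP[uc uB] /andP[vc vB].
  rewrite (bigD1 u)//= (bigD1 v)//= uv uc vc/= mul1r -addrA lerDl.
  by rewrite addr_ge0//; do ?(apply: sumr_ge0 => ? _); rewrite mulr_ge0.
rewrite exchange_big/= -mulrA expr2 -mulrA mulr_natl -sumr_const; apply: ler_sum => x _.
rewrite exchange_big/= mulr_natl -sumr_const; apply: ler_sum => y _.
rewrite -mulr_suml ler_wpM2r// -natrX -natr_sum ler_nat.
have [xy|xy] := eqVneq x y; first by rewrite big1.
exact: card_APs_through2.
Qed.

(* Progressions meeting B in one point are counted through that point; those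
   meeting B in two points or more are few, and each contributes at most q. *)
Lemma sum_meeting_APs l (Q : pred {set 'I_n}) (q : R) B : (2 < l)%N -> 0 <= q ->
  (forall c, c \in APs n l -> Q c -> (1 < #|c :&: B|)%N -> p ^+ #|c :\: B| <= q) ->
  \sum_(c in APs n l | meets B c && Q c) p ^+ #|c :\: B|
  <= #|B|%:R * n%:R * p ^+ l.-1 + #|B|%:R ^+ 2 * l%:R ^+ 2 * q.
Proof.
move=> l3 q0 hq; rewrite (bigID (fun c => 1 < #|c :&: B|)%N)/= addrC.
apply: lerD; last first.
  apply: le_trans (sum_two_meeting_APs l3 q0 hq).
  rewrite big_mkcond [leRHS]big_mkcond; apply: ler_sum => c _.
  case: (c \in APs n l) => //=; case: (meets B c); case: (Q c); case: (_ < _)%N;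
    by rewrite //= exprn_ge0.
apply: (@le_trans _ _ (\sum_(c in APs n l) \sum_(x in B) (x \in c)%:R * p ^+ l.-1)).
  rewrite [leLHS]big_mkcond [leRHS]big_mkcond; apply: ler_sum => c _.
  case: ifPn => [/andP[/andP[cA /andP[/meetsP[x xB xc] Qc]] one]|_]; last first.
    by case: ifP => // _; apply: sumr_ge0 => x _; rewrite mulr_ge0// exprn_ge0.
  have c1 : #|c :&: B| = 1%N.
    apply/eqP; rewrite eqn_leq leqNgt one card_gt0; apply/set0Pn; exists x.
    by rewrite inE xc xB.
  rewrite cA -mulr_suml -natr_mem_sum c1 mul1r.
  by rewrite cardsD c1 (card_APs_mem l3 cA) subn1.
rewrite exchange_big/= -mulrA mulr_natl -sumr_const; apply: ler_sum => x _.
rewrite -mulr_suml -ap_degree_natr ler_wpM2r ?exprn_ge0//.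
exact: ap_degree_le_n.
Qed.

Definition ap_mean l : R := #|APs n l|%:R * p ^+ l.

(** [L] bounds all lengths and [B] may be a union of two progressions: [#|B| <= 2 L] turns
    [#|B| ^ 2 * l ^ 2] into [4 L ^ 4]. *)
Definition overlap_bound l L : R := 2 * L%:R * (n%:R * p ^+ l.-1) + 4 * L%:R ^+ 4.

Lemma overlap_bound_ge0 l L : 0 <= overlap_bound l L.
Proof. by rewrite addr_ge0// !mulr_ge0// ?exprn_ge0// mulr_ge0. Qed.

Lemma sum_meeting_APs_le l L B : (2 < l)%N -> (l <= L)%N -> (#|B| <= 2 * L)%N ->
  \sum_(c in APs n l | meets B c) p ^+ #|c :\: B| <= overlap_bound l L.
Proof.
move=> l3 lL BL.
have -> : \sum_(c in APs n l | meets B c) p ^+ #|c :\: B| =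
  \sum_(c in APs n l | meets B c && predT c) p ^+ #|c :\: B|.
  by apply: eq_bigl => c; rewrite andbT.
have := @sum_meeting_APs l predT 1 B l3 ler01.
move=> H; apply: le_trans (H _) _.
  by move=> c _ _ _; rewrite exprn_ile1.
have BR : #|B|%:R <= 2 * L%:R :> R by rewrite -natrM ler_nat.
have lR : l%:R <= L%:R :> R by rewrite ler_nat.
rewrite mulr1 -mulrA /overlap_bound; apply: lerD.
  by rewrite ler_wpM2r ?mulr_ge0 ?exprn_ge0.
apply: (@le_trans _ _ ((2 * L%:R) ^+ 2 * L%:R ^+ 2)).
  by rewrite ler_pM ?sqr_ge0// lerXn2r ?nnegrE ?mulr_ge0.
by rewrite le_eqVlt; apply/orP; left; apply/eqP; ring.
Qed.

(** A progression of the same length as [a] but distinct from it has a point outside [a]; this gives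
    the factor [p] in the term for overlaps in two points or more. *)
Definition strict_overlap_bound l : R :=
  l%:R * (n%:R * p ^+ l.-1) + l%:R ^+ 4 * p.

Lemma sum_meeting_APs_ne l a : (2 < l)%N -> a \in APs n l ->
  \sum_(c in APs n l | meets a c && (c != a)) p ^+ #|c :\: a| <= strict_overlap_bound l.
Proof.
move=> l3 aA; have := @sum_meeting_APs l (fun c => c != a) p a l3 p0.
rewrite (card_APs_mem l3 aA) => H; apply: le_trans (H _) _.
  move=> c cA ca _; rewrite -[leRHS]expr1 ler_wiXn2l// card_gt0 finset.setD_eq0.
  apply: contraNN ca => ca; rewrite eqEcard ca.
  by rewrite (card_APs_mem l3 cA) (card_APs_mem l3 aA) leqnn.
by rewrite -mulrA -exprD.
Qed.

Lemma chain_sum_APs_le l1 l2 l3 L : (2 < l1 <= L)%N -> (2 < l2 <= L)%N -> (2 < l3 <= L)%N ->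
  chain_sum p (APs n l1) (APs n l2) (APs n l3)
  <= ap_mean l1 * (overlap_bound l2 L * overlap_bound l3 L).
Proof.
move=> /andP[l13 l1L] /andP[l23 l2L] /andP[l33 l3L].
rewrite /ap_mean -mulrA mulr_natl -sumr_const; apply: ler_sum => a aA.
rewrite (card_APs_mem l13 aA) ler_wpM2l ?exprn_ge0//.
apply: (@le_trans _ _ (\sum_(c in APs n l2 | meets a c) p ^+ #|c :\: a| * overlap_bound l3 L)).
  apply: ler_sum => c /andP[cA _]; rewrite ler_wpM2l ?exprn_ge0//.
  apply: sum_meeting_APs_le => //; rewrite (leq_trans (leq_card_setU _ _))//.
  by rewrite (card_APs_mem l13 aA) (card_APs_mem l23 cA); lia.
rewrite -mulr_suml ler_wpM2r ?overlap_bound_ge0//.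
by apply: sum_meeting_APs_le => //; rewrite (card_APs_mem l13 aA); lia.
Qed.

(** The summand 1 is the case [c = e = a], the next one [c = a] with [e] different, and the product
    the case of [c] different from [a]. The crude bound occurs only multiplied by a strict one. *)
Lemma chain_sum_APs_diag_le l : (2 < l)%N ->
  chain_sum p (APs n l) (APs n l) (APs n l)
  <= ap_mean l * (1 + strict_overlap_bound l
                  + strict_overlap_bound l * overlap_bound l l).
Proof.
move=> l3; rewrite /ap_mean -mulrA mulr_natl -sumr_const; apply: ler_sum => a aA.
rewrite (card_APs_mem l3 aA) ler_wpM2l ?exprn_ge0//.
have aa : meets a a.
  have : (0 < #|a|)%N by rewrite (card_APs_mem l3 aA); lia.
  by rewrite card_gt0 => /set0Pn[x xa]; apply/meetsP; exists x.
have D0 : #|a :\: a| = 0%N by rewrite finset.setDv cards0.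
rewrite (bigD1 a) ?aA ?aa//= D0 expr0 mul1r; apply: lerD.
  rewrite finset.setUid (bigD1 a) ?aA ?aa//= D0 expr0 lerD2l.
  under eq_bigl do rewrite -andbA.
  exact: sum_meeting_APs_ne.
apply: (@le_trans _ _ (\sum_(c in APs n l | meets a c && (c != a))
    p ^+ #|c :\: a| * overlap_bound l l)).
  under eq_bigl do rewrite -andbA.
  apply: ler_sum => c /andP[cA _]; rewrite ler_wpM2l ?exprn_ge0//.
  apply: sum_meeting_APs_le => //; rewrite (leq_trans (leq_card_setU _ _))//.
  by rewrite (card_APs_mem l3 aA) (card_APs_mem l3 cA); lia.
rewrite -mulr_suml ler_wpM2r ?overlap_bound_ge0//.
exact: sum_meeting_APs_ne.
Qed.

End ap_overlaps.

(** * Riemann sums of profiles *)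

Section riemann_sums.
Context {R : realType}.
Implicit Types (F : R -> R) (n m k : nat).

Lemma ratio01 (a b : nat) : (a <= b)%N -> 0 <= (a%:R / b%:R : R) <= 1.
Proof.
move=> ab; rewrite divr_ge0//=; have [->|b0] := posnP b; first by rewrite invr0 mulr0.
by rewrite ler_pdivrMr ?ltr0n// mul1r ler_nat.
Qed.

Definition riemann_sum n F : R := n%:R^-1 * \sum_(0 <= r < n) F (r%:R / n%:R).

(** The finer grid is cut into [n] blocks of [k] points, each block being compared with its left
    end; [w r] bounds the oscillation on block [r]. *)
Lemma riemann_sum_refine n k F (w : nat -> R) : (0 < n)%N -> (0 < k)%N ->
  (forall r s, (r < n)%N -> (s < k)%N ->
     `|F (r%:R / n%:R) - F ((r * k + s)%:R / (n * k)%:R)| <= w r) ->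
  `|riemann_sum n F - riemann_sum (n * k) F| <= n%:R^-1 * \sum_(0 <= r < n) w r.
Proof.
move=> n0 k0 hw.
have n0' : n%:R != 0 :> R by rewrite pnatr_eq0 -lt0n.
have k0' : k%:R != 0 :> R by rewrite pnatr_eq0 -lt0n.
have -> : riemann_sum (n * k) F = n%:R^-1 * \sum_(0 <= r < n)
    (k%:R^-1 * \sum_(0 <= s < k) F ((r * k + s)%:R / (n * k)%:R)).
  rewrite /riemann_sum {1}natrM invfM -mulrA -mulr_sumr; congr (_ * (_ * _)).
  rewrite big_nat_mul/=; apply: eq_bigr => r _.
  rewrite -{1}[(r * k)%N]add0n big_addn mulSn addnK; apply: eq_bigr => s _.
  by rewrite addnC.
rewrite /riemann_sum -mulrBr normrM ger0_norm ?invr_ge0// ler_wpM2l ?invr_ge0//.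
rewrite -sumrB; apply: le_trans (ler_norm_sum _ _ _) _.
apply: ler_sum_nat => r /andP[_ rn].
have -> : F (r%:R / n%:R) = k%:R^-1 * \sum_(0 <= s < k) F (r%:R / n%:R).
  by rewrite sum_nat_cst subn0 mulKf.
rewrite -mulrBr -sumrB normrM ger0_norm ?invr_ge0//.
rewrite ler_pdivrMl ?ltr0n//; apply: le_trans (ler_norm_sum _ _ _) _.
rewrite -[k in leRHS]subn0 -sum_nat_cst; apply: ler_sum_nat => s /andP[_ sk].
exact: hw.
Qed.

Lemma riemann_sum_cauchy n m F (w : nat -> R) : (0 < n)%N -> (0 < m)%N ->
  (forall n' k, (0 < n')%N -> (0 < k)%N ->
     `|riemann_sum n' F - riemann_sum (n' * k) F| <= w n') ->
  `|riemann_sum n F - riemann_sum m F| <= w n + w m.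
Proof.
move=> n0 m0 ref; have h1 := ref n m n0 m0; have h2 := ref m n m0 n0; rewrite mulnC in h2.
rewrite (_ : riemann_sum n F - riemann_sum m F = (riemann_sum n F - riemann_sum (n * m) F)
  - (riemann_sum m F - riemann_sum (n * m) F)); last by ring.
by apply: le_trans (ler_normB _ _) _; rewrite lerD.
Qed.

Lemma riemann_sum_lipschitz n m F (K : R) : (0 < n)%N -> (0 < m)%N ->
  {in `[0, 1] &, forall x y, `|F x - F y| <= K * `|x - y|} ->
  `|riemann_sum n F - riemann_sum m F| <= K * (n%:R^-1 + m%:R^-1).
Proof.
move=> n0 m0 FK.
have K0 : 0 <= K.
  have := FK 0 1; rewrite !in_itv/= !lexx ler01 => /(_ isT isT).
  by rewrite sub0r normrN normr1 mulr1; apply: le_trans.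
have ref n' k : (0 < n')%N -> (0 < k)%N ->
    `|riemann_sum n' F - riemann_sum (n' * k) F| <= K / n'%:R.
  move=> n'0 k0; apply: le_trans (riemann_sum_refine (w := fun=> K / n'%:R) n'0 k0 _) _.
    have n'0' : 0 < n'%:R :> R by rewrite ltr0n.
    have k0' : 0 < k%:R :> R by rewrite ltr0n.
    move=> r s rn sk.
    have e : (r * k + s)%:R / (n' * k)%:R = r%:R / n'%:R + s%:R / k%:R / n'%:R :> R.
      by rewrite natrD !natrM; field; rewrite !lt0r_neq0.
    have sk1 := ratio01 (ltnW sk).
    apply: le_trans (FK _ _ _ _) _.
    - by rewrite in_itv/= ratio01// ltnW.
    - rewrite in_itv/= ratio01//.
      by rewrite (leq_trans (n := (r.+1 * k)%N)) ?leq_mul// mulSn; lia.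
    rewrite e opprD addrA subrr sub0r normrN ger0_norm; last first.
      by rewrite divr_ge0//; case/andP: sk1.
    rewrite ler_wpM2l// ler_piMl ?invr_ge0//; by case/andP: sk1.
  rewrite sum_nat_cst subn0 mulKf// pnatr_eq0; by case: (n') n'0.
rewrite mulrDr; exact: (riemann_sum_cauchy (w := fun n' => K / n'%:R)).
Qed.

(** The oscillations over the blocks telescope to [F 1 - F 0], so the rate depends on no modulus of
    continuity. This is what makes [ap_profile_close] uniform in [x]. *)
Lemma riemann_sum_monotone n m F : (0 < n)%N -> (0 < m)%N ->
  {in `[0, 1] &, {homo F : x y / x <= y}} -> (forall x, 0 <= F x <= 1) ->
  `|riemann_sum n F - riemann_sum m F| <= n%:R^-1 + m%:R^-1.
Proof.
move=> n0 m0 Fm F01.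
have ref n' k : (0 < n')%N -> (0 < k)%N ->
    `|riemann_sum n' F - riemann_sum (n' * k) F| <= n'%:R^-1.
  move=> n'0 k0; have n'0' : 0 < n'%:R :> R by rewrite ltr0n.
  apply: le_trans (riemann_sum_refine
    (w := fun r => F (r.+1%:R / n'%:R) - F (r%:R / n'%:R)) n'0 k0 _) _.
    move=> r s rn sk.
    have k0' : 0 < k%:R :> R by rewrite ltr0n.
    have e : (r * k + s)%:R / (n' * k)%:R = r%:R / n'%:R + s%:R / k%:R / n'%:R :> R.
      by rewrite natrD !natrM; field; rewrite !lt0r_neq0.
    have sk1 := ratio01 (ltnW sk).
    have r1 : r.+1%:R / n'%:R = r%:R / n'%:R + n'%:R^-1 :> R by rewrite -natr1 mulrDl mul1r.
    have rI : r%:R / n'%:R \in `[(0 : R), 1].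
      by rewrite in_itv/= ratio01// ltnW.
    have r1I : r.+1%:R / n'%:R \in `[(0 : R), 1].
      by rewrite in_itv/= ratio01.
    have h1 : r%:R / n'%:R <= (r * k + s)%:R / (n' * k)%:R :> R.
      by rewrite e lerDl divr_ge0//; case/andP: sk1.
    have h2 : (r * k + s)%:R / (n' * k)%:R <= r.+1%:R / n'%:R :> R.
      by rewrite e r1 lerD2l ler_piMl ?invr_ge0//; case/andP: sk1.
    have sI : (r * k + s)%:R / (n' * k)%:R \in `[(0 : R), 1].
      move: rI r1I; rewrite !in_itv/= => /andP[rI _] /andP[_ r1I].
      by rewrite (le_trans rI h1) (le_trans h2 r1I).
    have f1 := Fm _ _ rI sI h1; have f2 := Fm _ _ sI r1I h2.
    by rewrite distrC ger0_norm ?subr_ge0// lerD2r.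
  rewrite telescope_sumr// ler_piMr ?invr_ge0//.
  by have := F01 (n'%:R / n'%:R); have := F01 (0 / n'%:R); lra.
exact: (riemann_sum_cauchy (w := fun n' => n'%:R^-1)).
Qed.

Lemma riemann_sumD n F G : riemann_sum n (fun x => F x + G x) = riemann_sum n F + riemann_sum n G.
Proof. by rewrite /riemann_sum big_split mulrDr. Qed.

Lemma riemann_sumZ n c F : riemann_sum n (fun x => c * F x) = c * riemann_sum n F.
Proof. by rewrite /riemann_sum -mulr_sumr mulrCA. Qed.

Lemma riemann_sum_le n F G : (forall x, 0 <= x <= 1 -> F x <= G x) ->
  riemann_sum n F <= riemann_sum n G.
Proof.
move=> FG; rewrite ler_wpM2l ?invr_ge0//; apply: ler_sum_nat => r /andP[_ rn].
by apply/FG/ratio01/ltnW.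
Qed.

Lemma riemann_sum_cst n c : (0 < n)%N -> riemann_sum n (fun=> c) = c.
Proof.
by move=> n0; rewrite /riemann_sum sum_nat_cst subn0 mulKf// pnatr_eq0 -lt0n.
Qed.

Lemma riemann_sum_close n F G e : (0 < n)%N ->
  (forall x, 0 <= x <= 1 -> `|F x - G x| <= e) ->
  `|riemann_sum n F - riemann_sum n G| <= e.
Proof.
move=> n0 FG; rewrite ler_norml; apply/andP; split.
  have : riemann_sum n G <= riemann_sum n (fun x => F x + e).
    by apply: riemann_sum_le => x /FG; rewrite ler_norml; lra.
  by rewrite riemann_sumD riemann_sum_cst//; lra.
have : riemann_sum n F <= riemann_sum n (fun x => G x + e).
  by apply: riemann_sum_le => x /FG; rewrite ler_norml; lra.
by rewrite riemann_sumD riemann_sum_cst//; lra.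
Qed.

(** At least [(b - a) n - 1] grid points lie in [[a, b]], counted as those up to [b n] minus those
    strictly below [a n]. *)
Lemma riemann_sum_count n (a b e : R) F : (0 < n)%N -> 0 <= a -> b < 1 -> 0 <= e ->
  (forall x : R, 0 <= x <= 1 -> 0 <= F x) -> (forall x, a <= x <= b -> e <= F x) ->
  e * (b - a - n%:R^-1) <= riemann_sum n F.
Proof.
move=> n0 a0 b1 e0 F0 Fe.
have n0' : 0 < n%:R :> R by rewrite ltr0n.
have cnt (t : R) : 0 <= t -> t < n%:R ->
    t <= \sum_(0 <= r < n) (r%:R <= t)%R%:R /\ \sum_(0 <= r < n) (r%:R < t)%R%:R <= t + 1.
  move=> t0 tn; split.
    have tT : (Num.truncn t < n)%N by rewrite -(ltr_nat R) (le_lt_trans _ tn)// truncn_le.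
    rewrite (@big_cat_nat _ _ _ (Num.truncn t).+1)//=.
    apply: (@le_trans _ _ (\sum_(0 <= r < (Num.truncn t).+1) 1)).
      by rewrite sum_nat_cst subn0 mulr1 ltW// truncnS_gt.
    rewrite -[leLHS]addr0; apply: lerD; last by apply: sumr_ge0.
    apply: ler_sum_nat => r /andP[_ rt].
    by rewrite (le_trans (y := (Num.truncn t)%:R)) ?ler_nat// truncn_le.
  rewrite big_ltn//; apply: (@le_trans _ _ (1 + \sum_(1 <= r < n) (r%:R <= t)%R%:R)).
    apply: lerD; first by case: (0 < t).
    by apply: ler_sum_nat => r _; rewrite ler_nat; case: ltP => // /ltW ->.
  by rewrite addrC lerD2r; exact: sum_indic_le.
have [ab|ba] := leP a b; last first.
  apply: (@le_trans _ _ 0); last first.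
    rewrite mulr_ge0 ?invr_ge0// big_nat_cond sumr_ge0// => r /andP[/andP[_ rn] _].
    by apply/F0/ratio01/ltnW.
  have : 0 < n%:R^-1 :> R by rewrite invr_gt0.
  nra.
have [c1 _] := cnt (b * n%:R) (mulr_ge0 (le_trans a0 ab) (ltW n0')) ltac:(by rewrite gtr_pMl).
have [_ c2] := cnt (a * n%:R) (mulr_ge0 a0 (ltW n0')) ltac:(by rewrite gtr_pMl// (le_lt_trans ab)).
rewrite /riemann_sum [leRHS]mulrC ler_pdivlMr//.
apply: (@le_trans _ _ (e * (\sum_(0 <= r < n) (r%:R <= b * n%:R)%R%:R
   - \sum_(0 <= r < n) (r%:R < a * n%:R)%R%:R))).
  rewrite -mulrA ler_wpM2l// !mulrBl mulVf ?lt0r_neq0//; lra.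
rewrite -sumrB mulr_sumr; apply: ler_sum_nat => r /andP[_ rn].
have rI := ratio01 (ltnW rn).
have F0r := F0 _ rI.
have [h1|h1] := leP (r%:R) (b * n%:R); have [h2|h2] := ltP (r%:R) (a * n%:R);
  rewrite /= ?subrr ?mulr0// ?sub0r ?mulrN1.
- rewrite subr0 mulr1; apply: Fe; rewrite ler_pdivlMr// ler_pdivrMr//.
  by apply/andP.
- by apply: le_trans F0r; rewrite oppr_le0.
Qed.

End riemann_sums.

(** * Convergence of profiles and of their inner products *)

Section profile_limits.
Context {R : realType}.
Implicit Types (x u : R) (m n : nat) (k : nat -> nat).

Local Notation phi := (@ap_profile R).

(* The unimodal function min (x / u) ((1 - x) / (1 - u)) of u is split into monotone
   pieces: their Riemann sums converge at a rate that does not depend on x. *)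
Lemma ap_profile_riemann m x : (0 < m)%N -> 0 < x < 1 ->
  phi m x = riemann_sum m (fun u => (Num.max 1 ((1 - u) / (1 - x)))^-1)
          - riemann_sum m (fun u => 1 - (Num.max 1 (u / x))^-1) + x / m%:R.
Proof.
move=> m0 /andP[x0 x1]; have x1' : 0 < 1 - x by rewrite subr_gt0.
have m0' : 0 < m%:R :> R by rewrite ltr0n.
rewrite /riemann_sum -mulrBr -sumrB big_ltn//= !mul0r subr0 mul1r.
rewrite max_r; last by rewrite invr_ge1 ?unitfE ?gt_eqF//; lra.
rewrite max_l; last exact: ler01.
rewrite invrK invr1 subrr subr0 /ap_profile mulrDr mulr_sumr.
(* The term [r = 0] of the Riemann sums is [(1 - x) / m]; the correction [x / m] completes it to the
   summand [1 / m] of the profile. *)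
rewrite addrAC (_ : m%:R^-1 * (1 - x) + x / m%:R = m%:R^-1); last by ring.
congr (_ + _); apply: eq_big_nat => r /andP[r0 rm].
have r0' : 0 < r%:R :> R by rewrite ltr0n.
have mr0 : 0 < (m - r)%:R :> R by rewrite ltr0n subn_gt0.
have mE : m%:R = r%:R + (m - r)%:R :> R by rewrite -natrD subnKC// ltnW.
have uE : 1 - r%:R / m%:R = (m - r)%:R / m%:R :> R.
  by rewrite mE; field; rewrite -mE lt0r_neq0.
rewrite uE opprB addrCA addrA.
have [h|h] := leP (x * m%:R) r%:R.
  rewrite min_l; last first.
    by rewrite ler_pdivrMr// mulrAC ler_pdivlMr//; move: h; rewrite mE; nra.
  rewrite max_r; last by rewrite ler_pdivlMr// mul1r ler_pdivlMr.
  rewrite max_l; last by rewrite ler_pdivrMr// mul1r ler_pdivrMr//; move: h; rewrite mE; nra.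
  by rewrite invr1; field; rewrite !lt0r_neq0.
rewrite min_r; last first.
  by rewrite ler_pdivrMr// mulrAC ler_pdivlMr//; move: h; rewrite mE; nra.
rewrite max_l; last by rewrite ler_pdivrMr// mul1r ler_pdivrMr// ltW.
rewrite max_r; last by rewrite ler_pdivlMr// mul1r ler_pdivlMr//; move: h; rewrite mE; nra.
by rewrite invr1; field; rewrite !lt0r_neq0.
Qed.

(** The two monotone Riemann sums and the correction each vary by at most [1 / m + 1 / n]. The
    monotone pieces divide by [x] and [1 - x], so the end points are treated apart; there the
    profile is [1 / m]. *)
Lemma ap_profile_close m n x : (0 < m)%N -> (0 < n)%N -> 0 <= x <= 1 ->
  `|phi m x - phi n x| <= 3 * (m%:R^-1 + n%:R^-1).
Proof.
move=> m0 n0 /andP[x0 x1].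
have im : 0 < m%:R^-1 :> R by rewrite invr_gt0 ltr0n.
have inn : 0 < n%:R^-1 :> R by rewrite invr_gt0 ltr0n.
have [x01|nx] := boolP (0 < x < 1); last first.
  have phiE q : phi q x = q%:R^-1.
    rewrite /ap_profile big1_seq ?addr0// => r /andP[_].
    rewrite mem_index_iota => /andP[r0 rk].
    have h1 : 0 < r%:R :> R by rewrite ltr0n.
    have h2 : 0 < (q - r)%:R :> R by rewrite ltr0n subn_gt0.
    have [/eqP xe|xe] := boolP (x == 0).
      by rewrite xe mul0r subr0 min_l// mul1r invr_ge0 ltW.
    have [/eqP xe1|xe1] := boolP (x == 1).
      by rewrite xe1 subrr mul0r min_r// mul1r invr_ge0 ltW.
    by move: nx; rewrite !lt_neqAle x0 x1 eq_sym xe xe1.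
  rewrite !phiE; apply: le_trans (ler_normB _ _) _.
  by rewrite !ger0_norm ?ltW//; lra.
have /andP[x0' x1'] := x01; have x2 : 0 < 1 - x by rewrite subr_gt0.
rewrite !ap_profile_riemann//.
set h1 := fun u => (Num.max 1 ((1 - u) / (1 - x)))^-1.
set h2 := fun u => 1 - (Num.max 1 (u / x))^-1.
have maxI (y : R) : 0 < (Num.max 1 y)^-1 <= 1.
  by rewrite invr_gt0 lt_max ltr01/= invf_le1 ?le_max ?lexx// lt_max ltr01.
have b1 : `|riemann_sum m h1 - riemann_sum n h1| <= m%:R^-1 + n%:R^-1.
  apply: riemann_sum_monotone => // [u v _ _ uv|u]; last first.
    by rewrite /h1; have := maxI ((1 - u) / (1 - x)); lra.
  rewrite /h1 lef_pV2 ?posrE ?lt_max ?ltr01//.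
  by rewrite ge_max !le_max lexx/= ler_pM2r ?invr_gt0// lerD2l lerN2 uv orbT.
have b2 : `|riemann_sum m h2 - riemann_sum n h2| <= m%:R^-1 + n%:R^-1.
  apply: riemann_sum_monotone => // [u v _ _ uv|u]; last first.
    by rewrite /h2; have := maxI (u / x); lra.
  rewrite /h2 lerD2l lerN2 lef_pV2 ?posrE ?lt_max ?ltr01//.
  by rewrite ge_max !le_max lexx/= ler_pM2r ?invr_gt0// uv orbT.
have b3 : `|x / m%:R - x / n%:R| <= m%:R^-1 + n%:R^-1.
  rewrite -mulrBr normrM (ger0_norm x0); apply: le_trans (ler_piMl _ x1) _ => //.
  by apply: le_trans (ler_normB _ _) _; rewrite (ger0_norm (ltW im)) (ger0_norm (ltW inn)).
move: b1 b2 b3; rewrite !ler_norml; lra.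
Qed.

(** This profile serves as the constant function, so that the number of progressions is an inner
    product of profiles like the incidences. *)
Lemma ap_profile1 x : phi 1 x = 1.
Proof. by rewrite /ap_profile big_geq// addr0 invr1. Qed.

Definition settles k := (exists c : nat, \forall n \near \oo, k n = c) \/ k @ \oo --> \oo.

Lemma cvg_natr_inv0 k : k @ \oo --> \oo -> (k n)%:R^-1 @[n --> \oo] --> (0 : R).
Proof.
move=> kk.
have h : (k n)%:R @[n --> \oo] --> (+oo : set_system R).
  by apply: (@cvg_comp _ _ _ k (fun i : nat => i%:R) \oo \oo) => //; exact: cvgr_idn.
apply/(gtr0_cvgV0 (f := fun n => (k n)%:R)); last exact: h.
by near=> n; rewrite ltr0n; near: n; exact: (kk _ (nbhs_infty_gt 0%N)).
Unshelve. all: by end_near. Qed.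

(** The Lipschitz bound of [ap_profile (k n)] may blow up with [k n]; a fixed nearby profile has a
    fixed Lipschitz constant, to which [riemann_sum_lipschitz] applies. *)
Lemma settles_profile k (e : R) : settles k -> (\forall n \near \oo, (0 < k n)%N) -> 0 < e ->
  exists2 M, (0 < M)%N &
    \forall n \near \oo, forall x, 0 <= x <= 1 -> `|phi (k n) x - phi M x| <= e.
Proof.
move=> [[c kc]|kk] k0 e0.
  have [c0|c0] := posnP c.
    have [N _ hN] := filterI k0 kc.
    by have /= [a b] := hN N (leqnn N); move: a; rewrite b c0.
  exists c => //; near=> n => x _.
  by rewrite (near kc n)// subrr normr0 ltW.
have e6 : 0 < e / 6 by rewrite divr_gt0.
have [M _ hM] : \forall n \near \oo, `|n%:R^-1 : R| <= e / 6.
  by apply: cvgr0_norm_le e6; apply: cvg_natr_inv0; exact: cvg_id.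
exists M.+1 => //; near=> n => x x01.
have kn0 : (0 < k n)%N by near: n.
have kM : (M <= k n)%N by near: n; exact: (kk _ (nbhs_infty_ge M)).
apply: le_trans (ap_profile_close _ _ x01) _ => //.
have a : (k n)%:R^-1 <= e / 6 by have := hM _ kM; rewrite /= ger0_norm ?invr_ge0.
have b : M.+1%:R^-1 <= e / 6 by have := hM _ (leqnSn M); rewrite /= ger0_norm ?invr_ge0.
by apply: le_trans (ler_wpM2l _ (lerD a b)) _ => //; lra.
Unshelve. all: by end_near. Qed.

(** The limit profile is never constructed: the Riemann sums are shown to be Cauchy by comparison
    with a fixed pair of profiles. *)
Lemma riemann_profile_cvg k1 k2 : settles k1 -> settles k2 ->
  (\forall n \near \oo, (0 < k1 n)%N) -> (\forall n \near \oo, (0 < k2 n)%N) ->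
  cvgn (fun n => riemann_sum n (fun x => phi (k1 n) x * phi (k2 n) x)).
Proof.
move=> s1 s2 k10 k20; apply/cauchy_cvgP/cauchy_exP => e e0.
have e8 : 0 < e / 8 by rewrite divr_gt0.
have [M1 M10 h1] := settles_profile s1 k10 e8.
have [M2 M20 h2] := settles_profile s2 k20 e8.
have M12 : 0 < (M1 + M2)%:R :> R by rewrite ltr0n addn_gt0 M10.
have [N _ hN] : \forall n \near \oo, `|n%:R^-1 : R| <= e / 8 / (M1 + M2)%:R.
  by apply: cvgr0_norm_le; [apply: cvg_natr_inv0; exact: cvg_id|rewrite divr_gt0].
pose F x := phi M1 x * phi M2 x.
have phi01 M x : (0 < M)%N -> 0 <= x <= 1 -> 0 <= phi M x <= 1.
  by move=> M0 x01; rewrite ap_profile_ge0// ap_profile_le1.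
have FL : {in `[0, 1] &, forall x y, `|F x - F y| <= (M1 + M2)%:R * `|x - y|}.
  move=> x y; rewrite !in_itv/= => x01 y01.
  have -> : F x - F y = (phi M1 x - phi M1 y) * phi M2 x + phi M1 y * (phi M2 x - phi M2 y).
    by rewrite /F; ring.
  apply: le_trans (ler_normD _ _) _; rewrite natrD [leRHS]mulrDl; apply: lerD.
    rewrite normrM; apply: le_trans (ler_piMr _ _) (ap_profile_lipschitz _ _ _) => //.
    by have /andP[a b] := phi01 M2 x M20 x01; rewrite ger0_norm.
  rewrite normrM; apply: le_trans (ler_piMl _ _) (ap_profile_lipschitz _ _ _) => //.
  by have /andP[a b] := phi01 M1 y M10 y01; rewrite ger0_norm.
exists (riemann_sum N.+1 F).
suff : \forall n \near \oo, ball (riemann_sum N.+1 F) e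
    (riemann_sum n (fun x => phi (k1 n) x * phi (k2 n) x)) by [].
near=> n.
have n0 : (0 < n)%N by near: n; exact: nbhs_infty_gt.
have nN : (N <= n)%N by near: n; exact: nbhs_infty_ge.
have c1 : `|riemann_sum N.+1 F - riemann_sum n F| <= e / 4.
  apply: le_trans (riemann_sum_lipschitz _ _ FL) _ => //.
  have := hN n nN; have := hN N.+1 (leqnSn _); rewrite /= !ger0_norm ?invr_ge0// => a b.
  rewrite -ler_pdivlMl//; apply: le_trans (lerD a b) _.
  by rewrite -mulrDl mulrC ler_wpM2l ?invr_ge0//; lra.
have c2 : `|riemann_sum n F - riemann_sum n (fun x => phi (k1 n) x * phi (k2 n) x)| <= e / 4.
  apply: riemann_sum_close => // x x01.
  have kn1 : (0 < k1 n)%N by near: n.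
  have kn2 : (0 < k2 n)%N by near: n.
  have -> : F x - phi (k1 n) x * phi (k2 n) x =
    - ((phi (k1 n) x - phi M1 x) * phi M2 x + phi (k1 n) x * (phi (k2 n) x - phi M2 x)).
    by rewrite /F; ring.
  rewrite normrN; apply: le_trans (ler_normD _ _) _.
  have a1 : `|phi (k1 n) x - phi M1 x| <= e / 8 by have := near h1 n; exact.
  have a2 : `|phi (k2 n) x - phi M2 x| <= e / 8 by have := near h2 n; exact.
  rewrite !normrM (_ : e / 4 = e / 8 + e / 8); last by field.
  have /andP[b1 b2] := phi01 M2 x M20 x01.
  have /andP[b3 b4] := phi01 (k1 n) x kn1 x01.
  apply: lerD; first by rewrite (le_trans _ a1)// ler_piMr// ger0_norm.
  by rewrite (le_trans _ a2)// ler_piMl// ger0_norm.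
rewrite /ball/= (_ : riemann_sum N.+1 F - _ = (riemann_sum N.+1 F - riemann_sum n F) +
  (riemann_sum n F - riemann_sum n (fun x => phi (k1 n) x * phi (k2 n) x))); last by ring.
apply: le_lt_trans (ler_normD _ _) _; apply: le_lt_trans (lerD c1 c2) _; lra.
Unshelve. all: by end_near. Qed.

Lemma ap_profile_near0E m x : (1 < m)%N -> 0 <= x -> x * m%:R <= 1 ->
  phi m x = m%:R^-1 + x * \sum_(1 <= r < m) r%:R^-1.
Proof.
move=> m1 x0 xm; rewrite /ap_profile mulr_sumr; congr (_ + _).
apply: eq_big_nat => r /andP[r0 rm].
have r0' : 0 < r%:R :> R by rewrite ltr0n.
have mr0 : 0 < (m - r)%:R :> R by rewrite ltr0n subn_gt0.
have mE : m%:R = r%:R + (m - r)%:R :> R by rewrite -natrD subnKC// ltnW.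
have r1 : 1 <= r%:R :> R by rewrite ler1n.
by rewrite min_l// ler_pdivrMr// mulrAC ler_pdivlMr//; move: xm; rewrite mE; nra.
Qed.

Lemma affine_away0 (a b M : R) : 0 < M -> (a != 0) || (b != 0) ->
  exists u v e : R, [/\ 0 <= u, u < v, v <= M, 0 < e &
    forall x, u <= x <= v -> e <= `|a + b * x|].
Proof.
move=> M0; have [a0 /= b0|a0 _] := eqVneq a 0.
  exists (M / 2), M, (`|b| * (M / 2)).
  have bp : 0 < `|b| by rewrite normr_gt0.
  split; [lra|lra|by []|by rewrite mulr_gt0// divr_gt0|move=> x /andP[x1 x2]].
  by rewrite a0 add0r normrM ler_wpM2l//; apply: le_trans (ler_norm _).
have ap : 0 < `|a| by rewrite normr_gt0.
have bp : 0 < `|b| + 1 by rewrite ltr_wpDl.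
have vp : 0 < Num.min M (`|a| / 2 / (`|b| + 1)) by rewrite lt_min M0 !divr_gt0.
exists 0, (Num.min M (`|a| / 2 / (`|b| + 1))), (`|a| / 2).
split; [by []|by []|by rewrite ge_min lexx|by rewrite divr_gt0|].
move=> x /andP[x0]; rewrite le_min => /andP[_]; rewrite ler_pdivlMr// => xb.
have h : `|b * x| <= `|a| / 2 by rewrite normrM (ger0_norm x0); nra.
have := ler_normB (a + b * x) (b * x); rewrite addrK; lra.
Qed.

Lemma harmonic_lt m n : (1 < m < n)%N ->
  (\sum_(1 <= r < m) r%:R^-1 : R) < \sum_(1 <= r < n) r%:R^-1.
Proof.
move=> /andP[m1 mn]; rewrite (@big_cat_nat _ _ _ m 1 n)//=; [|exact: ltnW|exact: ltnW].
rewrite ltrDl big_ltn//= ltr_pwDl ?invr_gt0 ?ltr0n ?(ltnW m1)//.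
by apply: sumr_ge0 => i _; rewrite invr_ge0.
Qed.

(* Near 0 the profile of c stays above 1 / c while that of k n becomes small if k n
   tends to infinity. If k is constant, both are affine near 0, with values 1 / k
   and 1 / c and harmonic numbers as slopes. *)
Lemma profile_not_proportional k c (lam : R) : settles k -> (1 < c)%N ->
  (\forall n \near \oo, (c < k n)%N) -> 0 < lam ->
  exists a b e : R, [/\ 0 <= a, a < b, b < 1, 0 < e & \forall n \near \oo,
    forall x, a <= x <= b -> e <= `|phi (k n) x - lam * phi c x|].
Proof.
move=> sk c1 ck lam0; have c0' : 0 < c%:R :> R by rewrite ltr0n ltnW.
case: sk => [[m km]|kk].
  have cm : (c < m)%N by have [N _ hN] := filterI ck km; have /= [h <-] := hN N (leqnn N).
  have m0' : 0 < m%:R :> R by rewrite ltr0n (leq_trans _ cm).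
  pose Hc : R := \sum_(1 <= r < c) r%:R^-1; pose Hm : R := \sum_(1 <= r < m) r%:R^-1.
  have Hcm : Hc < Hm by apply: harmonic_lt; rewrite c1.
  have Hc0 : 0 < Hc.
    rewrite /Hc big_ltn//= ltr_pwDl ?invr_gt0//.
    by apply: sumr_ge0 => i _; rewrite invr_ge0.
  have m0i : 0 < m%:R^-1 :> R by rewrite invr_gt0.
  (* If both coefficients vanished, then [lam = c / m < 1] and [Hm = lam * Hc < Hc], against
     [Hc < Hm]. *)
  have [|u [v [e [u0 uv vM e0 he]]]] :=
    @affine_away0 (m%:R^-1 - lam * c%:R^-1) (Hm - lam * Hc) m%:R^-1 m0i.
    rewrite -negb_and; apply/negP => /andP[/eqP h1 /eqP h2].
    have lam1 : lam * m%:R = c%:R.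
      have -> : lam = c%:R / m%:R by apply: (mulIf (invr_neq0 (lt0r_neq0 c0')));
        rewrite mulrAC mulfV ?lt0r_neq0// mul1r; lra.
      by rewrite divfK// lt0r_neq0.
    have cm' : c%:R < m%:R :> R by rewrite ltr_nat.
    nra.
  exists u, v, e; split => //.
    apply: le_lt_trans vM _; rewrite invf_lt1// ltr1n; exact: (ltn_trans c1 cm).
  near=> n => x /andP[xu xv]; rewrite (near km n)//.
  have x0 : 0 <= x by apply: le_trans xu.
  have xm : x * m%:R <= 1 by rewrite -ler_pdivlMr// mul1r; apply: le_trans vM.
  have cm' : c%:R < m%:R :> R by rewrite ltr_nat.
  have xc : x * c%:R <= 1 by nra.
  rewrite !ap_profile_near0E//; last exact: (ltn_trans c1 cm).
  rewrite (_ : _ - _ = m%:R^-1 - lam * c%:R^-1 + (Hm - lam * Hc) * x); last by rewrite /Hm /Hc; ring.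
  by apply: he; rewrite xu.
(* Here [lam / c = 8 eta], whereas [ap_profile_near0] bounds the long profile by [3 eta] on
   [[0, eta ^+ 2]]. *)
pose eta := lam / c%:R / 8; have eta0 : 0 < eta by rewrite !divr_gt0.
pose b := Num.min 2^-1 (eta ^+ 2).
have b0 : 0 < b by rewrite lt_min invr_gt0 ltr0n exprn_gt0.
exists 0, b, eta; split => //.
  by rewrite /b gt_min; apply/orP; left; lra.
have h : \forall n \near \oo, `|(k n)%:R^-1 : R| <= eta.
  by apply: cvgr0_norm_le eta0; exact: cvg_natr_inv0.
near=> n => x /andP[x0 xb].
have x01 : 0 <= x <= 1 by rewrite x0 (le_trans xb)// ge_min; apply/orP; left; lra.
have kn0 : (0 < k n)%N by near: n; exact: (kk _ (nbhs_infty_gt 0%N)).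
have h1 := ap_profile_near0 kn0 x01 eta0.
have h2 := ap_profile_ge_inv c x01.
have h3 : `|(k n)%:R^-1 : R| <= eta by near: n.
have h4 : x / eta <= eta.
  by rewrite ler_pdivrMr// -expr2 (le_trans xb)// ge_min lexx orbT.
have h5 : lam * c%:R^-1 = 8 * eta by rewrite /eta; field; rewrite lt0r_neq0.
have h6 : lam * c%:R^-1 <= lam * phi c x by rewrite ler_wpM2l// ltW.
rewrite ger0_norm ?invr_ge0// in h3.
rewrite distrC; apply: le_trans (ler_norm _); lra.
Unshelve. all: by end_near. Qed.

End profile_limits.

Section profile_gram.
Context {R : realType}.
Implicit Types (m n : nat) (k : nat -> nat).

Local Notation phi := (@ap_profile R).

Lemma riemann_sum_lim_gt0 (F : nat -> R -> R) (a b e l : R) : 0 <= a -> a < b -> b < 1 -> 0 < e ->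
  (\forall n \near \oo, forall x, 0 <= x <= 1 -> 0 <= F n x) ->
  (\forall n \near \oo, forall x, a <= x <= b -> e <= F n x) ->
  riemann_sum n (F n) @[n --> \oo] --> l -> 0 < l.
Proof.
move=> a0 ab b1 e0 F0 Fe Fl.
apply: (@lt_le_trans _ _ (e * ((b - a) / 2))); first by rewrite mulr_gt0// divr_gt0// subr_gt0.
apply: (cvgr_to_ge Fl); near=> n.
have n0 : (0 < n)%N by near: n; exact: nbhs_infty_gt.
have n1 : `|n%:R^-1 : R| <= (b - a) / 2.
  near: n; have h : 0 < (b - a) / 2 by rewrite divr_gt0// subr_gt0.
  by apply: cvgr0_norm_le h; apply: cvg_natr_inv0; exact: cvg_id.
rewrite ger0_norm ?invr_ge0// in n1.
apply: le_trans (riemann_sum_count (n := n) (a := a) (b := b) (e := e) _ _ _ _ _ _) => //.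
- by rewrite ler_wpM2l ?(ltW e0)//; lra.
- exact: ltW.
- by near: n.
- by near: n.
Unshelve. all: by end_near. Qed.

(** The limit is positive because every profile is at least [1/4] on [[1/4, 3/4]], by
    [ap_profile_ge_min]. *)
Lemma riemann_profile_lim k1 k2 : settles k1 -> settles k2 ->
  (\forall n \near \oo, (0 < k1 n)%N) -> (\forall n \near \oo, (0 < k2 n)%N) ->
  exists2 J : R, 0 < J &
    riemann_sum n (fun x => phi (k1 n) x * phi (k2 n) x) @[n --> \oo] --> J.
Proof.
move=> s1 s2 k10 k20; exists (limn (fun n => riemann_sum n (fun x => phi (k1 n) x * phi (k2 n) x)));
  last exact: riemann_profile_cvg.
have q m x : (0 < m)%N -> 4^-1 <= x <= 3 / 4 -> 4^-1 <= phi m x.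
  move=> m0 x01; have := @ap_profile_ge_min R m x m0; rewrite /Num.min.
  by case: ltP => _ /(_ ltac:(lra)); lra.
apply: (@riemann_sum_lim_gt0 (fun n x => phi (k1 n) x * phi (k2 n) x) 4^-1 (3 / 4) (4^-1 * 4^-1));
  last (exact: riemann_profile_cvg).
- lra.
- lra.
- lra.
- lra.
- by near=> n => x x01; rewrite mulr_ge0// ap_profile_ge0.
- near=> n => x x01; apply: ler_pM; rewrite ?invr_ge0//; apply: q => //; near: n.
Unshelve. all: by end_near. Qed.

(** With the projection coefficient [lam = J12 / J22], the Riemann sums of [(phi1 - lam phi2)^2]
    tend to [J11 - J12 ^+ 2 / J22], which is positive since the profiles stay apart on an interval.
    If both lengths grow, the profiles merge by [ap_profile_close]. *)
Lemma profile_gram k1 k2 (J11 J12 J22 : R) : settles k1 -> settles k2 ->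
  (\forall n \near \oo, (1 < k2 n < k1 n)%N) -> 0 < J12 -> 0 < J22 ->
  riemann_sum n (fun x => phi (k1 n) x * phi (k1 n) x) @[n --> \oo] --> J11 ->
  riemann_sum n (fun x => phi (k1 n) x * phi (k2 n) x) @[n --> \oo] --> J12 ->
  riemann_sum n (fun x => phi (k2 n) x * phi (k2 n) x) @[n --> \oo] --> J22 ->
  ((exists c : nat, \forall n \near \oo, k2 n = c) -> J12 ^+ 2 < J11 * J22) /\
  (k2 @ \oo --> \oo -> J11 = J12 /\ J12 = J22).
Proof.
move=> s1 s2 k21 p12 p22 h11 h12 h22; split.
  move=> [c kc]; pose lam := J12 / J22; have lam0 : 0 < lam by rewrite divr_gt0.
  have [N _ hN] := filterI k21 kc; have /= [cc cE] := hN N (leqnn N).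
  have c1 : (1 < c)%N by rewrite -cE; case/andP: cc.
  have ck : \forall n \near \oo, (c < k1 n)%N.
    by apply: filterS (filterI k21 kc) => n [/andP[_ +] <-].
  have [a [b [e [a0 ab b1 e0 he]]]] := profile_not_proportional s1 c1 ck lam0.
  have hl : riemann_sum n (fun x => (phi (k1 n) x - lam * phi (k2 n) x) ^+ 2) @[n --> \oo] -->
      J11 + (- (2 * lam)) * J12 + lam ^+ 2 * J22.
    have -> : (fun n => riemann_sum n (fun x => (phi (k1 n) x - lam * phi (k2 n) x) ^+ 2)) =
      fun n => riemann_sum n (fun x => phi (k1 n) x * phi (k1 n) x) +
        (- (2 * lam)) * riemann_sum n (fun x => phi (k1 n) x * phi (k2 n) x) +
        lam ^+ 2 * riemann_sum n (fun x => phi (k2 n) x * phi (k2 n) x).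
      apply/funext => n; rewrite -!riemann_sumZ -!riemann_sumD; congr riemann_sum.
      by apply/funext => x; ring.
    by apply: cvgD; [apply: cvgD => //|]; apply: cvgMr.
  have e2 : 0 < e ^+ 2 by rewrite exprn_gt0.
  have := riemann_sum_lim_gt0 a0 ab b1 e2 _ _ hl.
  have -> : J11 + - (2 * lam) * J12 + lam ^+ 2 * J22 = J11 - J12 ^+ 2 / J22.
    by rewrite /lam; field; rewrite lt0r_neq0.
  rewrite subr_gt0 ltr_pdivrMr//; apply.
    by near=> n => x _; exact: sqr_ge0.
  near=> n => x xab; rewrite -[leRHS]real_normK ?num_real// lerXn2r ?nnegrE ?(ltW e0)//.
  rewrite (near kc n)//; have := near he n; apply => //.
move=> kk2.
have kk1 : k1 @ \oo --> \oo.
  move=> A /= [N _ hN].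
  suff : \forall n \near \oo, A (k1 n) by [].
  by apply: filterS2 k21 (kk2 _ (nbhs_infty_ge N)) => n /andP[_ h] /= h'; apply/hN/(leq_trans h')/ltnW.
have phi01 m x : (0 < m)%N -> 0 <= x <= 1 -> `|phi m x| <= 1.
  by move=> m0 x01; rewrite ger0_norm ?ap_profile_ge0// ap_profile_le1.
have cl k : (forall n, k n = k1 n \/ k n = k2 n) ->
   (riemann_sum n (fun x => phi (k1 n) x * phi (k n) x) -
    riemann_sum n (fun x => phi (k2 n) x * phi (k n) x)) @[n --> \oo] --> (0 : R).
  move=> kE; apply/cvgr0Pnorm_le => e e0.
  have e6 : 0 < e / 6 by rewrite divr_gt0.
  near=> n.
  have n0 : (0 < n)%N by near: n; exact: nbhs_infty_gt.
  have /andP[h2 h1] : (1 < k2 n < k1 n)%N by near: n.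
  have k20 : (0 < k2 n)%N by exact: ltnW.
  have k10 : (0 < k1 n)%N by exact: leq_trans h1.
  apply: riemann_sum_close => // x x01.
  rewrite -mulrBl normrM; apply: le_trans (ler_piMr _ (phi01 _ _ _ x01)) _ => //.
    by case: (kE n) => ->.
  apply: le_trans (ap_profile_close k10 k20 x01) _.
  have a1 : `|(k1 n)%:R^-1 : R| <= e / 6.
    by near: n; apply: cvgr0_norm_le e6; exact: cvg_natr_inv0.
  have a2 : `|(k2 n)%:R^-1 : R| <= e / 6.
    by near: n; apply: cvgr0_norm_le e6; exact: cvg_natr_inv0.
  by rewrite !ger0_norm ?invr_ge0// in a1 a2; lra.
have sw k k' : (fun n => riemann_sum n (fun x => phi (k n) x * phi (k' n) x)) =
    (fun n => riemann_sum n (fun x => phi (k' n) x * phi (k n) x)).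
  by apply/funext => n; congr riemann_sum; apply/funext => x; rewrite mulrC.
have h21 := h12; rewrite sw in h21.
split; apply/eqP; rewrite -subr_eq0; apply/eqP.
  by apply: (cvg_unique _ (cvgB h11 h21) (cl k1 (fun n => or_introl erefl))).
by apply: (cvg_unique _ (cvgB h12 h22) (cl k2 (fun n => or_intror erefl))).
Unshelve. all: by end_near. Qed.

End profile_gram.

(** * Covariances of the counts *)

Section ap_covariance.
Context {R : realType} (n : nat) (p : R).
Hypothesis p01 : 0 <= p <= 1.
Implicit Types (l : nat) (A B a c : {set 'I_n}).

Let p0 : 0 <= p. Proof. by case/andP: p01. Qed.
Let p1 : p <= 1. Proof. by case/andP: p01. Qed.

Definition ap_cov l l' : R :=
  \sum_(a in APs n l) \sum_(c in APs n l') (p ^+ #|a :|: c| - p ^+ (l + l')).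

Definition ap_incidence l l' : R := \sum_(x : 'I_n) (ap_degree l x)%:R * (ap_degree l' x)%:R.

Lemma ap_covE l l' : (2 < l)%N -> (2 < l')%N ->
  bern_mean p (fun A => (\sum_(a in APs n l) (a \subset A)%:R - ap_mean n p l)
                      * (\sum_(c in APs n l') (c \subset A)%:R - ap_mean n p l')) = ap_cov l l'.
Proof.
move=> l3 l3'.
have mE q A : \sum_(a in APs n q) (a \subset A)%:R - ap_mean n p q =
    \sum_(a in APs n q) ((a \subset A)%:R - p ^+ q).
  by rewrite sumrB /ap_mean sumr_const mulr_natl.
transitivity (bern_mean p (fun A => \sum_(a in APs n l) \sum_(c in APs n l')
   (((a :|: c) \subset A)%:R - p ^+ l' * (a \subset A)%:R - p ^+ l * (c \subset A)%:R + p ^+ (l + l')))).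
  apply: eq_bern_mean => A; rewrite !mE// mulr_suml; apply: eq_bigr => a _; rewrite mulr_sumr.
  by apply: eq_bigr => c _; rewrite finset.subUset -mulnb natrM exprD; ring.
rewrite bern_mean_sum; apply: eq_bigr => a aA; rewrite bern_mean_sum; apply: eq_bigr => c cA.
rewrite bern_meanD !bern_meanB !bern_meanZ bern_mean_cst// !bern_mean_subset//.
by rewrite (card_APs_mem l3 aA) (card_APs_mem l3' cA) exprD; ring.
Qed.

Lemma ap_mean_bern l : (2 < l)%N ->
  bern_mean p (fun A => \sum_(a in APs n l) (a \subset A)%:R) = ap_mean n p l.
Proof.
move=> l3; rewrite bern_mean_sum /ap_mean mulr_natl -sumr_const.
by apply: eq_bigr => a aA; rewrite bern_mean_subset// (card_APs_mem l3 aA).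
Qed.

Lemma ap_incidenceE l l' :
  ap_incidence l l' = \sum_(a in APs n l) \sum_(c in APs n l') (#|a :&: c|%:R : R).
Proof.
transitivity (\sum_(x : 'I_n) \sum_(a in APs n l) \sum_(c in APs n l')
   ((x \in a) && (x \in c))%:R : R).
  apply: eq_bigr => x _; rewrite !ap_degree_natr mulr_suml; apply: eq_bigr => a _.
  by rewrite mulr_sumr; apply: eq_bigr => c _; rewrite -mulnb natrM.
rewrite exchange_big/=; apply: eq_bigr => a _; rewrite exchange_big/=; apply: eq_bigr => c _.
rewrite -sum1_card natr_sum [RHS]big_mkcond/=; apply: eq_bigr => x _.
by rewrite inE; case: (_ && _).
Qed.

(** The incidence counts each pair [#|a :&: c|] times. Subtracting its multiple cancels the pairs
    with at most one common point exactly and leaves a correction for the others. *)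
Definition ap_cov_rest l l' : R := ap_cov l l' - p ^+ (l + l').-1 * (1 - p) * ap_incidence l l'.

(** For [k] common points, nonnegativity is [1 - p^k = (1 - p) (1 + ... + p^(k-1)) >= k p^(k-1) (1 -
    p)]. The lower bound uses [p^k <= p] and [p^(k-1) <= p], the latter because [k >= 2]. *)
Lemma cov_rest_term_bounds (s k : nat) : (k <= s)%N -> (1 < k)%N ->
  forall t, t = p ^+ (s - k) - p ^+ s - p ^+ s.-1 * (1 - p) * k%:R ->
  p ^+ (s - k) * (1 - (k.+1)%:R * p) <= t /\ 0 <= t <= p ^+ (s - k).
Proof.
move=> ks k1 t tE0.
have e1 : p ^+ s = p ^+ (s - k) * p ^+ k by rewrite -exprD subnK.
have e2 : p ^+ s.-1 = p ^+ (s - k) * p ^+ k.-1.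
  by rewrite -exprD; congr (_ ^+ _); lia.
have tE : t = p ^+ (s - k) * (1 - p ^+ k - p ^+ k.-1 * (1 - p) * k%:R).
  by rewrite tE0 e1 e2; ring.
have q0 : 0 <= p ^+ (s - k) by rewrite exprn_ge0.
have pk : 0 <= p ^+ k <= p.
  by rewrite exprn_ge0//= -[leRHS]expr1 ler_wiXn2l// ltnW.
have pk1 : 0 <= p ^+ k.-1 <= p.
  by rewrite exprn_ge0//= -[leRHS]expr1 ler_wiXn2l//; lia.
have geo : p ^+ k.-1 * (1 - p) * k%:R <= 1 - p ^+ k.
  have -> : 1 - p ^+ k = (1 - p) * \sum_(i < k) p ^+ i by rewrite -opprB subrX1 -mulNr opprB.
  rewrite (mulrC (p ^+ _)) -mulrA; apply: ler_wpM2l; first by rewrite subr_ge0.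
  rewrite mulr_natr -[k in _ *+ k]card_ord -sumr_const; apply: ler_sum => i _.
  by rewrite ler_wiXn2l//; have := ltn_ord i; lia.
have c0 : 0 <= p ^+ k.-1 * (1 - p) * k%:R.
  by rewrite !mulr_ge0//; [case/andP: pk1|rewrite subr_ge0].
have c1 : p ^+ k.-1 * (1 - p) * k%:R <= k%:R * p.
  rewrite [leRHS]mulrC ler_wpM2r//; case/andP: pk1 => h1 h2.
  by rewrite (le_trans _ h2)// ler_piMr// lerBlDr lerDl.
have /andP[_ pk'] := pk; rewrite tE; clear e1 e2 tE tE0 pk pk1.
split; first by rewrite ler_wpM2l// -natr1; lra.
rewrite mulr_ge0//=; last lra.
rewrite -[leRHS]mulr1 ler_wpM2l//; have : 0 <= p ^+ k by rewrite exprn_ge0.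
lra.
Qed.

Lemma ap_cov_restE l l' : (2 < l)%N -> (2 < l')%N -> ap_cov_rest l l' =
  \sum_(a in APs n l) \sum_(c in APs n l' | (1 < #|c :&: a|)%N)
    (p ^+ (l + l' - #|c :&: a|) - p ^+ (l + l') - p ^+ (l + l').-1 * (1 - p) * #|c :&: a|%:R).
Proof.
move=> l3 l3'; rewrite /ap_cov_rest ap_incidenceE mulr_sumr -sumrB.
apply: eq_bigr => a aA; rewrite mulr_sumr -sumrB [RHS]big_mkcondr/=.
apply: eq_bigr => c cA.
have -> : #|a :|: c| = (l + l' - #|c :&: a|)%N.
  by rewrite cardsU (card_APs_mem l3 aA) (card_APs_mem l3' cA) finset.setIC.
rewrite (finset.setIC a c); case: ltnP => //.
case: (#|c :&: a|) => [|[|//]] _; first by rewrite subn0 mulr0 !subrr.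
have -> : (l + l' - 1)%N = (l + l').-1 by lia.
have -> : p ^+ (l + l') = p ^+ (l + l').-1 * p by rewrite -exprSr; congr (_ ^+ _); lia.
ring.
Qed.

Lemma ap_cov_rest_ge0 l l' : (2 < l)%N -> (2 < l')%N -> 0 <= ap_cov_rest l l'.
Proof.
move=> l3 l3'; rewrite ap_cov_restE//; apply: sumr_ge0 => a aA; apply: sumr_ge0 => c /andP[cA two].
have cl : (#|c :&: a| <= l + l')%N.
  by rewrite (leq_trans (subset_leq_card (finset.subsetIl _ _)))// (card_APs_mem l3' cA) leq_addl.
by have [_ /andP[]] := cov_rest_term_bounds cl two erefl.
Qed.

Lemma ap_cov_rest_off_le l l' : (2 < l)%N -> (2 < l')%N ->
  ap_cov_rest l l' <= ap_mean n p l * (l%:R ^+ 2 * l'%:R ^+ 2).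
Proof.
move=> l3 l3'; rewrite ap_cov_restE// /ap_mean -mulrA mulr_natl -sumr_const.
apply: ler_sum => a aA.
have := sum_two_meeting_APs (p := p) (Q := predT) (q := 1) (B := a) l3' ler01.
rewrite (card_APs_mem l3 aA) mulr1 => H.
apply: le_trans (ler_wpM2l (exprn_ge0 l p0) (H _)); last first.
  by move=> c _ _ _; rewrite exprn_ile1.
rewrite mulr_sumr; under [leRHS]eq_bigl do rewrite andbT.
apply: ler_sum => c /andP[cA two].
have cl : (#|c :&: a| <= l')%N.
  by rewrite -(card_APs_mem l3' cA) subset_leq_card// finset.subsetIl.
have [_ /andP[_]] := @cov_rest_term_bounds (l + l') #|c :&: a| (leq_trans cl (leq_addl _ _)) two _ erefl.
move=> h; apply: le_trans h _; rewrite -exprD cardsD (card_APs_mem l3' cA) addnBA//.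
Qed.

(** The pairs [c = a] give the mean up to a relative error [(l + 1) p]; the other pairs with two
    common points gain a factor [p], as some point of [c] lies outside [a]. *)
Lemma ap_cov_rest_diag_le l : (2 < l)%N ->
  `|ap_cov_rest l l - ap_mean n p l| <= ap_mean n p l * (l%:R ^+ 4 * p).
Proof.
move=> l3; rewrite ap_cov_restE// /ap_mean.
have -> : #|APs n l|%:R * p ^+ l = \sum_(a in APs n l) p ^+ l by rewrite sumr_const mulr_natl.
rewrite -sumrB mulr_suml; apply: le_trans (ler_norm_sum _ _ _) _.
apply: ler_sum => a aA.
have aa : a :&: a = a by rewrite finset.setIid.
have al := card_APs_mem l3 aA.
have lR : 3 <= l%:R :> R by rewrite ler_nat.
have lp : 0 <= l%:R ^+ 4 * p - l.+1%:R * p.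
  rewrite -mulrBl mulr_ge0// subr_ge0 -natrX ler_nat (expnD l 2 2); nia.
have q0 : 0 <= p ^+ l by rewrite exprn_ge0.
rewrite (bigD1 a)/=; last by rewrite aA aa al; lia.
rewrite aa al addnK.
have l1 : (1 < l)%N by lia.
have [h1 /andP[_ h2]] := cov_rest_term_bounds (leq_addl l l) l1 erefl.
rewrite addnK in h1 h2.
set S := \sum_(i | _) _.
have [S0 S1] : 0 <= S /\ S <= p ^+ l * (l%:R ^+ 4 * p).
  have tb c : c \in APs n l -> (1 < #|c :&: a|)%N -> _ :=
    fun cA two => @cov_rest_term_bounds (l + l) #|c :&: a| (leq_trans
      (subset_leq_card (finset.subsetIr c a)) (leq_trans (eq_leq al) (leq_addl _ _))) two _ erefl.
  split.
    by apply: sumr_ge0 => c /andP[/andP[cA two] _]; have [_ /andP[]] := tb c cA two.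
  have := sum_two_meeting_APs (p := p) (Q := fun c => c != a) (q := p) (B := a) l3 p0.
  rewrite al -exprD => H; apply: le_trans (ler_wpM2l q0 (H _)); last first.
    move=> c cA ca _; rewrite -[leRHS]expr1 ler_wiXn2l// card_gt0 finset.setD_eq0.
    apply: contraNN ca => ca; rewrite eqEcard ca.
    by rewrite al (card_APs_mem l3 cA) leqnn.
  rewrite mulr_sumr; under [leRHS]eq_bigl do rewrite andbA.
  apply: ler_sum => c /andP[/andP[cA two] _].
  have [_ /andP[_ h]] := tb c cA two; apply: le_trans h _.
  rewrite -exprD cardsD (card_APs_mem l3 cA) addnBA//.
  by rewrite -[leqRHS](card_APs_mem l3 cA) subset_leq_card// finset.subsetIl.
move: h1 h2; set t := _ - _ * l%:R => h1 h2.
have h3 : p ^+ l * (l.+1%:R * p) <= p ^+ l * (l%:R ^+ 4 * p) by rewrite ler_wpM2l// -subr_ge0.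
rewrite mulrBr mulr1 in h1; clearbody t S; rewrite ler_norml; apply/andP; split; lra.
Qed.

End ap_covariance.

Section ap_riemann_sums.
Context {R : realType} (n : nat).
Implicit Types (l : nat).

(** At each point both degrees fall short of [n] times the profile by at most [2 l] and [2 l'], and
    all factors are at most [n]. *)
Lemma ap_incidence_riemann l l' : (2 < l)%N -> (2 < l')%N ->
  `|ap_incidence n l l' - n%:R ^+ 3 *
    riemann_sum n (fun x : R => ap_profile l.-1 x * ap_profile l'.-1 x)|
  <= 2 * n%:R ^+ 2 * (l%:R + l'%:R).
Proof.
move=> l3 l3'; have [n0|n0] := posnP n.
  rewrite n0 /riemann_sum big_geq// !mulr0 subr0 /ap_incidence big1 ?normr0 ?mulr_ge0//.
  by move=> x; have := leq_ltn_trans (leq0n x) (ltn_ord x); lia.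
have n0' : 0 < n%:R :> R by rewrite ltr0n.
rewrite /riemann_sum exprSr -mulrA mulVKf ?lt0r_neq0// big_mkord mulr_sumr -sumrB.
apply: le_trans (ler_norm_sum _ _ _) _.
have -> : 2 * n%:R ^+ 2 * (l%:R + l'%:R) = \sum_(x < n) (2 * n%:R * (l%:R + l'%:R)) :> R.
  by rewrite sumr_const card_ord -mulr_natl; ring.
apply: ler_sum => x _.
have x01 : 0 <= (x%:R / n%:R : R) <= 1 by apply: ratio01; exact: ltnW.
have m0 : (0 < l.-1)%N by lia.
have m0' : (0 < l'.-1)%N by lia.
have phi0 := @ap_profile_ge0 R l.-1 _ x01; have phi1 := @ap_profile_le1 R l.-1 _ m0 x01.
have psi0 := @ap_profile_ge0 R l'.-1 _ x01; have psi1 := @ap_profile_le1 R l'.-1 _ m0' x01.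
have d1 := @ap_degree_le R n l l3 x; have d2 := @ap_degree_ge R n l l3 x.
have e1 := @ap_degree_le R n l' l3' x; have e2 := @ap_degree_ge R n l' l3' x.
have l0 : 0 <= l%:R :> R by []. have l0' : 0 <= l'%:R :> R by [].
have g0 : 0 <= (ap_degree l x)%:R :> R by []. have g0' : 0 <= (ap_degree l' x)%:R :> R by [].
move: (ap_profile l.-1 _) (ap_profile l'.-1 _) phi0 phi1 psi0 psi1 d1 d2 e1 e2 l0 l0' g0 g0'.
move: (ap_degree l x)%:R (ap_degree l' x)%:R l%:R l'%:R n%:R n0'.
move=> f g a b N N0 u v u0 u1 v0 v1 d1 d2 e1 e2 a0 b0 f0 g0.
rewrite (_ : f * g - _ = f * (g - N * v) + (f - N * u) * (N * v)); last by ring.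
apply: le_trans (ler_normD _ _) _; rewrite [leRHS]mulrDr addrC; apply: lerD; rewrite normrM.
  have Nv : 0 <= N * v <= N by rewrite mulr_ge0 ?(ltW N0)//= ler_piMr// ltW.
  have /andP[Nv0 Nv1] := Nv.
  rewrite ler0_norm ?subr_le0// opprB (ger0_norm Nv0).
  by rewrite [leRHS]mulrAC; apply: ler_pM; rewrite ?subr_ge0//; lra.
rewrite (ger0_norm f0) ler0_norm ?subr_le0// opprB.
have fN : f <= N by apply: le_trans d1 _; rewrite ler_piMr// ltW.
by rewrite [leRHS]mulrAC mulrC; apply: ler_pM; rewrite ?subr_ge0//; lra.
Qed.

Lemma ap_count_riemann l : (2 < l)%N ->
  `|#|APs n l|%:R * l%:R
    - n%:R ^+ 2 * riemann_sum n (fun x : R => ap_profile l.-1 x * ap_profile 1 x)|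
  <= 2 * n%:R * l%:R.
Proof.
move=> l3; have [n0|n0] := posnP n.
  rewrite -sum_ap_degree// n0 /riemann_sum big_geq// !mulr0 subr0 big1 ?normr0 ?mulr_ge0//.
  by move=> x; have := leq_ltn_trans (leq0n x) (ltn_ord x); lia.
have n0' : 0 < n%:R :> R by rewrite ltr0n.
rewrite -sum_ap_degree// /riemann_sum expr2 -mulrA mulVKf ?lt0r_neq0//.
rewrite big_mkord mulr_sumr -sumrB.
apply: le_trans (ler_norm_sum _ _ _) _.
have -> : 2 * n%:R * l%:R = \sum_(x < n) (2 * l%:R) :> R.
  by rewrite sumr_const card_ord -mulr_natl; ring.
apply: ler_sum => x _; rewrite ap_profile1 mulr1.
have d1 := @ap_degree_le R n l l3 x; have d2 := @ap_degree_ge R n l l3 x.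
by rewrite ler0_norm ?subr_le0//; lra.
Qed.

End ap_riemann_sums.

(** * Estimates for weighted connected triples *)

Section triples_bound.
Context {R : realType}.

Section scalar_bounds.
Variables (p L C dl r : R).
Hypotheses (p0 : 0 <= p) (p1 : p <= 1) (L1 : 1 <= L) (C1 : 1 <= C) (r0 : 0 <= r) (dl1 : dl <= 1).
Hypotheses (Lr : L ^+ 8 * r <= dl) (Lp : L ^+ 8 * p <= dl).

Let L0 : 0 <= L. Proof. exact: le_trans L1. Qed.
Let C0 : 0 <= C. Proof. exact: le_trans C1. Qed.
Let Li (i : nat) : 0 <= L ^+ i. Proof. exact: exprn_ge0. Qed.
Let d0 : 0 <= dl. Proof. by apply: le_trans Lr; exact: mulr_ge0. Qed.
Let CC : C * dl <= C ^+ 2 * dl.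
Proof. by apply: ler_wpM2r => //; rewrite expr2; exact: ler_peMl. Qed.

Let Lm (i : nat) (y : R) : (i <= 8)%N -> 0 <= y -> L ^+ 8 * y <= dl -> L ^+ i * y <= dl.
Proof.
by move=> i8 y0; apply: le_trans; apply: ler_wpM2r => //; exact: ler_weXn2l.
Qed.

Let Lv (i : nat) (v : R) : (i <= 8)%N -> v <= C * r -> L ^+ i * v <= C * dl.
Proof.
move=> i8 h; apply: (@le_trans _ _ (L ^+ i * (C * r))); first exact: ler_wpM2l.
by rewrite mulrCA; apply: ler_wpM2l => //; exact: Lm.
Qed.

(** In the application [x] is an inverse deviation, [E] a mean count, [tau = n p^(l-1)] and
    [r = (n p)^(-1/2)]. After expansion each monomial is a bounded factor times a small one; the
    exponent 8 comes from [L ^+ 4 * p * L ^+ 4]. The monomial [E x^3] carries no [L], so [x <= dl]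
    is enough for [x]. *)
Lemma diag_triple_bound (x E tau : R) :
  0 <= x -> 0 <= E -> 0 <= tau ->
  E * x ^+ 2 <= C -> tau * x <= C * r -> E * tau * x ^+ 2 <= C -> x <= dl ->
  x ^+ 3 * (2 * (E * (1 + (L * tau + L ^+ 4 * p)
                       + (L * tau + L ^+ 4 * p) * (2 * L * tau + 4 * L ^+ 4)))) <= 30 * C ^+ 2 * dl.
Proof.
move=> x0 E0 t0 h1 h2 h3 h4.
have x1 : x <= 1 by exact: le_trans dl1.
have : 0 <= E * x ^+ 2 by rewrite mulr_ge0 ?exprn_ge0.
have : 0 <= tau * x by rewrite mulr_ge0.
have : 0 <= E * tau * x ^+ 2 by rewrite !mulr_ge0 ?exprn_ge0.
have -> : x ^+ 3 * (2 * (E * (1 + (L * tau + L ^+ 4 * p)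
      + (L * tau + L ^+ 4 * p) * (2 * L * tau + 4 * L ^+ 4)))) =
   2 * (E * x ^+ 2 * x + E * x ^+ 2 * (L ^+ 1 * (tau * x)) + E * x ^+ 2 * (L ^+ 4 * p * x) +
     2 * (E * tau * x ^+ 2 * (L ^+ 2 * (tau * x))) + 4 * (E * x ^+ 2 * (L ^+ 5 * (tau * x)))
     + 2 * (p * (E * x ^+ 2 * (L ^+ 5 * (tau * x))))
     + 4 * (E * x ^+ 2 * (L ^+ 8 * p * x))) by ring.
move: (E * tau * x ^+ 2) (tau * x) (E * x ^+ 2) h3 h2 h1 => w v u h3 h2 h1 w0 v0 u0.
have LV i : (i <= 8)%N -> 0 <= L ^+ i * v /\ L ^+ i * v <= C * dl.
  by move=> i8; split; [exact: mulr_ge0|exact: Lv].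
have big (a : R) i : (i <= 8)%N -> 0 <= a -> a <= C -> a * (L ^+ i * v) <= C ^+ 2 * dl.
  by move=> i8 a0 aC; have [a1 a2] := LV i i8; rewrite expr2 -mulrA; exact: ler_pM.
have small (i : nat) : (i <= 8)%N -> u * (L ^+ i * p * x) <= C * dl.
  move=> i8; have a1 : 0 <= L ^+ i * p by exact: mulr_ge0.
  apply: ler_pM => //; first exact: mulr_ge0.
  by apply: le_trans (Lm i8 p0 Lp); exact: ler_piMr.
have t1 : u * x <= C * dl by exact: ler_pM.
have t2 := big u 1%N isT u0 h1.
have t3 := small 4%N isT.
have t4 := big w 2%N isT w0 h3.
have t5 := big u 5%N isT u0 h1.
have t6 : p * (u * (L ^+ 5 * v)) <= C ^+ 2 * dl.
  by apply: le_trans t5; apply: ler_piMl => //; apply: mulr_ge0 => //; case: (LV 5%N isT).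
have t7 := small 8%N isT.
rewrite -[leRHS]mulrA; move: t1 t2 t3 t4 t5 t6 t7 CC.
move: (u * x) (u * (L ^+ 1 * v)) (u * (L ^+ 4 * p * x)) (w * (L ^+ 2 * v)) (u * (L ^+ 5 * v))
  (p * _) (u * (L ^+ 8 * p * x)) (C * dl) (C ^+ 2 * dl).
move=> *; lra.
Qed.

(** The left side is 32 times a factor in [x1], at most [2 C], and a factor in [x2], at most
    [2 C dl]. The crude overlap power [L ^+ 8] falls on [x2] alone. *)
Lemma off_triple_bound12 (x1 x2 E tau1 tau2 : R) :
  0 <= x1 -> 0 <= x2 -> 0 <= E -> 0 <= tau1 -> 0 <= tau2 ->
  E * x1 ^+ 2 <= C -> E * tau1 * x1 ^+ 2 <= C -> tau2 * x2 <= C * r -> L ^+ 8 * x2 <= dl ->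
  x1 ^+ 2 * x2 * (2 * (E * (4 * L ^+ 4 * (tau1 + 1) * (4 * L ^+ 4 * (tau2 + 1))))) <= 128 * C ^+ 2 * dl.
Proof.
move=> x10 x20 E0 t10 t20 h1 h2 h3 h4.
have -> : x1 ^+ 2 * x2 * (2 * (E * (4 * L ^+ 4 * (tau1 + 1) * (4 * L ^+ 4 * (tau2 + 1))))) =
  32 * ((E * x1 ^+ 2 + E * tau1 * x1 ^+ 2) * (L ^+ 8 * (tau2 * x2) + L ^+ 8 * x2)) by ring.
have a0 : 0 <= E * x1 ^+ 2 + E * tau1 * x1 ^+ 2.
  by rewrite addr_ge0// !mulr_ge0// exprn_ge0.
have a1 : E * x1 ^+ 2 + E * tau1 * x1 ^+ 2 <= 2 * C by lra.
have b0 : 0 <= L ^+ 8 * (tau2 * x2) + L ^+ 8 * x2 by rewrite addr_ge0// !mulr_ge0.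
have b1 : L ^+ 8 * (tau2 * x2) + L ^+ 8 * x2 <= 2 * (C * dl).
  have e1 := Lv (leqnn 8) h3; have e2 : dl <= C * dl by exact: ler_peMl.
  by move: e1 e2 h4; move: (L ^+ 8 * _) (L ^+ 8 * x2) => *; lra.
have := ler_pM a0 b0 a1 b1; rewrite (_ : 2 * C * _ = 4 * (C ^+ 2 * dl)); last by ring.
rewrite -(mulrA 128); move: (_ * (L ^+ 8 * _ + _)) (C ^+ 2 * dl) => *; lra.
Qed.

(** After [(tau + 1)^2 <= 2 (tau^2 + 1)] two monomials remain, controlled by the mixed quantities
    [E * x1 * r] and [E * x1 * x2]. *)
Lemma off_triple_bound22 (x1 x2 E tau : R) :
  0 <= x1 -> 0 <= x2 -> 0 <= E -> 0 <= tau ->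
  E * x1 * r <= C -> E * x1 * x2 <= C -> tau * x2 <= C * r -> L ^+ 8 * x2 <= dl ->
  x1 * x2 ^+ 2 * (2 * (E * (4 * L ^+ 4 * (tau + 1) * (4 * L ^+ 4 * (tau + 1))))) <= 128 * C ^+ 3 * dl.
Proof.
move=> x10 x20 E0 t0 h1 h2 h3 h4.
have a1 : x1 * x2 ^+ 2 * (2 * (E * (4 * L ^+ 4 * (tau + 1) * (4 * L ^+ 4 * (tau + 1))))) <=
   64 * (E * x1 * (L ^+ 8 * (tau * x2) ^+ 2) + E * x1 * x2 * (L ^+ 8 * x2)).
  have -> : x1 * x2 ^+ 2 * (2 * (E * (4 * L ^+ 4 * (tau + 1) * (4 * L ^+ 4 * (tau + 1))))) =
   64 * (E * x1 * (L ^+ 8 * (tau * x2) ^+ 2) + E * x1 * x2 * (L ^+ 8 * x2))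
   - 32 * (E * x1 * x2 ^+ 2 * L ^+ 8 * (tau - 1) ^+ 2) by ring.
  rewrite gerBl; apply: mulr_ge0 => //; apply: mulr_ge0; last exact: sqr_ge0.
  by rewrite !mulr_ge0// exprn_ge0.
apply: le_trans a1 _.
have t1 : E * x1 * (L ^+ 8 * (tau * x2) ^+ 2) <= C ^+ 3 * dl.
  have v0 : 0 <= tau * x2 by exact: mulr_ge0.
  apply: (@le_trans _ _ (E * x1 * (L ^+ 8 * (C * r) ^+ 2))).
    rewrite ler_wpM2l ?mulr_ge0// ler_wpM2l// lerXn2r ?nnegrE//; exact: le_trans h3.
  rewrite (_ : E * x1 * _ = E * x1 * r * (C ^+ 2 * (L ^+ 8 * r))); last by ring.
  rewrite (_ : C ^+ 3 * dl = C * (C ^+ 2 * dl)); last by ring.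
  by apply: ler_pM => //; rewrite ?mulr_ge0 ?exprn_ge0// ler_wpM2l ?exprn_ge0.
have t2 : E * x1 * x2 * (L ^+ 8 * x2) <= C ^+ 3 * dl.
  apply: (@le_trans _ _ (C * dl)); first by apply: ler_pM => //; rewrite !mulr_ge0.
  by apply: le_trans CC _; apply: ler_wpM2r => //; exact: ler_weXn2l.
move: t1 t2; rewrite -(mulrA 128).
by move: (E * x1 * (L ^+ 8 * _)) (E * x1 * x2 * _) (C ^+ 3 * dl) => *; lra.
Qed.

End scalar_bounds.

(** Mixed triples are always explored from an [l1] progression, so only [ap_mean n p l1] enters the
    mixed hypotheses. The constant 1000 leaves room for [30 + 3 * 128 + 3 * 128 + 30]. *)
Lemma connected_triples_APs_le (n l1 l2 L : nat) (p s0 x1 x2 C dl r : R) (b : {set 'I_n} -> R) :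
  0 <= p <= 1 -> (2 < l1 <= L)%N -> (2 < l2 <= L)%N -> 0 <= s0 -> 0 <= x1 -> 0 <= x2 ->
  1 <= C -> 0 <= r -> dl <= 1 ->
  (forall a, `|b a| <= s0 * x1 * (a \in APs n l1)%:R + s0 * x2 * (a \in APs n l2)%:R) ->
  L%:R ^+ 8 * r <= dl -> L%:R ^+ 8 * p <= dl -> x1 <= dl -> L%:R ^+ 8 * x2 <= dl ->
  ap_mean n p l1 * x1 ^+ 2 <= C -> ap_mean n p l2 * x2 ^+ 2 <= C -> (n%:R * p ^+ l1.-1) * x1 <= C * r -> (n%:R * p ^+ l2.-1) * x2 <= C * r ->
  ap_mean n p l1 * (n%:R * p ^+ l1.-1) * x1 ^+ 2 <= C -> ap_mean n p l2 * (n%:R * p ^+ l2.-1) * x2 ^+ 2 <= C -> ap_mean n p l1 * x1 * r <= C -> ap_mean n p l1 * x1 * x2 <= C ->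
  connected_triples p b <= s0 ^+ 3 * (1000 * C ^+ 3 * dl).
Proof.
move=> p01 l1L l2L s00 x10 x20 C1 r0 dl1 hb Lr Lp x1d x2d.
move=> a1 a2 b1 b2 c1 c2 d1 d2.
have /andP[p0 p1] := p01.
have /andP[l13 l1L'] := l1L; have /andP[l23 l2L'] := l2L.
have L1 : 1 <= L%:R :> R by rewrite ler1n (leq_trans _ l1L')// (leq_trans _ l13).
have L0 : 0 <= L%:R :> R by [].
have E10 : 0 <= ap_mean n p l1 by rewrite mulr_ge0 ?exprn_ge0.
have E20 : 0 <= ap_mean n p l2 by rewrite mulr_ge0 ?exprn_ge0.
have t10 : 0 <= n%:R * p ^+ l1.-1 by rewrite mulr_ge0 ?exprn_ge0.
have t20 : 0 <= n%:R * p ^+ l2.-1 by rewrite mulr_ge0 ?exprn_ge0.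
have x2d' : x2 <= dl.
  by apply: le_trans x2d; rewrite ler_peMl// exprn_ege1.
have obE l : overlap_bound n p l L <= 4 * L%:R ^+ 4 * (n%:R * p ^+ l.-1 + 1).
  rewrite /overlap_bound mulrDr mulr1 lerD2r ler_wpM2r ?mulr_ge0 ?exprn_ge0//.
  have : L%:R <= L%:R ^+ 4 :> R by rewrite -[leLHS]expr1 ler_weXn2l.
  by move: (L%:R ^+ 4) L0 L1 => y; move: L%:R => *; lra.
have two (y : R) : 2 * y = y + y by ring.
have diag l : (2 < l <= L)%N -> triple_sum p (APs n l) (APs n l) (APs n l) <=
    2 * (ap_mean n p l * (1 + (L%:R * (n%:R * p ^+ l.-1) + L%:R ^+ 4 * p)
      + (L%:R * (n%:R * p ^+ l.-1) + L%:R ^+ 4 * p) * (2 * L%:R * (n%:R * p ^+ l.-1) + 4 * L%:R ^+ 4))).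
  move=> /andP[l3 lL]; apply: le_trans (triple_sum_le_chain p01 _ _ _) _.
  have lR : l%:R <= L%:R :> R by rewrite ler_nat.
  have t0 : 0 <= n%:R * p ^+ l.-1 by rewrite mulr_ge0 ?exprn_ge0.
  have s1 : strict_overlap_bound n p l <= L%:R * (n%:R * p ^+ l.-1) + L%:R ^+ 4 * p.
    by apply: lerD; rewrite ler_wpM2r// lerXn2r ?nnegrE.
  have s2 : overlap_bound n p l l <= 2 * L%:R * (n%:R * p ^+ l.-1) + 4 * L%:R ^+ 4.
    by apply: lerD; rewrite ?ler_wpM2r// ler_wpM2l// lerXn2r ?nnegrE.
  have s0' : 0 <= strict_overlap_bound n p l by rewrite addr_ge0 ?mulr_ge0 ?exprn_ge0.
  have D := @chain_sum_APs_diag_le R n p p01 l l3.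
  rewrite two; apply: lerD; apply: (le_trans D);
  (apply: ler_wpM2l; [by rewrite mulr_ge0 ?exprn_ge0|]);
  (apply: lerD; [by rewrite lerD2l|apply: ler_pM => //; exact: overlap_bound_ge0]).
have off l l' : (2 < l <= L)%N -> (2 < l' <= L)%N ->
    chain_sum p (APs n l1) (APs n l) (APs n l') <=
    ap_mean n p l1 * (4 * L%:R ^+ 4 * (n%:R * p ^+ l.-1 + 1) * (4 * L%:R ^+ 4 * (n%:R * p ^+ l'.-1 + 1))).
  move=> lL l'L; apply: le_trans (@chain_sum_APs_le R n p p01 l1 l l' L l1L lL l'L) _.
  by rewrite ler_wpM2l// ler_pM ?overlap_bound_ge0.
apply: le_trans (connected_triples_le p01 (mulr_ge0 s00 x10) (mulr_ge0 s00 x20) hb) _.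
have T111 := le_trans (ler_wpM2l (exprn_ge0 3 x10) (diag _ l1L))
  (diag_triple_bound p0 p1 L1 C1 r0 dl1 Lr Lp x10 E10 t10 a1 b1 c1 x1d).
have T222 := le_trans (ler_wpM2l (exprn_ge0 3 x20) (diag _ l2L))
  (diag_triple_bound p0 p1 L1 C1 r0 dl1 Lr Lp x20 E20 t20 a2 b2 c2 x2d').
have T112 : x1 ^+ 2 * x2 * triple_sum p (APs n l1) (APs n l1) (APs n l2) <= 128 * C ^+ 2 * dl.
  apply: le_trans (off_triple_bound12 L1 C1 r0 Lr x10 x20 E10 t10 t20 a1 c1 b2 x2d).
  rewrite ler_wpM2l ?mulr_ge0 ?exprn_ge0//; apply: le_trans (triple_sum_le_chain p01 _ _ _) _.
  rewrite two; apply: lerD; first exact: off.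
  by apply: le_trans (off _ _ l2L l1L) _; rewrite [X in _ * X]mulrC.
have T122 : x1 * x2 ^+ 2 * triple_sum p (APs n l1) (APs n l2) (APs n l2) <= 128 * C ^+ 3 * dl.
  apply: le_trans (off_triple_bound22 L1 C1 r0 Lr x10 x20 E10 t20 d1 d2 b2 x2d).
  rewrite ler_wpM2l ?mulr_ge0 ?exprn_ge0//; apply: le_trans (triple_sum_le_chain p01 _ _ _) _.
  by rewrite two; apply: lerD; exact: off.
have d0 : 0 <= dl by exact: le_trans x1d.
have CC : C ^+ 2 * dl <= C ^+ 3 * dl by rewrite ler_wpM2r// ler_weXn2l.
rewrite (_ : _ + _ = s0 ^+ 3 * (x1 ^+ 3 * triple_sum p (APs n l1) (APs n l1) (APs n l1)
  + 3 * (x1 ^+ 2 * x2 * triple_sum p (APs n l1) (APs n l1) (APs n l2))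
  + 3 * (x1 * x2 ^+ 2 * triple_sum p (APs n l1) (APs n l2) (APs n l2))
  + x2 ^+ 3 * triple_sum p (APs n l2) (APs n l2) (APs n l2))); last by ring.
rewrite ler_wpM2l ?exprn_ge0//; have d3 : 0 <= C ^+ 3 * dl by rewrite mulr_ge0 ?exprn_ge0// (le_trans _ C1).
move: T111 T112 T122 T222 CC d3.
rewrite -!mulrA.
move: (x1 * (x1 * (x1 * _))) => u1; move: (x1 * (x1 * (x2 * _))) => u2.
move: (x1 * (x2 * (x2 * _))) => u3; move: (x2 * (x2 * (x2 * _))) => u4.
move: (C * (C * (C * dl))) => u5; move: (C * (C * dl)) => u6; lra.
Qed.

End triples_bound.

(** * Asymptotics *)

Section inverse_deviation.
Context {R : realType}.

Lemma sqrtV_sqr (x : R) : 0 < x -> (Num.sqrt x)^-1 ^+ 2 = x^-1.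
Proof. by move=> x0; rewrite exprVn sqr_sqrtr// ltW. Qed.

(** The bounds follow from [E <= V / c] and [nu tau^2 <= V / c]; the last two first trade [E] for
    [A nu tau], which supplies the missing factor [tau]. *)
Lemma inv_deviation_bounds (c A nu tau E V : R) : 0 < c -> c <= 1 -> 1 <= A -> 0 < nu -> 0 <= tau -> 0 < E ->
  c * (nu * tau ^+ 2 + E) <= V -> E <= A * (nu * tau) ->
  let x := (Num.sqrt V)^-1 in let r := (Num.sqrt nu)^-1 in
  [/\ 0 < V, E * x ^+ 2 <= A / c, tau * x <= A / c * r, E * tau * x ^+ 2 <= A / c
    & E * x * r <= A / c].
Proof.
move=> c0 c1 A1 nu0 t0 E0 hV hE x r.
have A0 : 0 < A by exact: lt_le_trans A1.
have nt0 : 0 <= nu * tau ^+ 2 by rewrite mulr_ge0 ?exprn_ge0// ltW.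
have V0 : 0 < V by apply: lt_le_trans hV; rewrite mulr_gt0// ltr_wpDl.
have h1 : E <= V / c by rewrite ler_pdivlMr// mulrC (le_trans _ hV)// ler_pM2l// lerDr.
have h2 : nu * tau ^+ 2 <= V / c.
  by rewrite ler_pdivlMr// mulrC (le_trans _ hV)// ler_pM2l// lerDl ltW.
have cA : c^-1 <= A / c by rewrite ler_peMl// invr_ge0 ltW.
have x2 : x ^+ 2 = V^-1 by exact: sqrtV_sqr.
have r2 : r ^+ 2 = nu^-1 by exact: sqrtV_sqr.
have x0 : 0 <= x by rewrite invr_ge0 sqrtr_ge0.
have r0 : 0 <= r by rewrite invr_ge0 sqrtr_ge0.
have Ac1 : 1 <= A / c by rewrite ler_pdivlMr// mul1r (le_trans c1).
have tx : tau * x <= c^-1 * r.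
  rewrite -ler_sqr ?nnegrE ?mulr_ge0 ?invr_ge0 ?(ltW c0)// !exprMn x2 r2.
  apply: (@le_trans _ _ (c^-1 / nu)); last first.
    by rewrite ler_wpM2r ?invr_ge0 ?(ltW nu0)// expr2 ler_peMl ?invr_ge0 ?(ltW c0)// invf_ge1.
  rewrite ler_pdivrMr// (_ : c^-1 / nu * V = V / c / nu); last by ring.
  by rewrite ler_pdivlMr// mulrC.
split => //.
- by rewrite x2 ler_pdivrMr//; apply: le_trans h1 _; rewrite mulrC ler_wpM2r// ltW.
- by apply: le_trans tx _; rewrite ler_wpM2r.
- rewrite x2 ler_pdivrMr// (le_trans (ler_wpM2r t0 hE))// -!mulrA ler_wpM2l ?(ltW A0)//.
  by rewrite -expr2 (le_trans h2)// mulrC.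
- apply: (@le_trans _ _ (A * (nu * tau) * x * r)); first by rewrite !ler_wpM2r.
  rewrite (_ : _ * r = A * (nu * r * (tau * x))); last by ring.
  rewrite ler_wpM2l ?(ltW A0)//; apply: (@le_trans _ _ (nu * r * (c^-1 * r))).
    by rewrite ler_wpM2l// mulr_ge0// ltW.
  rewrite (_ : _ * (_ * r) = c^-1 * (nu * r ^+ 2)); last by ring.
  by rewrite r2 mulfV ?mulr1 ?lt0r_neq0.
Qed.

(** [E1 ^+ 2 <= E1 * (B * E2)], and each mean is at most its variance over [c]. The squared form
    keeps [B] linear, for later use with [B] proportional to [p]. *)
Lemma inv_deviation_cross_sqr (c B E1 E2 V1 V2 : R) : 0 < c -> 0 <= B -> 0 < E1 -> 0 < E2 ->
  c * E1 <= V1 -> c * E2 <= V2 -> E1 <= B * E2 ->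
  (E1 * (Num.sqrt V1)^-1 * (Num.sqrt V2)^-1) ^+ 2 <= B / c ^+ 2.
Proof.
move=> c0 B0 E10 E20 hV1 hV2 hE.
have V10 : 0 < V1 by apply: lt_le_trans hV1; rewrite mulr_gt0.
have V20 : 0 < V2 by apply: lt_le_trans hV2; rewrite mulr_gt0.
rewrite !exprMn !sqrtV_sqr// ler_pdivrMr// ler_pdivrMr//.
have -> : B / c ^+ 2 * V2 * V1 = B * (V2 / c) * (V1 / c) by field; rewrite lt0r_neq0.
have e1 : E1 <= V1 / c by rewrite ler_pdivlMr// mulrC.
have e2 : E2 <= V2 / c by rewrite ler_pdivlMr// mulrC.
rewrite expr2; apply: ler_pM => //; try exact: ltW.
by apply: le_trans hE _; rewrite ler_wpM2l.
Qed.

Lemma inv_deviation_cross (c A E1 E2 V1 V2 : R) : 0 < c -> 1 <= A -> 0 < E1 -> 0 < E2 ->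
  c * E1 <= V1 -> c * E2 <= V2 -> E1 <= A * E2 ->
  E1 * (Num.sqrt V1)^-1 * (Num.sqrt V2)^-1 <= A / c.
Proof.
move=> c0 A1 E10 E20 hV1 hV2 hE.
have A0 : 0 <= A by exact: le_trans A1.
rewrite -ler_sqr ?nnegrE ?divr_ge0 ?mulr_ge0 ?invr_ge0 ?sqrtr_ge0 ?(ltW c0) ?(ltW E10)//.
apply: le_trans (inv_deviation_cross_sqr c0 A0 E10 E20 hV1 hV2 hE) _.
by rewrite exprMn exprVn ler_wpM2r ?invr_ge0 ?exprn_ge0 ?(ltW c0)// expr2 ler_peMl.
Qed.

End inverse_deviation.

Record ap_regime (R : realType) (l1 l2 : nat -> nat) (p : nat -> R) : Prop := APRegime {
  regime_l2_ge3 : \forall n \near \oo, (2 < l2 n)%N;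
  regime_l12 : \forall n \near \oo, (l2 n < l1 n)%N;
  regime_settles1 : settles l1;
  regime_settles2 : settles l2;
  regime_p01 : \forall n \near \oo, 0 < p n < 1;
  regime_p_small : p n * (l1 n)%:R ^+ 9 @[n --> \oo] --> (0 : R);
  regime_np_large : n%:R ^+ 2 * p n ^+ l1 n * (l1 n)%:R ^- 9 @[n --> \oo] --> +oo }.

Section asymptotics.
Context {R : realType} (l1 l2 : nat -> nat) (p : nat -> R).
Hypothesis rg : ap_regime l1 l2 p.
Implicit Types (l k : nat -> nat) (n : nat).

(** [nu] is the mean size of the random set and [tau l] the order of the weight of the progressions
    through a point already present. [theta], which is [tau] times the length, compares the two
    contributions to the variance, of orders [nu tau^2] and [nu tau / l]. *)
Local Notation nu n := (n%:R * p n).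
Local Notation tau l n := (n%:R * p n ^+ (l n).-1).
Local Notation theta l n := (n%:R * p n ^+ (l n).-1 * (l n)%:R).
Local Notation mean l n := (ap_mean n (p n) (l n)).
Local Notation var l n := (ap_cov n (p n) (l n) (l n)).
Local Notation mean_bounds M l n := ([/\ 0 < mean l n,
  M * (n%:R ^+ 2 * p n ^+ l n / (l n)%:R) <= mean l n,
  mean l n <= 4 * M * (n%:R ^+ 2 * p n ^+ l n / (l n)%:R)
  & mean l n <= 4 * M * (nu n * tau l n)]).
Local Notation var_bounds c A l n := (c * (nu n * tau l n ^+ 2 + mean l n) <= var l n /\
  mean l n <= A * (nu n * tau l n)).
Local Notation variance_bounds c A n := ([/\ 0 < mean l1 n, 0 < mean l2 n,
  mean l1 n <= A * mean l2 n, var_bounds c A l1 n & var_bounds c A l2 n]).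

Let l2_ge3 := regime_l2_ge3 rg.
Let l12 := regime_l12 rg.
Let settles1 := regime_settles1 rg.
Let settles2 := regime_settles2 rg.
Let p01 := regime_p01 rg.
Let p_small := regime_p_small rg.
Let np_large := regime_np_large rg.

Local Notation in_range n := ([/\ (0 < n)%N, 0 < p n < 1, (2 < l2 n)%N, (l2 n < l1 n)%N
  & 1 <= n%:R * p n ^+ 2 :> R]).

(** The last bound comes from [l1 >= 4]: eventually [1 <= n^2 p^l1 <= (n p^2)^2]. *)
Lemma near_ranges : \forall n \near \oo, in_range n.
Proof.
have h1 : \forall n \near \oo, 1 <= n%:R ^+ 2 * p n ^+ l1 n * (l1 n)%:R ^- 9
  by exact: (cvgry_ge np_large).
near=> n.
have n0 : (0 < n)%N by near: n; exact: nbhs_infty_gt.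
have pn : 0 < p n < 1 by near: n.
have l3 : (2 < l2 n)%N by near: n.
have ll : (l2 n < l1 n)%N by near: n.
have e1 : 1 <= n%:R ^+ 2 * p n ^+ l1 n * (l1 n)%:R ^- 9 by near: n.
split => //; have /andP[p0 p1] := pn.
have L1 : 1 <= (l1 n)%:R ^+ 9 :> R.
  by rewrite exprn_ege1// ler1n; lia.
have e2 : 1 <= n%:R ^+ 2 * p n ^+ l1 n.
  by move: e1; rewrite ler_pdivlMr ?mul1r ?(lt_le_trans _ L1)//; apply: le_trans.
have e3 : p n ^+ l1 n <= p n ^+ 4 by apply: ler_wiXn2l; [exact: ltW|exact: ltW|lia].
have e4 : 1 <= (n%:R * p n ^+ 2) ^+ 2.
  by rewrite exprMn -exprM (le_trans e2)// ler_wpM2l// exprn_ge0.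
by rewrite -(@ler_sqr R) ?nnegrE ?mulr_ge0 ?exprn_ge0 ?(ltW p0)// expr1n.
Unshelve. all: by end_near. Qed.

Lemma power_p_cvg0 (i : nat) : (i <= 9)%N -> (l1 n)%:R ^+ i * p n @[n --> \oo] --> (0 : R).
Proof.
move=> i9; apply: (@squeeze_cvgr _ _ _ _ (fun=> 0) (fun n => p n * (l1 n)%:R ^+ 9)) => //.
  near=> n; have [_ /andP[p0 p1] l3 ll _] : in_range n by near: n; exact: near_ranges.
  rewrite mulr_ge0 ?exprn_ge0 ?(ltW p0)//= mulrC ler_wpM2l ?(ltW p0)// ler_weXn2l// ler1n; lia.
exact: cvg_cst.
Unshelve. all: by end_near. Qed.

Lemma length_over_n_cvg0 : (l1 n)%:R / n%:R @[n --> \oo] --> (0 : R).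
Proof.
apply: (@squeeze_cvgr _ _ _ _ (fun=> 0) (fun n => (l1 n)%:R ^+ 1 * p n)); last exact: power_p_cvg0.
  near=> n; have [n0 /andP[p0 p1] l3 ll np2] : in_range n by near: n; exact: near_ranges.
  rewrite divr_ge0//= expr1 ler_pdivrMr ?ltr0n// -mulrA ler_peMr// mulrC (le_trans np2)//.
  by rewrite ler_wpM2l// -[leRHS]expr1 ler_wiXn2l// ltW.
exact: cvg_cst.
Unshelve. all: by end_near. Qed.

(** The exponent is 16 because [l1 ^ 8] will multiply the inverse square root of [nu]. For constant
    [l1], [n p^2 >= 1] gives [1 / nu <= p]. Otherwise eventually [l1 >= 8], so [n p^4 >= 1] and
    [1 / nu <= p^3], while [l1^16 p^3 <= (l1^9 p)^3]. *)
Lemma inv_nu_cvg0 : (l1 n)%:R ^+ 16 / nu n @[n --> \oo] --> (0 : R).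
Proof.
have rng := near_ranges.
case: settles1 => [[c lc]|ll1].
  apply: (@squeeze_cvgr _ _ _ _ (fun=> 0) (fun n => c%:R ^+ 16 * ((l1 n)%:R ^+ 0 * p n))).
  - near=> n; have [n0 /andP[p0 p1] l3 ll np2] : in_range n by near: n.
    rewrite divr_ge0 ?exprn_ge0 ?mulr_ge0 ?(ltW p0)//= expr0 mul1r (near lc n)//.
    rewrite ler_pdivrMr ?mulr_gt0 ?ltr0n// -mulrA ler_peMr ?exprn_ge0//.
    by rewrite mulrCA -expr2.
  - exact: cvg_cst.
  - by rewrite -[X in _ --> X](mulr0 (c%:R ^+ 16 : R)); apply: cvgMr; exact: power_p_cvg0.
have h1 : \forall n \near \oo, 1 <= n%:R ^+ 2 * p n ^+ l1 n * (l1 n)%:R ^- 9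
  by exact: (cvgry_ge np_large).
have h8 : \forall n \near \oo, (8 <= l1 n)%N by exact: (ll1 _ (nbhs_infty_ge 8)).
have h9 : \forall n \near \oo, `|(l1 n)%:R ^+ 9 * p n| <= 1.
  by have h := @power_p_cvg0 9 isT; exact: (cvgr0_norm_le _ h 1 ltr01).
apply: (@squeeze_cvgr _ _ _ _ (fun=> 0) (fun n => (l1 n)%:R ^+ 9 * p n)); last exact: power_p_cvg0.
  near=> n; have [n0 /andP[p0 p1] l3 ll np2] : in_range n by near: n.
  have e1 : 1 <= n%:R ^+ 2 * p n ^+ l1 n * (l1 n)%:R ^- 9 by near: n.
  have e8 : (8 <= l1 n)%N by near: n.
  have e9 : `|(l1 n)%:R ^+ 9 * p n| <= 1 by near: n.
  have L1 : 1 <= (l1 n)%:R :> R by rewrite ler1n; lia.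
  have L91 : 1 <= (l1 n)%:R ^+ 9 :> R by rewrite exprn_ege1.
  have L0 i : 0 <= (l1 n)%:R ^+ i :> R by rewrite exprn_ge0.
  have e2 : 1 <= n%:R ^+ 2 * p n ^+ l1 n.
    by move: e1; rewrite ler_pdivlMr ?mul1r ?(lt_le_trans _ L91)//; apply: le_trans.
  have e3 : p n ^+ l1 n <= p n ^+ 8 by apply: ler_wiXn2l; [exact: ltW|exact: ltW|exact: e8].
  have e4 : 1 <= (n%:R * p n ^+ 4) ^+ 2.
    by rewrite exprMn -exprM (le_trans e2)// ler_wpM2l// exprn_ge0.
  have e5 : 1 <= n%:R * p n ^+ 4.
    by rewrite -(@ler_sqr R) ?nnegrE ?mulr_ge0 ?exprn_ge0 ?(ltW p0)// expr1n.
  have q0 : 0 <= (l1 n)%:R ^+ 9 * p n by rewrite mulr_ge0 ?(ltW p0).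
  rewrite divr_ge0 ?exprn_ge0 ?mulr_ge0 ?(ltW p0)//= ler_pdivrMr ?mulr_gt0 ?ltr0n//.
  rewrite ger0_norm// in e9.
  have e6 : ((l1 n)%:R ^+ 9 * p n) ^+ 3 <= (l1 n)%:R ^+ 9 * p n.
    by rewrite exprS ler_piMr// exprn_ile1.
  have e7 : (l1 n)%:R ^+ 16 * p n ^+ 3 <= (l1 n)%:R ^+ 9 * p n.
    apply: le_trans e6; rewrite exprMn -exprM ler_wpM2r ?exprn_ge0 ?(ltW p0)//.
    exact: ler_weXn2l.
  apply: (@le_trans _ _ ((l1 n)%:R ^+ 16 * (n%:R * p n ^+ 4))); first by rewrite ler_peMr.
  rewrite (_ : _ * (n%:R * _) = (l1 n)%:R ^+ 16 * p n ^+ 3 * (n%:R * p n)); last by ring.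
  by rewrite ler_wpM2r// mulr_ge0// ltW.
exact: cvg_cst.
Unshelve. all: by end_near. Qed.

Definition ap_density l n : R := #|APs n (l n)|%:R * (l n)%:R / n%:R ^+ 2.

Definition incidence_density l l' n : R := ap_incidence n (l n) (l' n) / n%:R ^+ 3.

Lemma settles_pred (l : nat -> nat) : settles l -> settles (fun n => (l n).-1).
Proof.
case=> [[c lc]|ll]; [left|right].
  by exists c.-1; apply: filterS lc => n ->.
move=> A [N _ hN]; suff : \forall n \near \oo, A (l n).-1 by [].
have h : \forall n \near \oo, (N.+1 <= l n)%N by exact: (ll _ (nbhs_infty_ge N.+1)).
by apply: filterS h => n h; apply: hN => /=; lia.
Qed.

Lemma cvg0_close (f g h : nat -> R) (a : R) : (\forall n \near \oo, `|f n - g n| <= h n) ->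
  h @ \oo --> (0 : R) -> g @ \oo --> a -> f @ \oo --> a.
Proof.
move=> fgh h0 ga.
have -> : f = (fun n => (f n - g n) + g n) by apply/funext => n; rewrite subrK.
rewrite -(add0r a); apply: cvgD => //; apply/norm_cvg0P.
by apply: (@squeeze_cvgr _ _ _ _ (fun=> 0) h) => //; [near=> n; rewrite normr_ge0/=; near: n|exact: cvg_cst].
Unshelve. all: by end_near. Qed.

Lemma ap_density_cvg l : settles l -> (\forall n \near \oo, (2 < l n <= l1 n)%N) ->
  exists2 M : R, 0 < M & ap_density l @ \oo --> M.
Proof.
move=> sl ll.
have s1 : settles (fun=> 1%N) by left; exists 1%N; near=> n.
have [||M M0 hM] := @riemann_profile_lim R _ _ (settles_pred sl) s1.
- by near=> n; have : (2 < l n <= l1 n)%N by [near: n]; lia.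
- by near=> n.
exists M => //.
apply: (cvg0_close (h := fun n => 2 * ((l1 n)%:R / n%:R))) hM; last first.
  by rewrite -(mulr0 (2 : R)); apply: cvgMr; exact: length_over_n_cvg0.
near=> n; have n0 : (0 < n)%N by near: n; exact: nbhs_infty_gt.
have /andP[l3 lL] : (2 < l n <= l1 n)%N by near: n.
have n0' : 0 < n%:R :> R by rewrite ltr0n.
have := @ap_count_riemann R n (l n) l3; rewrite /ap_density.
set S := riemann_sum _ _; set N := _ * _ => h.
rewrite (_ : N / _ - S = (N - n%:R ^+ 2 * S) / n%:R ^+ 2); last by field; rewrite lt0r_neq0.
rewrite normrM (ger0_norm (_ : 0 <= (n%:R ^+ 2)^-1)) ?invr_ge0 ?exprn_ge0//.
rewrite ler_pdivrMr ?exprn_gt0//; apply: le_trans h _.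
rewrite (_ : _ * n%:R ^+ 2 = 2 * n%:R * (l1 n)%:R); last by field; rewrite lt0r_neq0.
by rewrite ler_wpM2l ?mulr_ge0// ler_nat.
Unshelve. all: by end_near. Qed.

Lemma incidence_density_close l l' : (\forall n \near \oo, (2 < l n <= l1 n)%N) ->
  (\forall n \near \oo, (2 < l' n <= l1 n)%N) -> forall J : R,
  riemann_sum n (fun x => ap_profile (l n).-1 x * ap_profile (l' n).-1 x) @[n --> \oo] --> J ->
  incidence_density l l' @ \oo --> J.
Proof.
move=> ll ll' J hJ.
apply: (cvg0_close (h := fun n => 4 * ((l1 n)%:R / n%:R))) hJ; last first.
  by rewrite -(mulr0 (4 : R)); apply: cvgMr; exact: length_over_n_cvg0.
near=> n; have n0 : (0 < n)%N by near: n; exact: nbhs_infty_gt.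
have /andP[l3 lL] : (2 < l n <= l1 n)%N by near: n.
have /andP[l3' lL'] : (2 < l' n <= l1 n)%N by near: n.
have n0' : 0 < n%:R :> R by rewrite ltr0n.
have := @ap_incidence_riemann R n (l n) (l' n) l3 l3'; rewrite /incidence_density.
set S := riemann_sum _ _; set N := ap_incidence _ _ _ => h.
rewrite (_ : N / _ - S = (N - n%:R ^+ 3 * S) / n%:R ^+ 3); last by field; rewrite lt0r_neq0.
rewrite normrM (ger0_norm (_ : 0 <= (n%:R ^+ 3)^-1)) ?invr_ge0 ?exprn_ge0//.
rewrite ler_pdivrMr ?exprn_gt0//; apply: le_trans h _.
rewrite (_ : _ * n%:R ^+ 3 = 2 * n%:R ^+ 2 * (2 * (l1 n)%:R)); last by field; rewrite lt0r_neq0.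
rewrite ler_wpM2l ?mulr_ge0 ?exprn_ge0// mulr_natl mulr2n.
by rewrite lerD// ler_nat.
Unshelve. all: by end_near. Qed.

Lemma ap_mean_tau l n : (0 < n)%N -> (0 < l n)%N ->
  mean l n = ap_density l n * (nu n * tau l n) / (l n)%:R.
Proof.
move=> n0 l0; rewrite /ap_mean /ap_density -{2}(prednK l0) exprS; field.
by rewrite !pnatr_eq0 -!lt0n n0 l0.
Qed.

Lemma ap_cov_tau l l' n : (0 < n)%N -> (0 < l n)%N -> (0 < l' n)%N ->
  ap_cov n (p n) (l n) (l' n) = nu n * tau l n * tau l' n * ((1 - p n) * incidence_density l l' n)
    + ap_cov_rest n (p n) (l n) (l' n).
Proof.
move=> n0 l0 l0'; rewrite /ap_cov_rest /incidence_density.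
rewrite (_ : (l n + l' n).-1 = ((l n).-1 + (l' n).-1).+1); last by lia.
by rewrite (exprS (p n)) (exprD (p n)); field; rewrite pnatr_eq0 -lt0n.
Qed.

Lemma sqr_cvg0 (f : nat -> R) : (\forall n \near \oo, 0 <= f n) ->
  f n ^+ 2 @[n --> \oo] --> (0 : R) -> f @ \oo --> (0 : R).
Proof.
move=> f0 f2; apply: (@cvg_trans _ (Num.sqrt (f n ^+ 2) @[n --> \oo])).
  apply: near_eq_cvg; near=> n; rewrite sqrtr_sqr ger0_norm//; near: n; exact: f0.
by have := cvg_comp _ _ f2 (@sqrt_continuous R 0); rewrite sqrtr0; apply.
Unshelve. all: by end_near. Qed.

Lemma density_bounds l : settles l -> (\forall n \near \oo, (2 < l n <= l1 n)%N) ->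
  exists2 M : R, 0 < M & \forall n \near \oo, M <= ap_density l n <= 4 * M.
Proof.
move=> sl ll; have [M M0 hM] := ap_density_cvg sl ll.
exists (M / 2); first by rewrite divr_gt0.
near=> n; apply/andP; split.
  near: n; apply: (cvgr_ge _ hM); lra.
near: n; apply: (cvgr_le _ hM); lra.
Unshelve. all: by end_near. Qed.

(** The incidence part keeps [J / 4] (half for [1 - p], half for the approach to the limit), and the
    rest keeps half of the mean once [l1^4 p <= 1/2]. *)
Lemma ap_cov_lower l : settles l -> (\forall n \near \oo, (2 < l n <= l1 n)%N) ->
  exists2 c : R, 0 < c <= 1 & \forall n \near \oo,
    c * (nu n * tau l n ^+ 2 + mean l n) <= var l n.
Proof.
move=> sl ll.
have l0 : \forall n \near \oo, (0 < (l n).-1)%N by apply: filterS ll => n; lia.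
have [J J0 hJ] := @riemann_profile_lim R _ _ (settles_pred sl) (settles_pred sl) l0 l0.
have hJn := incidence_density_close ll ll hJ.
exists (Num.min (J / 4) 2^-1).
  by rewrite lt_min divr_gt0//= invr_gt0 ltr0n/= ge_min; apply/orP; right; lra.
have hp4 := @power_p_cvg0 4 isT; have hp0 := @power_p_cvg0 0 isT.
near=> n.
have [n0 /andP[p0 p1] l3 ll' np2] : in_range n by near: n; exact: near_ranges.
have /andP[ln3 lL] : (2 < l n <= l1 n)%N by near: n.
have p12 : `|(l1 n)%:R ^+ 0 * p n| <= 2^-1.
  by near: n; apply: (cvgr0_norm_le _ hp0); rewrite invr_gt0.
have lp : `|(l1 n)%:R ^+ 4 * p n| <= 2^-1.
  by near: n; apply: (cvgr0_norm_le _ hp4); rewrite invr_gt0.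
have J2 : J / 2 <= incidence_density l l n by near: n; apply: (cvgr_ge _ hJn); lra.
rewrite expr0 mul1r gtr0_norm// in p12.
rewrite ger0_norm ?mulr_ge0 ?exprn_ge0 ?(ltW p0)// in lp.
have pp : 0 <= p n <= 1 by rewrite !ltW.
have := @ap_cov_rest_diag_le R n (p n) pp (l n) ln3; rewrite ler_norml => /andP[+ _].
have E0 : 0 <= mean l n by rewrite mulr_ge0 ?exprn_ge0 ?(ltW p0).
have lp' : (l n)%:R ^+ 4 * p n <= 2^-1.
  by apply: le_trans lp; rewrite ler_wpM2r ?(ltW p0)// lerXn2r ?nnegrE// ler_nat.
have h1 : mean l n * ((l n)%:R ^+ 4 * p n) <= mean l n * 2^-1.
  by rewrite ler_wpM2l.
have l0n : (0 < l n)%N by exact: leq_trans ln3.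
rewrite ap_cov_tau//.
set A := nu n * _ ^+ 2; have A0 : 0 <= A.
  by apply: mulr_ge0; [apply: mulr_ge0 => //; exact: ltW|exact: sqr_ge0].
rewrite (_ : nu n * tau l n * tau l n = A); last by rewrite /A; ring.
have h2 : A * (J / 4) <= A * ((1 - p n) * incidence_density l l n).
  rewrite ler_wpM2l//; apply: (@le_trans _ _ (2^-1 * (J / 2))); first lra.
  by apply: ler_pM => //; lra.
have h3 : Num.min (J / 4) 2^-1 * A <= A * (J / 4) by rewrite mulrC ler_wpM2l// ge_min lexx.
have h4 : Num.min (J / 4) 2^-1 * mean l n <= mean l n * 2^-1.
  by rewrite mulrC ler_wpM2l// ge_min lexx orbT.
move: h1 h2 h3 h4; rewrite mulrDr; clearbody A.
move: (Num.min _ _ * A) => u1; move: (Num.min _ _ * _) => u2.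
move: (ap_mean _ _ _ * (_ * _)) (A * (_ * _)) => u3 u4; move: (A * _) (ap_cov_rest _ _ _ _) => u5 u6.
by move=> *; lra.
Unshelve. all: by end_near. Qed.

Lemma ap_mean_large l : settles l -> (\forall n \near \oo, (2 < l n <= l1 n)%N) ->
  exists2 M : R, 0 < M & \forall n \near \oo,
    mean_bounds M l n.
Proof.
move=> sl ll; have [M M0 hM] := density_bounds sl ll; exists M => //; near=> n.
have [n0 /andP[p0 p1] l3 ll' np2] : in_range n by near: n; exact: near_ranges.
have /andP[ln3 lL] : (2 < l n <= l1 n)%N by near: n.
have /andP[h1 h2] : M <= ap_density l n <= 4 * M by near: n.
have l0 : (0 < l n)%N by exact: leq_trans ln3.
have l0' : 1 <= (l n)%:R :> R by rewrite ler1n.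
have E : mean l n = ap_density l n * (n%:R ^+ 2 * p n ^+ l n / (l n)%:R).
  by rewrite /ap_mean /ap_density; field; rewrite !pnatr_eq0 -!lt0n n0 l0.
have Q : 0 < n%:R ^+ 2 * p n ^+ l n / (l n)%:R.
  by rewrite divr_gt0 ?mulr_gt0 ?exprn_gt0 ?ltr0n.
rewrite E; split.
- by rewrite mulr_gt0// (lt_le_trans M0).
- by rewrite ler_pM2r.
- by rewrite ler_pM2r.
- apply: ler_pM => //; first by exact: le_trans (ltW M0) h1.
    exact: ltW.
  rewrite (_ : nu n * tau l n = n%:R ^+ 2 * p n ^+ l n).
    by rewrite ler_pdivrMr ?ltr0n// ler_peMr// mulr_ge0 ?exprn_ge0 ?(ltW p0).
  have -> : p n ^+ l n = p n * p n ^+ (l n).-1 by rewrite -exprS prednK.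
  by ring.
Unshelve. all: by end_near. Qed.

Lemma regime_lengths : (\forall n \near \oo, (2 < l1 n <= l1 n)%N) /\
  (\forall n \near \oo, (2 < l2 n <= l1 n)%N).
Proof.
by split; apply: filterS2 l2_ge3 l12 => n h1 h2;
  rewrite ?leqnn ?andbT ?h1 ?(ltnW h2) ?(ltn_trans h1 h2).
Qed.

Lemma inv_mean1_cvg0 : (mean l1 n)^-1 @[n --> \oo] --> (0 : R).
Proof.
have [h1 _] := regime_lengths.
have [M M0 hM] := ap_mean_large settles1 h1.
apply/(gtr0_cvgV0 (f := fun n => mean l1 n)).
  by apply: filterS hM => n [].
apply/cvgryPge => A.
have hK : \forall n \near \oo, A / M <= n%:R ^+ 2 * p n ^+ l1 n * (l1 n)%:R ^- 9
  by exact: (cvgry_ge np_large).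
near=> n; have [n0 /andP[p0 p1] l3 ll np2] : in_range n by near: n; exact: near_ranges.
have [_ e1 _ _] : mean_bounds M l1 n by near: n.
have e2 : A / M <= n%:R ^+ 2 * p n ^+ l1 n * (l1 n)%:R ^- 9 by near: n.
apply: le_trans e1; rewrite -ler_pdivrMl// mulrC; apply: le_trans e2 _.
have L0 : (0 < l1 n)%N by exact: leq_trans ll.
rewrite ler_wpM2l ?mulr_ge0 ?exprn_ge0 ?(ltW p0)//.
by rewrite lef_pV2 ?posrE ?exprn_gt0 ?ltr0n// -[leLHS]expr1 ler_weXn2l// ler1n.
Unshelve. all: by end_near. Qed.

(** As [l2 <= l1 - 1], the mean is at least of order [n^2 p^(l1 - 1) / l1]. This is a factor [1 / p]
    more than for [l1], and [l1^9 p <= 1] converts it into the required power of [l1]. *)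
Lemma inv_mean2_cvg0 : (l1 n)%:R ^+ 16 / mean l2 n @[n --> \oo] --> (0 : R).
Proof.
have [_ h2] := regime_lengths.
have [M M0 hM] := ap_mean_large settles2 h2.
pose K n : R := n%:R ^+ 2 * p n ^+ l1 n * (l1 n)%:R ^- 9.
have hK : (K n)^-1 @[n --> \oo] --> (0 : R).
  apply/(gtr0_cvgV0 (f := K)); last exact: np_large.
  near=> n; have [n0 /andP[p0 p1] l3 ll np2] : in_range n by near: n; exact: near_ranges.
  by rewrite /K divr_gt0 ?mulr_gt0 ?exprn_gt0 ?ltr0n// (leq_trans _ ll).
have h9 := @power_p_cvg0 9 isT.
apply: (@squeeze_cvgr _ _ _ _ (fun=> 0) (fun n => M^-1 * (K n)^-1)).
- near=> n; have [n0 /andP[p0 p1] l3 ll np2] : in_range n by near: n; exact: near_ranges.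
  have [E0 e1 _ _] : mean_bounds M l2 n by near: n.
  have e9 : `|(l1 n)%:R ^+ 9 * p n| <= 1 by near: n; exact: (cvgr0_norm_le _ h9 1 ltr01).
  rewrite ger0_norm ?mulr_ge0 ?exprn_ge0 ?(ltW p0)// in e9.
  have L0 : (0 < l1 n)%N by exact: leq_trans ll.
  have L0' : 0 < (l1 n)%:R :> R by rewrite ltr0n.
  have K0 : 0 < K n by rewrite /K divr_gt0 ?mulr_gt0 ?exprn_gt0 ?ltr0n.
  have MK : 0 < M * K n by exact: mulr_gt0.
  rewrite divr_ge0 ?exprn_ge0 ?(ltW E0)//= -invfM ler_pdivrMr// mulrC.
  rewrite ler_pdivlMr//; apply: le_trans e1.
  rewrite (_ : _ * (M * K n) = M * (K n * (l1 n)%:R ^+ 16)); last by ring.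
  rewrite ler_wpM2l ?(ltW M0)//.
  have -> : K n * (l1 n)%:R ^+ 16 = n%:R ^+ 2 * (p n ^+ (l1 n).-1 / (l1 n)%:R * ((l1 n)%:R ^+ 8 * p n)).
    have -> : K n = n%:R ^+ 2 * (p n * p n ^+ (l1 n).-1) * (l1 n)%:R ^- 9.
      by rewrite -exprS prednK.
    by field; rewrite lt0r_neq0.
  rewrite -[leRHS]mulrA ler_wpM2l ?exprn_ge0//.
  have q : (l1 n)%:R ^+ 8 * p n <= 1.
    by apply: le_trans e9; rewrite ler_wpM2r ?(ltW p0)// ler_weXn2l// ler1n.
  apply: (@le_trans _ _ (p n ^+ (l1 n).-1 / (l1 n)%:R)).
    by rewrite ler_piMr// divr_ge0// exprn_ge0// ltW.
  apply: ler_pM; rewrite ?exprn_ge0 ?invr_ge0 ?(ltW p0)//.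
    by apply: ler_wiXn2l; [exact: ltW|exact: ltW|rewrite -ltnS prednK].
  have L2 : (0 < l2 n)%N by exact: leq_trans l3.
  by rewrite lef_pV2 ?posrE ?ltr0n// ler_nat ltnW.
- exact: cvg_cst.
- by rewrite -(mulr0 M^-1); apply: cvgMr.
Unshelve. all: by end_near. Qed.

(** The factor [p] stems from [l2 < l1]; it later makes the remainder of the covariance
    negligible. *)
Lemma mean1_le_mean2 : exists2 A : R, 0 < A & \forall n \near \oo, mean l1 n <= A * p n * mean l2 n.
Proof.
have [h1 h2] := regime_lengths.
have [M1 M10 hM1] := ap_mean_large settles1 h1.
have [M2 M20 hM2] := ap_mean_large settles2 h2.
exists (4 * M1 / M2); first by rewrite divr_gt0 ?mulr_gt0.
near=> n; have [n0 /andP[p0 p1] l3 ll np2] : in_range n by near: n; exact: near_ranges.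
have [_ _ e1 _] : mean_bounds M1 l1 n by near: n.
have [_ e2 _ _] : mean_bounds M2 l2 n by near: n.
rewrite (_ : 4 * M1 / M2 * p n * _ = 4 * M1 * (M2^-1 * (p n * mean l2 n))); last by ring.
apply: le_trans e1 _; apply: ler_wpM2l; first by rewrite mulr_ge0// ltW.
rewrite ler_pdivlMl//; apply: le_trans (ler_wpM2l (ltW p0) e2).
rewrite [leRHS]mulrCA ler_wpM2l ?(ltW M20)//.
rewrite (_ : p n * _ = n%:R ^+ 2 * (p n ^+ (l2 n).+1 / (l2 n)%:R)); last by rewrite (exprS (p n)); ring.
rewrite -[leLHS]mulrA ler_wpM2l ?exprn_ge0//.
apply: ler_pM; rewrite ?exprn_ge0 ?invr_ge0 ?(ltW p0)//.
  by apply: ler_wiXn2l; [exact: ltW|exact: ltW|exact: ll].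
have L2 : (0 < l2 n)%N by exact: leq_trans l3.
have L1 : (0 < l1 n)%N by exact: ltn_trans ll.
by rewrite lef_pV2 ?posrE ?ltr0n// ler_nat ltnW.
Unshelve. all: by end_near. Qed.

Lemma variance_regime : exists c A : R, [/\ 0 < c, c <= 1, 1 <= A & \forall n \near \oo,
  variance_bounds c A n].
Proof.
have [h1 h2] := regime_lengths.
have [M1 M10 hM1] := ap_mean_large settles1 h1.
have [M2 M20 hM2] := ap_mean_large settles2 h2.
have [c1 /andP[c10 c11] hc1] := ap_cov_lower settles1 h1.
have [c2 /andP[c20 c21] hc2] := ap_cov_lower settles2 h2.
have [A A0 hA] := mean1_le_mean2.
pose B := 1 + A + 4 * M1 + 4 * M2.
exists (Num.min c1 c2), B; split.
- by rewrite lt_min c10.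
- by rewrite ge_min c11.
- by rewrite /B; lra.
near=> n; have [n0 /andP[p0 p1] l3 ll np2] : in_range n by near: n; exact: near_ranges.
have [E10 _ _ e1] : mean_bounds M1 l1 n by near: n.
have [E20 _ _ e2] : mean_bounds M2 l2 n by near: n.
have e3 : mean l1 n <= A * p n * mean l2 n by near: n.
have {}e3 : mean l1 n <= A * mean l2 n.
  by apply: le_trans e3 _; rewrite ler_wpM2r ?(ltW E20)// ler_piMr ?(ltW A0)// ltW.
have e4 : c1 * (nu n * tau l1 n ^+ 2 + mean l1 n) <= var l1 n by near: n.
have e5 : c2 * (nu n * tau l2 n ^+ 2 + mean l2 n) <= var l2 n by near: n.
have t0 l : 0 <= tau l n by rewrite mulr_ge0 ?exprn_ge0 ?(ltW p0).
have n0' : 0 <= nu n by rewrite mulr_ge0 ?(ltW p0).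
split => //.
- by apply: le_trans e3 _; rewrite ler_wpM2r ?(ltW E20)// /B; lra.
- split; first (apply: le_trans e4; apply: ler_wpM2r; last by rewrite ge_min lexx).
    by rewrite addr_ge0 ?(ltW E10)// mulr_ge0 ?sqr_ge0.
  by apply: le_trans e1 _; apply: ler_wpM2r; [exact: mulr_ge0|rewrite /B; lra].
- split; first (apply: le_trans e5; apply: ler_wpM2r; last by rewrite ge_min lexx orbT).
    by rewrite addr_ge0 ?(ltW E20)// mulr_ge0 ?sqr_ge0.
  by apply: le_trans e2 _; apply: ler_wpM2r; [exact: mulr_ge0|rewrite /B; lra].
Unshelve. all: by end_near. Qed.

Lemma connected_triples_cvg0 (s t : R) :
  connected_triples (p n) (fun a : {set 'I_n} => s / Num.sqrt (var l1 n) * (a \in APs n (l1 n))%:R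
    + t / Num.sqrt (var l2 n) * (a \in APs n (l2 n))%:R) @[n --> \oo] --> (0 : R).
Proof.
have [c [A [c0 c1 A1 hcA]]] := variance_regime.
pose x1 n := (Num.sqrt (var l1 n))^-1; pose x2 n := (Num.sqrt (var l2 n))^-1.
pose r n := (Num.sqrt (nu n))^-1; pose L n : R := (l1 n)%:R.
have C1 : 1 <= A / c by rewrite ler_pdivlMr// mul1r (le_trans c1).
have x1_0 : x1 @ \oo --> (0 : R).
  apply: sqr_cvg0; first by near=> n; rewrite invr_ge0 sqrtr_ge0.
  apply: (@squeeze_cvgr _ _ _ _ (fun=> 0) (fun n => A / c * (mean l1 n)^-1)); last 1 first.
  - by rewrite -(mulr0 (A / c)); apply: cvgMr; exact: inv_mean1_cvg0.
  - near=> n; have [n0 /andP[p0 p1] l3 ll np2] : in_range n by near: n; exact: near_ranges.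
    have [E10 E20 e12 [v1 m1] [v2 m2]] : variance_bounds c A n by near: n.
    have nu0 : 0 < nu n by rewrite mulr_gt0 ?ltr0n.
    have t0 : 0 <= tau l1 n by rewrite mulr_ge0 ?exprn_ge0 ?(ltW p0).
    have [V0 b1 _ _ _] := inv_deviation_bounds c0 c1 A1 nu0 t0 E10 v1 m1.
    by rewrite sqr_ge0/= ler_pdivlMr// mulrC.
  - exact: cvg_cst.
have x2_0 : L n ^+ 8 * x2 n @[n --> \oo] --> (0 : R).
  apply: sqr_cvg0; first by near=> n; rewrite mulr_ge0 ?exprn_ge0// invr_ge0 sqrtr_ge0.
  apply: (@squeeze_cvgr _ _ _ _ (fun=> 0) (fun n => A / c * ((l1 n)%:R ^+ 16 / mean l2 n))); last 1 first.
  - by rewrite -(mulr0 (A / c)); apply: cvgMr; exact: inv_mean2_cvg0.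
  - near=> n; have [n0 /andP[p0 p1] l3 ll np2] : in_range n by near: n; exact: near_ranges.
    have [E10 E20 e12 [v1 m1] [v2 m2]] : variance_bounds c A n by near: n.
    have nu0 : 0 < nu n by rewrite mulr_gt0 ?ltr0n.
    have t0 : 0 <= tau l2 n by rewrite mulr_ge0 ?exprn_ge0 ?(ltW p0).
    have [V0 b1 _ _ _] := inv_deviation_bounds c0 c1 A1 nu0 t0 E20 v2 m2.
    rewrite sqr_ge0/= exprMn -exprM [leRHS]mulrCA ler_wpM2l ?exprn_ge0//.
    by rewrite ler_pdivlMr// mulrC.
  - exact: cvg_cst.
have r_0 : L n ^+ 8 * r n @[n --> \oo] --> (0 : R).
  apply: sqr_cvg0; first by near=> n; rewrite mulr_ge0 ?exprn_ge0// invr_ge0 sqrtr_ge0.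
  apply: (@cvg_trans _ ((l1 n)%:R ^+ 16 / nu n @[n --> \oo])); last exact: inv_nu_cvg0.
  apply: near_eq_cvg; near=> n.
  have [n0 /andP[p0 p1] l3 ll np2] : in_range n by near: n; exact: near_ranges.
  by rewrite exprMn -exprM sqrtV_sqr// mulr_gt0 ?ltr0n.
have p_0 : L n ^+ 8 * p n @[n --> \oo] --> (0 : R) by exact: power_p_cvg0.
(* [dl] collects the small quantities of the triple bound; [x1] is the only one whose convergence to
   0 is available and required without a power of [l1]. *)
pose dl n := x1 n + L n ^+ 8 * x2 n + L n ^+ 8 * r n + L n ^+ 8 * p n.
have dl_0 : dl @ \oo --> (0 : R).
  rewrite (_ : 0 = 0 + 0 + 0 + 0 :> R); last by rewrite !addr0.
  by apply: cvgD => //; apply: cvgD => //; apply: cvgD.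
apply: (@squeeze_cvgr _ _ _ _ (fun=> 0)
    (fun n => (`|s| + `|t|) ^+ 3 * (1000 * (A / c) ^+ 3 * dl n))).
- near=> n; have [n0 /andP[p0 p1] l3 ll np2] : in_range n by near: n; exact: near_ranges.
  have [E10 E20 e12 [v1 m1] [v2 m2]] : variance_bounds c A n by near: n.
  have nu0 : 0 < nu n by rewrite mulr_gt0 ?ltr0n.
  have t0 l : 0 <= tau l n by rewrite mulr_ge0 ?exprn_ge0 ?(ltW p0).
  have [V1 a1 b1 d1 f1] := inv_deviation_bounds c0 c1 A1 nu0 (t0 l1) E10 v1 m1.
  have [V2 a2 b2 d2 _] := inv_deviation_bounds c0 c1 A1 nu0 (t0 l2) E20 v2 m2.
  have vE l : c * (nu n * tau l n ^+ 2 + mean l n) <= var l n -> c * mean l n <= var l n.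
    by apply: le_trans; rewrite ler_pM2l// lerDr mulr_ge0 ?sqr_ge0// ltW.
  have f2 := inv_deviation_cross c0 A1 E10 E20 (vE l1 v1) (vE l2 v2) e12.
  apply/andP; split.
    by do 3 (apply: sumr_ge0 => ? _); rewrite mulr_ge0// exprn_ge0//; exact: ltW.
  have dl1 : dl n <= 1.
    have h : `|dl n| <= 1 by near: n; exact: (cvgr0_norm_le _ dl_0 1 ltr01).
    exact: le_trans (ler_norm _) h.
  have q1 : 0 <= x1 n by rewrite invr_ge0 sqrtr_ge0.
  have q2 : 0 <= L n ^+ 8 * x2 n by rewrite mulr_ge0 ?exprn_ge0// invr_ge0 sqrtr_ge0.
  have q3 : 0 <= L n ^+ 8 * r n by rewrite mulr_ge0 ?exprn_ge0// invr_ge0 sqrtr_ge0.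
  have q4 : 0 <= L n ^+ 8 * p n by rewrite mulr_ge0 ?exprn_ge0// ltW.
  have [d1' d2' d3' d4'] : [/\ L n ^+ 8 * r n <= dl n, L n ^+ 8 * p n <= dl n, x1 n <= dl n
      & L n ^+ 8 * x2 n <= dl n].
    by rewrite /dl; move: (L n ^+ 8 * _) (L n ^+ 8 * _) (L n ^+ 8 * _) q2 q3 q4 => *; split; lra.
  apply: (@connected_triples_APs_le R n (l1 n) (l2 n) (l1 n) (p n) (`|s| + `|t|)
    (x1 n) (x2 n) (A / c) (dl n) (r n)) => //.
  + by rewrite !ltW.
  + by rewrite leqnn andbT (ltn_trans l3).
  + by rewrite l3 ltnW.
  + by rewrite invr_ge0 sqrtr_ge0.
  + by rewrite invr_ge0 sqrtr_ge0.
  + move=> a; apply: le_trans (ler_normD _ _) _; rewrite !normrM !normr_nat.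
    rewrite !(ger0_norm (_ : 0 <= (Num.sqrt _)^-1)) ?invr_ge0 ?sqrtr_ge0//.
    by apply: lerD; rewrite ler_wpM2r// ler_wpM2r ?invr_ge0 ?sqrtr_ge0// ?lerDl ?lerDr.
- exact: cvg_cst.
- rewrite -[X in _ --> X](mulr0 ((`|s| + `|t|) ^+ 3)); apply: cvgMr.
  by rewrite -[X in _ --> X](mulr0 (1000 * (A / c) ^+ 3)); apply: cvgMr.
Unshelve. all: by end_near. Qed.

Definition variance_share l n : R := nu n * tau l n ^+ 2 / var l n.

(** Dividing the variance by [nu tau^2] leaves the incidence density plus a multiple of
    [mean / (nu tau^2)], which is the density of progressions over [theta]. *)
Lemma variance_shareE l : settles l -> (\forall n \near \oo, (2 < l n <= l1 n)%N) ->
  forall J : R, incidence_density l l @ \oo --> J ->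
  exists M : R, exists a b : nat -> R, [/\ 0 < M, a @ \oo --> J, b @ \oo --> M
    & \forall n \near \oo, (variance_share l n)^-1 = a n + b n * (theta l n)^-1].
Proof.
move=> sl ll J hJ; have [M M0 hM] := ap_density_cvg sl ll.
have hp0 : p @ \oo --> (0 : R).
  have := power_p_cvg0 (leq0n 9).
  by under eq_fun do rewrite expr0 mul1r.
have hp4 := @power_p_cvg0 4 isT.
pose q n := ap_cov_rest n (p n) (l n) (l n) / mean l n.
have hq : q @ \oo --> (1 : R).
  apply: (cvg0_close (h := fun n => (l1 n)%:R ^+ 4 * p n)) (cvg_cst _) => //.
  have [M' M'0 hM'] := ap_mean_large sl ll.
  near=> n; have [n0 /andP[p0 p1] l3 ll' np2] : in_range n by near: n; exact: near_ranges.
  have [E0 _ _ _] : mean_bounds M' l n by near: n.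
  have /andP[ln3 lL] : (2 < l n <= l1 n)%N by near: n.
  have pp : 0 <= p n <= 1 by rewrite !ltW.
  have h := @ap_cov_rest_diag_le R n (p n) pp (l n) ln3.
  rewrite /q (_ : _ - 1 = (ap_cov_rest n (p n) (l n) (l n) - mean l n) / mean l n); last first.
    by field; rewrite lt0r_neq0.
  rewrite normrM (gtr0_norm (_ : 0 < (mean l n)^-1)) ?invr_gt0// ler_pdivrMr// mulrC.
  apply: le_trans h _; rewrite ler_wpM2l ?(ltW E0)// ler_wpM2r ?(ltW p0)//.
  by rewrite lerXn2r ?nnegrE// ler_nat.
exists M, (fun n => (1 - p n) * incidence_density l l n), (fun n => q n * ap_density l n).
split => //.
- rewrite (_ : J = (1 - 0) * J); last by rewrite subr0 mul1r.
  by apply: cvgM => //; apply: cvgB => //; exact: cvg_cst.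
- by rewrite -[M]mul1r; apply: cvgM.
have [M' M'0 hM'] := ap_mean_large sl ll.
near=> n; have [n0 /andP[p0 p1] l3 ll' np2] : in_range n by near: n; exact: near_ranges.
have [E0 _ _ _] : mean_bounds M' l n by near: n.
have /andP[ln3 lL] : (2 < l n <= l1 n)%N by near: n.
have l0 : (0 < l n)%N by exact: leq_trans ln3.
have nu0 : nu n != 0 by rewrite lt0r_neq0// mulr_gt0 ?ltr0n.
have t0 : tau l n != 0 by rewrite lt0r_neq0// mulr_gt0 ?exprn_gt0 ?ltr0n.
have ln0 : (l n)%:R != 0 :> R by rewrite pnatr_eq0 -lt0n.
rewrite /variance_share invf_div ap_cov_tau//.
have -> : ap_cov_rest n (p n) (l n) (l n) = q n * mean l n by rewrite /q divfK// lt0r_neq0.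
rewrite ap_mean_tau//; move: (tau l n) (nu n) (q n) (ap_density l n) (incidence_density l l n) nu0 t0.
move=> u v a b c v0 u0; field; by rewrite ?v0 ?u0 ?ln0.
Unshelve. all: by end_near. Qed.

(** Multiplied through by [th], the relation reads [y = th / (a th + b)], which passes to the limit
    even when [th] tends to 0; for infinite [th] the original form does. *)
Lemma share_limits (y a b th : nat -> R) (J M : R) : 0 < J -> 0 < M ->
  a @ \oo --> J -> b @ \oo --> M -> (\forall n \near \oo, 0 < th n) ->
  (\forall n \near \oo, (y n)^-1 = a n + b n * (th n)^-1) ->
  (forall c : R, 0 <= c -> th @ \oo --> c -> y @ \oo --> c / (J * c + M)) /\
  ((th n)^-1 @[n --> \oo] --> (0 : R) -> y @ \oo --> J^-1).
Proof.
move=> J0 M0 ha hb th0 hy; split=> [c c0 hc|hi].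
  apply: (@cvg_trans _ (th n * (a n * th n + b n)^-1 @[n --> \oo])).
    apply: near_eq_cvg; near=> n.
    have t0 : 0 < th n by near: n.
    have e : (y n)^-1 = a n + b n * (th n)^-1 by near: n.
    rewrite -[y n]invrK e (_ : a n + _ = (a n * th n + b n) / th n); last by field; rewrite lt0r_neq0.
    by rewrite invf_div.
  apply: cvgM => //; apply: cvgV; first by rewrite lt0r_neq0// ltr_wpDl// mulr_ge0// ltW.
  by apply: cvgD => //; apply: cvgM.
have h : (a n + b n * (th n)^-1)^-1 @[n --> \oo] --> J^-1.
  apply: cvgV; first by rewrite lt0r_neq0.
  rewrite -[J]addr0 -(mulr0 M); apply: cvgD => //; exact: cvgM.
apply: cvg_trans h; apply: near_eq_cvg; near=> n.
have e : (y n)^-1 = a n + b n * (th n)^-1 by near: n.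
by rewrite -e invrK.
Unshelve. all: by end_near. Qed.

Definition ap_corr n : R :=
  ap_cov n (p n) (l1 n) (l2 n) / (Num.sqrt (var l1 n) * Num.sqrt (var l2 n)).

(** Divided by the deviations, [nu tau1 tau2] becomes the product of the square roots of the shares.
    The remainder is at most [err], whose square is of order [l1^8 p] thanks to the factor [p] in
    [mean1_le_mean2]. *)
Lemma ap_corr_cvg (J w : R) : incidence_density l1 l2 @ \oo --> J ->
  Num.sqrt (variance_share l1 n) * Num.sqrt (variance_share l2 n) @[n --> \oo] --> w ->
  ap_corr @ \oo --> J * w.
Proof.
move=> hJ hw.
have hp0 : p @ \oo --> (0 : R).
  have := power_p_cvg0 (leq0n 9).
  by under eq_fun do rewrite expr0 mul1r.
have [c [A [c0 c1 A1 hcA]]] := variance_regime.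
have [B B0 hB] := mean1_le_mean2.
pose err n : R := (l1 n)%:R ^+ 4 * (mean l1 n * (Num.sqrt (var l1 n))^-1 * (Num.sqrt (var l2 n))^-1).
have err0 : err @ \oo --> (0 : R).
  apply: sqr_cvg0.
    near=> n; have [n0 /andP[p0 p1] l3 ll np2] : in_range n by near: n; exact: near_ranges.
    by rewrite !mulr_ge0 ?exprn_ge0 ?invr_ge0 ?sqrtr_ge0// (ltW p0).
  apply: (@squeeze_cvgr _ _ _ _ (fun=> 0) (fun n => B / c ^+ 2 * ((l1 n)%:R ^+ 8 * p n))).
  - near=> n; have [n0 /andP[p0 p1] l3 ll np2] : in_range n by near: n; exact: near_ranges.
    have [E10 E20 e12 [v1 _] [v2 _]] : variance_bounds c A n by near: n.
    have hBn : mean l1 n <= B * p n * mean l2 n by near: n.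
    have vE l : c * (nu n * tau l n ^+ 2 + mean l n) <= var l n -> c * mean l n <= var l n.
      by apply: le_trans; rewrite ler_pM2l// lerDr mulr_ge0 ?sqr_ge0// mulr_ge0 ?(ltW p0).
    have Bp : 0 <= B * p n by rewrite mulr_ge0// ltW.
    have h := inv_deviation_cross_sqr c0 Bp E10 E20 (vE l1 v1) (vE l2 v2) hBn.
    rewrite sqr_ge0/= exprMn -exprM.
    rewrite (_ : B / c ^+ 2 * _ = (l1 n)%:R ^+ 8 * (B * p n / c ^+ 2)); last by ring.
    by rewrite ler_wpM2l ?exprn_ge0.
  - exact: cvg_cst.
  - by rewrite -(mulr0 (B / c ^+ 2)); apply: cvgMr; exact: power_p_cvg0.
apply: (cvg0_close (h := err) (g := fun n => (1 - p n) * incidence_density l1 l2 n *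
    (Num.sqrt (variance_share l1 n) * Num.sqrt (variance_share l2 n))) _ err0); last first.
  apply: cvgM => //; rewrite (_ : J = (1 - 0) * J); last by rewrite subr0 mul1r.
  by apply: cvgM => //; apply: cvgB => //; exact: cvg_cst.
near=> n; have [n0 /andP[p0 p1] l3 ll np2] : in_range n by near: n; exact: near_ranges.
have [E10 E20 _ [v1 _] [v2 _]] : variance_bounds c A n by near: n.
have nu0 : 0 <= nu n by rewrite mulr_ge0// ltW.
have t0 l : 0 <= tau l n by rewrite mulr_ge0 ?exprn_ge0 ?(ltW p0).
have vE l : 0 < mean l n -> c * (nu n * tau l n ^+ 2 + mean l n) <= var l n -> 0 <= var l n.
  move=> E0; apply: le_trans; apply: mulr_ge0; first exact: ltW.
  by rewrite addr_ge0 ?(ltW E0)// mulr_ge0 ?sqr_ge0.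
have V1 := vE _ E10 v1; have V2 := vE _ E20 v2.
have shE l : 0 <= var l n -> Num.sqrt (variance_share l n) = Num.sqrt (nu n) * tau l n / Num.sqrt (var l n).
  move=> V0; rewrite /variance_share (sqrtrM _ (mulr_ge0 nu0 (sqr_ge0 _))) (sqrtrM _ nu0).
  by rewrite sqrtr_sqr ger0_norm// sqrtrV.
have l20 : (2 < l1 n)%N by exact: ltn_trans ll.
have pp : 0 <= p n <= 1 by rewrite !ltW.
rewrite /ap_corr ap_cov_tau; [|by []|exact: leq_trans l20|exact: leq_trans l3].
rewrite !shE// (_ : Num.sqrt (nu n) * tau l1 n / _ * _ =
   nu n * tau l1 n * tau l2 n / (Num.sqrt (var l1 n) * Num.sqrt (var l2 n))); last first.
  by rewrite -{3}(sqr_sqrtr nu0) invfM; ring.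
rewrite mulrDl (_ : _ + _ - _ = ap_cov_rest n (p n) (l1 n) (l2 n) /
    (Num.sqrt (var l1 n) * Num.sqrt (var l2 n))); last by ring.
have r0 := @ap_cov_rest_ge0 R n (p n) pp (l1 n) (l2 n) l20 l3.
have r1 := @ap_cov_rest_off_le R n (p n) pp (l1 n) (l2 n) l20 l3.
rewrite ger0_norm ?divr_ge0 ?mulr_ge0 ?sqrtr_ge0// /err.
rewrite (_ : (l1 n)%:R ^+ 4 * _ = mean l1 n * (l1 n)%:R ^+ 4 / (Num.sqrt (var l1 n) * Num.sqrt (var l2 n))); last first.
  by rewrite invfM; ring.
rewrite ler_wpM2r ?invr_ge0 ?mulr_ge0 ?sqrtr_ge0//; apply: le_trans r1 _.
rewrite ler_wpM2l ?(ltW E10)// (exprD _ 2 2) ler_wpM2l ?exprn_ge0//.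
by rewrite lerXn2r ?nnegrE// ler_nat ltnW.
Unshelve. all: by end_near. Qed.

Lemma theta1_pos : \forall n \near \oo, 0 < theta l1 n /\ 0 < theta l2 n.
Proof.
near=> n; have [n0 /andP[p0 p1] l3 ll np2] : in_range n by near: n; exact: near_ranges.
by rewrite !mulr_gt0 ?exprn_gt0 ?ltr0n// ?(leq_trans _ l3)// (leq_trans _ ll).
Unshelve. all: by end_near. Qed.

(** Since the lengths differ by at least one, [theta1 <= l1 p theta2]: the second quantity is
    infinite in the limit as soon as the first stays away from 0. *)
Lemma inv_theta2_cvg0 (B : R) : (\forall n \near \oo, (theta l1 n)^-1 <= B) ->
  (theta l2 n)^-1 @[n --> \oo] --> (0 : R).
Proof.
move=> hB; have h1 := @power_p_cvg0 1 isT.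
have th := theta1_pos.
apply: (@squeeze_cvgr _ _ _ _ (fun=> 0) (fun n => B * ((l1 n)%:R ^+ 1 * p n))).
- near=> n; have [n0 /andP[p0 p1] l3 ll np2] : in_range n by near: n; exact: near_ranges.
  have [t1 t2] : 0 < theta l1 n /\ 0 < theta l2 n by near: n.
  have b : (theta l1 n)^-1 <= B by near: n.
  rewrite invr_ge0 (ltW t2)/=.
  have l20 : (0 < l2 n)%N by exact: leq_trans l3.
  have l10 : (0 < l1 n)%N by exact: leq_trans ll.
  have e : theta l1 n <= (l1 n)%:R ^+ 1 * p n * theta l2 n.
    rewrite expr1 (_ : _ * theta l2 n = n%:R * (p n ^+ (l2 n).-1.+1) * (l1 n)%:R * (l2 n)%:R); last first.
      by rewrite (exprS (p n)); ring.
    apply: (@le_trans _ _ (n%:R * p n ^+ (l2 n).-1.+1 * (l1 n)%:R)).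
      rewrite ler_wpM2r// ler_wpM2l// prednK//.
      by apply: ler_wiXn2l; [exact: ltW|exact: ltW|rewrite -ltnS prednK].
    by rewrite ler_peMr ?ler1n// !mulr_ge0 ?exprn_ge0// ltW.
  apply: (@le_trans _ _ ((theta l1 n)^-1 * ((l1 n)%:R ^+ 1 * p n))).
    by rewrite ler_pdivlMl// ler_pdivrMr.
  by rewrite ler_wpM2r// mulr_ge0 ?exprn_ge0 ?(ltW p0).
- exact: cvg_cst.
- by rewrite -(mulr0 B); apply: cvgMr.
Unshelve. all: by end_near. Qed.

Lemma sqrt_quotient_lt1 (J J11 J22 : R) : 0 < J -> 0 < J11 -> 0 < J22 -> J ^+ 2 < J11 * J22 ->
  0 < J * (Num.sqrt J11^-1 * Num.sqrt J22^-1) < 1.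
Proof.
move=> J0 J110 J220 h; have s0 : 0 < J * (Num.sqrt J11^-1 * Num.sqrt J22^-1).
  by rewrite !mulr_gt0// sqrtr_gt0 invr_gt0.
rewrite s0/= -(@ltr_sqr R) ?nnegrE ?(ltW s0)// expr1n !exprMn !sqr_sqrtr ?invr_ge0 ?ltW//.
by rewrite -invfM ltr_pdivrMr ?mulr_gt0// mul1r.
Qed.

Lemma ap_correlation_limit :
  (exists L : \bar R, (0 <= L)%E /\ (theta l1 n)%:E @[n --> \oo] --> L) ->
  exists kappa : R, [/\ ap_corr @ \oo --> kappa, 0 <= kappa <= 1,
    theta l1 n @[n --> \oo] --> (0 : R) -> kappa = 0,
    (exists c : R, 0 < c /\ theta l1 n @[n --> \oo] --> c) \/
      (theta l1 n @[n --> \oo] --> +oo /\ exists c : nat, \forall n \near \oo, l2 n = c) ->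
      0 < kappa < 1
  & theta l1 n @[n --> \oo] --> +oo /\ l2 @ \oo --> \oo -> kappa = 1].
Proof.
have [r1 r2] := regime_lengths.
have s1 := settles_pred settles1; have s2 := settles_pred settles2.
have l10 : \forall n \near \oo, (0 < (l1 n).-1)%N.
  by apply: filterS r1 => n /andP[+ _]; case: (l1 n) => [|[|]].
have l20 : \forall n \near \oo, (0 < (l2 n).-1)%N.
  by apply: filterS r2 => n /andP[+ _]; case: (l2 n) => [|[|]].
have [J11 J110 h11] := @riemann_profile_lim R _ _ s1 s1 l10 l10.
have [J12 J120 h12] := @riemann_profile_lim R _ _ s1 s2 l10 l20.
have [J22 J220 h22] := @riemann_profile_lim R _ _ s2 s2 l20 l20.
have lpred : \forall n \near \oo, (1 < (l2 n).-1 < (l1 n).-1)%N.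
  apply: filterS2 l2_ge3 l12 => n.
  by case: (l2 n) => [|[|[|k]]]//; case: (l1 n) => [|m]//.
have [Gst Geq] := profile_gram s1 s2 lpred J120 J220 h11 h12 h22.
have d11 := incidence_density_close r1 r1 h11.
have d12 := incidence_density_close r1 r2 h12.
have d22 := incidence_density_close r2 r2 h22.
have predy (k : nat -> nat) : k @ \oo --> \oo -> (fun n => (k n).-1) @ \oo --> \oo.
  move=> kk A [N _ hN]; suff : \forall n \near \oo, A (k n).-1 by [].
  have h : \forall n \near \oo, (N.+1 <= k n)%N by exact: (kk _ (nbhs_infty_ge N.+1)).
  by apply: filterS h => n; case: (k n) => // m h; apply: hN.
(* The weak inequality holds for both kinds of [l2]. For positive finite [theta] it suffices,
   strictness then coming from [M1 / c > 0]. *)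
have Gle : J12 ^+ 2 <= J11 * J22.
  case: s2 => [c|/Geq[-> ->]]; first exact/ltW/Gst.
  by rewrite expr2.
have [M1 [a1 [b1 [M10 ha1 hb1 y1E]]]] := variance_shareE settles1 r1 d11.
have [M2 [a2 [b2 [M20 ha2 hb2 y2E]]]] := variance_shareE settles2 r2 d22.
have th1 : \forall n \near \oo, 0 < theta l1 n by apply: filterS theta1_pos => n [].
have th2 : \forall n \near \oo, 0 < theta l2 n by apply: filterS theta1_pos => n [].
have [y1c y1i] := share_limits J110 M10 ha1 hb1 th1 y1E.
have [y2c y2i] := share_limits J220 M20 ha2 hb2 th2 y2E.
have sqrt_cvg (f : nat -> R) (a : R) : f @ \oo --> a -> Num.sqrt (f n) @[n --> \oo] --> Num.sqrt a.
  by move=> fa; exact: (cvg_comp _ _ fa (@sqrt_continuous R a)).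
have noy (c : R) : theta l1 n @[n --> \oo] --> c -> theta l1 n @[n --> \oo] --> +oo -> False.
  move=> hc hy; have g1 : \forall n \near \oo, c + 1 <= theta l1 n by exact: (cvgry_ge hy).
  have g2 : \forall n \near \oo, theta l1 n <= c + 2^-1 by apply: (cvgr_le _ hc); lra.
  have [n [a b]] := filter_ex (filterI g1 g2).
  by have := le_trans a b; rewrite lerD2l; lra.
case=> -[c| |] [L0 hL]; last by [].
- have {}hL : theta l1 n @[n --> \oo] --> c by exact: (fine_cvg hL).
  have {}L0 : 0 <= c by rewrite -lee_fin.
  have hy1 := sqrt_cvg _ _ (y1c c L0 hL).
  (* When [theta l1] tends to 0 nothing is known about the limit of [theta l2]: the first share
     tends to 0, and the second is only kept below [2 / J22]. *)
  have [c0|c0] := eqVneq c 0.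
    exists 0; split => //.
    + rewrite -(mulr0 J12); apply: ap_corr_cvg => //.
      apply: (@squeeze_cvgr _ _ _ _ (fun=> 0)
        (fun n => Num.sqrt (variance_share l1 n) * Num.sqrt (2 / J22))).
      * have g1 : \forall n \near \oo, J22 / 2 <= a2 n by apply: (cvgr_ge _ ha2); lra.
        have g2 : \forall n \near \oo, 0 <= b2 n by apply: (cvgr_ge _ hb2); lra.
        near=> n; rewrite mulr_ge0 ?sqrtr_ge0//= ler_wpM2l ?sqrtr_ge0// ler_wsqrtr//.
        have e : (variance_share l2 n)^-1 = a2 n + b2 n * (theta l2 n)^-1 by near: n.
        have t2 : 0 < theta l2 n by near: n.
        have g3 : J22 / 2 <= a2 n by near: n.
        have g4 : 0 <= b2 n by near: n.
        have J2 : 0 < J22 / 2 by rewrite divr_gt0.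
        rewrite -[variance_share l2 n]invrK e -(invf_div J22 2) lef_pV2 ?posrE//.
          by apply: le_trans g3 _; rewrite lerDl divr_ge0// ltW.
        by apply: (lt_le_trans J2); apply: le_trans g3 _; rewrite lerDl divr_ge0// ltW.
      * exact: cvg_cst.
      * rewrite (_ : 0 = Num.sqrt (c / (J11 * c + M1)) * Num.sqrt (2 / J22)).
          by apply: cvgM => //; exact: cvg_cst.
        by rewrite c0 mul0r sqrtr0 mul0r.
    + by rewrite lexx ler01.
    + case=> [[c' [c'0 hc']]|[hy _]]; last by case: (noy _ hL hy).
      have e : c' = c by exact: (cvg_unique _ hc' hL).
      by move: c'0; rewrite e c0 ltxx.
    + by case=> hy; case: (noy _ hL hy).
  have {c0}L0 : 0 < c by rewrite lt_neqAle eq_sym c0.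
  have i1 : \forall n \near \oo, (theta l1 n)^-1 <= 2 / c.
    near=> n; have g : c / 2 <= theta l1 n by near: n; apply: (cvgr_ge _ hL); lra.
    have c2 : 0 < c / 2 by rewrite divr_gt0.
    by rewrite -(invf_div c 2) lef_pV2 ?posrE// (lt_le_trans c2).
  have hy2 := sqrt_cvg _ _ (y2i (inv_theta2_cvg0 i1)).
  have cE : c / (J11 * c + M1) = (J11 + M1 / c)^-1.
    rewrite -invf_div mulrDl mulfK ?lt0r_neq0//.
  rewrite cE in hy1.
  have J0 : 0 < J11 + M1 / c by rewrite addr_gt0 ?divr_gt0.
  have lt1 : 0 < J12 * (Num.sqrt (J11 + M1 / c)^-1 * Num.sqrt J22^-1) < 1.
    apply: sqrt_quotient_lt1 => //; apply: le_lt_trans Gle _.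
    by rewrite ltr_pM2r// ltrDl divr_gt0.
  exists (J12 * (Num.sqrt (J11 + M1 / c)^-1 * Num.sqrt J22^-1)); split => //.
  + by apply: ap_corr_cvg => //; exact: cvgM.
  + by case/andP: lt1 => a b; rewrite !ltW.
  + move=> h0; have e : c = 0 by exact: (cvg_unique _ hL h0).
    by move: L0; rewrite e ltxx.
  + by case=> hy; case: (noy _ hL hy).
have {}hL : theta l1 n @[n --> \oo] --> +oo by apply/cvgeryP.
have i0 : (theta l1 n)^-1 @[n --> \oo] --> (0 : R).
  by apply/(gtr0_cvgV0 (f := fun n => theta l1 n)).
have i1 : \forall n \near \oo, (theta l1 n)^-1 <= 1 by apply: (cvgr_le _ i0); exact: ltr01.
have hy1 := sqrt_cvg _ _ (y1i i0).
have hy2 := sqrt_cvg _ _ (y2i (inv_theta2_cvg0 i1)).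
exists (J12 * (Num.sqrt J11^-1 * Num.sqrt J22^-1)); split.
- by apply: ap_corr_cvg => //; exact: cvgM.
- case: s2 => [h|].
    by have /andP[a b] := sqrt_quotient_lt1 J120 J110 J220 (Gst h); rewrite !ltW.
  move/Geq => [-> ->]; rewrite -expr2 sqr_sqrtr ?invr_ge0 ?(ltW J220)// mulfV ?lt0r_neq0//.
  by rewrite ler01 lexx.
- by move=> h0; case: (noy _ h0 hL).
- case=> [[c [_ hc]]|[_ [c hc]]]; first by case: (noy _ hc hL).
  apply: sqrt_quotient_lt1 => //; apply: Gst; exists c.-1.
  by apply: filterS hc => n ->.
- case=> _ /predy /Geq [-> ->].
  by rewrite -expr2 sqr_sqrtr ?invr_ge0 ?(ltW J220)// mulfV ?lt0r_neq0.
Unshelve. all: by end_near. Qed.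

End asymptotics.

(** * Conclusion *)

Section standardized_counts.
Context {R : realType}.

Definition std_ap_count n (p : R) l (A : {set 'I_n}) : R :=
  (\sum_(a in APs n l) (a \subset A)%:R - ap_mean n p l) / Num.sqrt (ap_cov n p l l).

Lemma bern_mean_std_ap_count n (p : R) l l' : 0 <= p <= 1 -> (2 < l)%N -> (2 < l')%N ->
  bern_mean p (fun A : {set 'I_n} => std_ap_count p l A * std_ap_count p l' A) =
  ap_cov n p l l' / (Num.sqrt (ap_cov n p l l) * Num.sqrt (ap_cov n p l' l')).
Proof.
move=> p01 l3 l3'; rewrite -ap_covE// mulrC -bern_meanZ; apply: eq_bern_mean => A.
by rewrite /std_ap_count invfM; ring.
Qed.

Lemma std_ap_count_dissociated n (p s t : R) l l' (A : {set 'I_n}) : (2 < l)%N -> (2 < l')%N ->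
  s * std_ap_count p l A + t * std_ap_count p l' A =
  dissociated_sum p (fun a : {set 'I_n} => s / Num.sqrt (ap_cov n p l l) * (a \in APs n l)%:R
    + t / Num.sqrt (ap_cov n p l' l') * (a \in APs n l')%:R) A.
Proof.
move=> l3 l3'; have stdE q : (2 < q)%N -> std_ap_count p q A =
    (Num.sqrt (ap_cov n p q q))^-1 * \sum_a (a \in APs n q)%:R * ((a \subset A)%:R - p ^+ #|a|).
  move=> q3; rewrite /std_ap_count mulrC /ap_mean mulr_natl -sumr_const -sumrB; congr (_ * _).
  rewrite big_mkcond; apply: eq_bigr => a _; case: ifPn => aA; last by rewrite mul0r.
  by rewrite mul1r (card_APs_mem q3 aA).
rewrite !stdE// !mulrA !mulr_sumr -big_split; apply: eq_bigr => a _ /=.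
by rewrite /centered_term; ring.
Qed.

(** The Cholesky factor of the correlation matrix; its last entry vanishes for [k = 1], which covers
    the degenerate limit law. *)
Definition correlation_factor (k : R) : 'M[R]_2 :=
  \matrix_(i < 2, j < 2) if i == 0 then (j == 0)%:R else if j == 0 then k else Num.sqrt (1 - k ^+ 2).

Lemma correlation_factorE (k : R) : `|k| <= 1 ->
  correlation_factor k *m (correlation_factor k)^T =
  \matrix_(i < 2, j < 2) (if i == j then 1 else k).
Proof.
move=> k1; have k2 : 0 <= 1 - k ^+ 2 by rewrite subr_ge0 -real_normK ?num_real// exprn_ile1.
apply/matrixP => i j; rewrite !mxE !big_ord_recl big_ord0 addr0 !mxE.
case: i => -[|[|//]] hi; case: j => -[|[|//]] hj /=; rewrite ?mulr1 ?mul1r ?mulr0 ?mul0r ?addr0 ?add0r//.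
by rewrite -expr2 -[X in _ + X]expr2 sqr_sqrtr// addrC subrK.
Qed.

Lemma std_ap_count_clt (l1 l2 : nat -> nat) (p : nat -> R) (kappa : R) :
  ap_regime l1 l2 p -> (forall n, (0 < n)%N -> 0 < p n < 1) -> `|kappa| <= 1 ->
  ap_corr l1 l2 p @ \oo --> kappa ->
  forall f : R * R -> R, continuous f -> (exists M : R, forall z, `|f z| <= M) ->
  (bern_mean (p n) (fun A : {set 'I_n} => f (std_ap_count (p n) (l1 n) A, std_ap_count (p n) (l2 n) A)))
    @[n --> \oo] --> \int[affine_gaussian (correlation_factor kappa)]_z f z.
Proof.
move=> rg p01 k1 hk f cf [M fM].
have pp n : (0 < n)%N -> 0 <= p n <= 1 by move=> /p01/andP[a b]; rewrite !ltW.
pose E n (g : R * R -> R) :=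
  bern_mean (p n) (fun A : {set 'I_n} => g (std_ap_count (p n) (l1 n) A, std_ap_count (p n) (l2 n) A)).
pose V l n := ap_cov n (p n) (l n) (l n).
have rng : \forall n \near \oo, [/\ (0 < n)%N, (2 < l1 n)%N, (2 < l2 n)%N, 0 < V l1 n & 0 < V l2 n].
  have [c [A [c0 c1 A1 hcA]]] := variance_regime rg.
  near=> n; have [n0 pn l3 ll _] : [/\ (0 < n)%N, 0 < p n < 1, (2 < l2 n)%N, (l2 n < l1 n)%N
    & 1 <= n%:R * p n ^+ 2 :> R] by near: n; exact: near_ranges rg.
  have [E1 E2 _ [v1 _] [v2 _]] : [/\ 0 < ap_mean n (p n) (l1 n), 0 < ap_mean n (p n) (l2 n),
      ap_mean n (p n) (l1 n) <= A * ap_mean n (p n) (l2 n),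
      c * (n%:R * p n * (n%:R * p n ^+ (l1 n).-1) ^+ 2 + ap_mean n (p n) (l1 n)) <= V l1 n /\
      ap_mean n (p n) (l1 n) <= A * (n%:R * p n * (n%:R * p n ^+ (l1 n).-1))
    & c * (n%:R * p n * (n%:R * p n ^+ (l2 n).-1) ^+ 2 + ap_mean n (p n) (l2 n)) <= V l2 n /\
      ap_mean n (p n) (l2 n) <= A * (n%:R * p n * (n%:R * p n ^+ (l2 n).-1))] by near: n.
  have /andP[p0 _] := pn.
  have q l : 0 <= n%:R * p n * (n%:R * p n ^+ (l n).-1) ^+ 2.
    by rewrite mulr_ge0 ?sqr_ge0// mulr_ge0// ltW.
  split => //; first exact: ltn_trans ll.
    by apply: lt_le_trans v1; rewrite mulr_gt0// ltr_wpDl.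
  by apply: lt_le_trans v2; rewrite mulr_gt0// ltr_wpDl.
have var1 n l : 0 < V l n -> ap_cov n (p n) (l n) (l n) / (Num.sqrt (V l n) * Num.sqrt (V l n)) = 1.
  by move=> V0; rewrite -expr2 sqr_sqrtr ?(ltW V0)// mulfV ?lt0r_neq0.
apply: (@weak_cvg R E (affine_gaussian (correlation_factor kappa)) _ _ _ _ _ _ f M cf fM).
- by move=> n g h _; rewrite /E bern_meanD.
- by move=> n k g _; rewrite /E bern_meanZ.
- by move=> n k n0; rewrite /E bern_mean_cst// pp.
- by move=> n g h n0 gh; apply: le_bern_mean => //; exact: pp.
- near=> n; have [n0 l13 l23 V1 V2] : [/\ (0 < n)%N, (2 < l1 n)%N, (2 < l2 n)%N, 0 < V l1 n & 0 < V l2 n]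
    by near: n.
  rewrite /E/= bern_meanD (_ : 2 = 1 + 1 :> R)//.
  rewrite -{1}(var1 n l1 V1) -{1}(var1 n l2 V2) -!bern_mean_std_ap_count ?pp//.
- move=> s t c.
  pose b n := fun a : {set 'I_n} => s / Num.sqrt (V l1 n) * (a \in APs n (l1 n))%:R
    + t / Num.sqrt (V l2 n) * (a \in APs n (l2 n))%:R.
  (* [q] is the cosine mean of the normal law with the correlation at [n] in place of [kappa]. It is
     what the Stein bound produces, because the linear combination has variance exactly
     [s^2 + 2 s t corr + t^2]. *)
  pose q n := expR (- (s ^+ 2 + 2 * s * t * ap_corr l1 l2 p n + t ^+ 2) / 2) * cos c.
  have hT := connected_triples_cvg0 rg s t.
  have hI : \int[affine_gaussian (correlation_factor kappa)]_z cos (s * z.1 + t * z.2 + c) =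
      expR (- (s ^+ 2 + 2 * s * t * kappa + t ^+ 2) / 2) * cos c.
    rewrite /Rintegral affine_gaussian_cos/= !mxE/= mulr1 mulr0 add0r.
    have k2 : 0 <= 1 - kappa ^+ 2 by rewrite subr_ge0 -real_normK ?num_real// exprn_ile1.
    congr (expR (- _ / 2) * _); rewrite [X in _ + X]exprMn sqr_sqrtr//; ring.
  rewrite hI.
  apply: (@cvg0_close R _ q (fun n => 24 * connected_triples (p n) (b n))).
  + near=> n; have [n0 l13 l23 V1 V2] :
      [/\ (0 < n)%N, (2 < l1 n)%N, (2 < l2 n)%N, 0 < V l1 n & 0 < V l2 n] by near: n.
    have := @dissociated_sum_cos R _ (p n) (b n) (pp n n0) c.
    rewrite (_ : bern_mean _ (fun A => cos _) = E n (fun z => cos (s * z.1 + t * z.2 + c))); last first.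
      by apply: eq_bern_mean => A /=; rewrite std_ap_count_dissociated.
    rewrite (_ : bern_mean _ (fun A => _ ^+ 2) = s ^+ 2 + 2 * s * t * ap_corr l1 l2 p n + t ^+ 2)//.
    transitivity (s ^+ 2 * bern_mean (p n) (fun A : {set 'I_n} => std_ap_count (p n) (l1 n) A * std_ap_count (p n) (l1 n) A)
      + 2 * s * t * bern_mean (p n) (fun A : {set 'I_n} => std_ap_count (p n) (l1 n) A * std_ap_count (p n) (l2 n) A)
      + t ^+ 2 * bern_mean (p n) (fun A : {set 'I_n} => std_ap_count (p n) (l2 n) A * std_ap_count (p n) (l2 n) A)).
      rewrite -!bern_meanZ -!bern_meanD; apply: eq_bern_mean => A.
      by rewrite -std_ap_count_dissociated//; ring.
    by rewrite !bern_mean_std_ap_count ?pp// !var1// !mulr1.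
  + by rewrite -(mulr0 (24 : R)); apply: cvgMr.
  + apply: cvgM; last exact: cvg_cst.
    have h : - (s ^+ 2 + 2 * s * t * ap_corr l1 l2 p n + t ^+ 2) / 2 @[n --> \oo] -->
        - (s ^+ 2 + 2 * s * t * kappa + t ^+ 2) / 2.
      apply: cvgM; last exact: cvg_cst.
      apply: cvgN; apply: cvgD; last exact: cvg_cst.
      by apply: cvgD; [exact: cvg_cst|exact: cvgMr].
    by have := cvg_comp _ _ h (@continuous_expR R _); apply.
Unshelve. all: by end_near. Qed.

End standardized_counts.

Section transfer.
Context {R : realType} (d : measure_display) (T : measurableType d) (P : probability T R)
  (n : nat) (S : T -> {set 'I_n}) (p : R).
Hypotheses (hS : binomial_subset P S p) (p01 : 0 <= p <= 1).
Implicit Types l : nat.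

Let count l (A : {set 'I_n}) : R := \sum_(a in APs n l) (a \subset A)%:R.

Lemma expectation_AP_count l : (2 < l)%N -> fine 'E_P[AP_count R S l] = ap_mean n p l.
Proof. by move=> l3; rewrite (expectation_binomial_subset hS (count l)) ap_mean_bern. Qed.

Lemma covariance_AP_count l l' : (2 < l)%N -> (2 < l')%N ->
  fine (covariance P (AP_count R S l) (AP_count R S l')) = ap_cov n p l l'.
Proof.
move=> l3 l3'; rewrite (covariance_binomial_subset hS (count l) (count l')).
by rewrite /count !ap_mean_bern// ap_covE.
Qed.

Lemma std_dev_AP_count l : (2 < l)%N -> std_dev P (AP_count R S l) = Num.sqrt (ap_cov n p l l).
Proof. by move=> l3; rewrite /std_dev /variance covariance_AP_count. Qed.

Lemma standardize_AP_count l w : (2 < l)%N ->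
  standardize P (AP_count R S l) w = std_ap_count p l (S w).
Proof.
by move=> l3; rewrite /standardize expectation_AP_count// std_dev_AP_count.
Qed.

End transfer.

Lemma settles_constant_seq (l : nat -> nat) : constant_seq l \/ l @ \oo --> \oo -> settles l.
Proof.
case=> [[c lc]|]; [left; exists c|by right].
by near=> n; apply: lc; near: n; exact: nbhs_infty_gt.
Unshelve. all: by end_near. Qed.

Theorem theorem2 (R : realType)
  (l1 l2 : nat -> nat) (p : nat -> R)
  (d : nat -> measure_display) (T : forall n : nat, measurableType (d n))
  (P : forall n : nat, probability (T n) R)
  (S : forall n : nat, T n -> {set 'I_n})
  (hS : forall n : nat, binomial_subset (P n) (S n) (p n))
  (hl1 : forall n : nat, (0 < n)%N -> (3 <= l1 n)%N)
  (hl2 : forall n : nat, (0 < n)%N -> (3 <= l2 n)%N)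
  (hl1_cst : constant_seq l1 \/ l1 @ \oo --> \oo)
  (hl2_cst : constant_seq l2 \/ l2 @ \oo --> \oo)
  (hl12 : forall n : nat, (0 < n)%N -> (l2 n < l1 n)%N)
  (hl1_log : (l1 n)%:R / ln n%:R @[n --> \oo] --> (0 : R))
  (hp : forall n : nat, (0 < n)%N -> 0 < p n < 1)
  (hp9 : p n * (l1 n)%:R ^+ 9 @[n --> \oo] --> (0 : R))
  (hnp : n%:R ^+ 2 * p n ^+ l1 n * (l1 n)%:R ^- 9 @[n --> \oo] --> +oo) :
  let theta := fun n : nat => n%:R * p n ^+ (l1 n).-1 * (l1 n)%:R in
  let X1 := fun n : nat => AP_count R (S n) (l1 n) in
  let X2 := fun n : nat => AP_count R (S n) (l2 n) in
  (exists L : \bar R, (0 <= L)%E /\ (theta n)%:E @[n --> \oo] --> L) ->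
  exists kappa : R,
    correlation (P n) (X1 n) (X2 n) @[n --> \oo] --> kappa /\
    (exists N : probability (measurableTypeR R * measurableTypeR R)%type R,
       bivariate_normal N (0, 0)
         (\matrix_(i < 2, j < 2) (if i == j then 1 else kappa)) /\
       cvg_in_distribution P
         (fun n w => (standardize (P n) (X1 n) w, standardize (P n) (X2 n) w)) N) /\
    (theta @ \oo --> (0 : R) -> kappa = 0) /\
    ((exists c : R, 0 < c /\ theta @ \oo --> c) \/
       (theta @ \oo --> +oo /\ constant_seq l2) ->
       0 < kappa < 1) /\
    (theta @ \oo --> +oo /\ l2 @ \oo --> \oo -> kappa = 1).
Proof.
move=> theta X1 X2 hL.
have n0 : \forall n \near \oo, (0 < n)%N by exact: nbhs_infty_gt.
have rg : ap_regime l1 l2 p.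
  split => //; try exact: settles_constant_seq; apply: filterS n0 => n n0.
  - exact: hl2.
  - exact: hl12.
  - exact: hp.
have pp n : (0 < n)%N -> 0 <= p n <= 1 by move=> /hp/andP[a b]; rewrite !ltW.
have [kappa [hk /andP[k0 k1] th0 thc thy]] := ap_correlation_limit rg hL.
have k1' : `|kappa| <= 1 by rewrite ger0_norm.
exists kappa; split; [|split; [|split; [exact: th0|split; [|exact: thy]]]].
- apply: cvg_trans hk; apply: near_eq_cvg; apply: filterS n0 => n n0.
  rewrite /correlation /X1 /X2 (covariance_AP_count (hS n)) ?pp ?hl1 ?hl2//.
  by rewrite !(std_dev_AP_count (hS n)) ?pp ?hl1 ?hl2.
- exists (affine_gaussian (correlation_factor kappa)); split.
    by rewrite -correlation_factorE//; exact: affine_gaussian_bivariate_normal.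
  move=> f cf [M fM].
  have h := std_ap_count_clt rg hp k1' hk cf (ex_intro _ M fM).
  (* Both sides are moved from extended to ordinary reals, where the convergence was proved; [f] is
     integrable as a bounded function made measurable by [continuous_measurable2]. *)
  have -> : (\int[affine_gaussian (correlation_factor kappa)]_z (f z)%:E)%E =
      (\int[affine_gaussian (correlation_factor kappa)]_z f z)%:E.
    rewrite /Rintegral fineK//; apply: integrable_fin_num => //.
    exact: (integrable_bounded _ (continuous_measurable2 cf fM) fM).
  apply: (@cvg_trans _ ((bern_mean (p n) (fun A : {set 'I_n} =>
      f (std_ap_count (p n) (l1 n) A, std_ap_count (p n) (l2 n) A)))%:E @[n --> \oo])); last first.
    by apply: cvg_EFin; [near=> n|exact: h].
  apply: near_eq_cvg; apply: filterS n0 => n n0.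
  rewrite -(expectation_binomial_subset (hS n)); congr ('E_(_)[_])%E.
  apply/funext => w /=.
  by rewrite !(standardize_AP_count (hS n)) ?pp ?hl1 ?hl2.
- case=> [|[hy [c lc]]]; first by move=> h; apply: thc; left.
  apply: thc; right; split => //; exists c; apply: filterS n0 => n; exact: lc.
Unshelve. all: by end_near. Qed.
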